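(* Let $(\mathbb{P}^{s,x})_{(s,x)\in[0,T]\times E}$ be a canonical Markov class associated to a transition function measurable in time, which solves a well-posed martingale problem associated to $(\mathcal{D}(a),a,V)$. Let $g:E\to\mathbb{R}$ and $f:[0,T]\times E\times\mathbb{R}\times\mathbb{R}\to\mathbb{R}$ be Borel functions such that: $g(X_T)$ is in $L^2$ under $\mathbb{P}^{s,x}$ for every $(s,x)$; $f(\cdot,\cdot,0,0)\in\mathcal{L}^2_X$; and there exist $K^Y,K^Z>0$ such that $|f(t,x,y,z)-f(t,x,y',z')|\le K^Y|y-y'|+K^Z|z-z'|$ for all $(t,x,y,y',z,z')$. (i) A classical solution $u$ of $Pseudo\text{-}PDE(f,g)$ such that $\Gamma(u,u)\in\mathcal{L}^1_X$ is also a martingale solution of $Pseudo\text{-}PDE(f,g)$. (ii) Conversely, if $u$ is a martingale solution of $Pseudo\text{-}PDE(f,g)$ belonging to $\mathcal{D}(a)$, then $u$ is a classical solution of $Pseudo\text{-}PDE(f,g)$ up to a zero potential set, meaning that the equality $a(u)+f(\cdot,\cdot,u,\sqrt{\Gamma(u,u)})=0$ holds up to a set of zero potential (and $u(T,\cdot)=g$).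
   Context: Canonical space: $T>0$, $E$ is a Polish space with Borel $\sigma$-field $\mathcal{B}(E)$, $\Omega$ is the set of functions $[0,T]\to E$ that are right-continuous with left limits and continuous at time $T$, $X_t(\omega)=\omega(t)$, $\mathcal{F}=\sigma(X_r|r\in[0,T])$, $\mathcal{F}_t=\bigcap_{s\in]t,T]}\sigma(X_r|r\le s)$ for $t<T$ and $\mathcal{F}_T=\mathcal{F}$. Markov class: a transition function measurable in time is $p:[0,T]\times E\times[0,T]\times\mathcal{B}(E)\to[0,1]$ such that $(s,x)\mapsto p(s,x,t,A)$ is Borel for all $t,A$; $p(s,x,t,\cdot)$ is a probability measure; $p(s,x,t,A)=\mathbf{1}_A(x)$ if $t\le s$; and $\int_Ep(s,x,t,dy)p(t,y,u,A)=p(s,x,u,A)$ if $s<t<u$. A canonical Markov class associated to $p$ is a family of probability measures $(\mathbb{P}^{s,x})$ on $(\Omega,\mathcal{F})$ with $\mathbb{P}^{s,x}(X_t\in A)=p(s,x,t,A)$ for all $t\in[0,T]$, $A\in\mathcal{B}(E)$, and $\mathbb{P}^{s,x}(X_u\in A|\mathcal{F}_t)=p(t,X_t,u,A)$ $\mathbb{P}^{s,x}$-a.s. for $s\le t\le u$. $\mathcal{F}^{s,x}$ is the $\mathbb{P}^{s,x}$-completion of $\mathcal{F}$ and $\mathcal{F}^{s,x}_t$ is the $\mathbb{P}^{s,x}$-closure of $\mathcal{F}_t$ (augmentation by the $\mathbb{P}^{s,x}$-null sets). Martingale problem: $\mathcal{D}(a)$ is a linear algebra of Borel functions $[0,T]\times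 E\to\mathbb{R}$, $a$ is a linear operator from $\mathcal{D}(a)$ to the Borel functions $[0,T]\times E\to\mathbb{R}$, and $V:[0,T]\to\mathbb{R}_+$ is a non-decreasing continuous function with $V_0=0$. $(\mathbb{P}^{s,x})$ solves the martingale problem associated to $(\mathcal{D}(a),a,V)$ if for every $(s,x)$: (a) $\mathbb{P}^{s,x}(\forall t\in[0,s],X_t=x)=1$; (b) for every $\phi\in\mathcal{D}(a)$, $t\mapsto\phi(t,X_t)-\phi(s,x)-\int_s^ta(\phi)(r,X_r)dV_r$, $t\in[s,T]$, is a cadlag $(\mathbb{P}^{s,x},(\mathcal{F}_t)_{t\in[s,T]})$-local martingale. It is well-posed if for every $(s,x)$, $\mathbb{P}^{s,x}$ is the only probability measure on $(\Omega,\mathcal{F})$ satisfying (a) and (b). Localizing sequences are a.s. increasing sequences of stopping times $\tau_n$ with values in $[0,T]\cup\{+\infty\}$ for which a.s. there is $N$ with $\tau_N=+\infty$. For $\phi,\psi\in\mathcal{D}(a)$, $\Gamma(\phi,\psi)=a(\phi\psi)-\phi a(\psi)-\psi a(\phi)$. For $p\ge1$, $\mathcal{L}^p_X$ is the set of Borel $h:[0,T]\times E\to\mathbb{R}$ with $\mathbb{E}^{s,x}[\int_s^T|h(r,X_r)|^pdV_r]<\infty$ for every $(s,x)$; $\mathcal{L}^0_X$ is the set of Borel $h$ with $\int_s^T|h|(r,X_r)dV_r<\infty$ $\mathbb{P}^{s,x}$-a.s. for every $(s,x)$. A Borel set $A\subset[0,T]\times E$ is of zero potential if $\mathbb{E}^{s,x}[\int_s^T\mathbf{1}_{\{(t,X_t)\in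 A\}}dV_t]=0$ for every $(s,x)$; $L^0_X$ is the quotient of $\mathcal{L}^0_X$ by equality up to sets of zero potential. Extended operators: $\mathcal{D}(\mathfrak{a})$ is the set of Borel $\phi:[0,T]\times E\to\mathbb{R}$ for which there is a Borel $\psi:[0,T]\times E\to\mathbb{R}$ such that under every $\mathbb{P}^{s,x}$ the process $\mathbf{1}_{[s,T]}\left(\phi(\cdot,X_\cdot)-\phi(s,x)-\int_s^\cdot\psi(r,X_r)dV_r\right)$ has a cadlag modification belonging to $\mathcal{H}^2_0$ (cadlag square integrable martingales vanishing at $0$, in the basis $(\Omega,\mathcal{F}^{s,x},(\mathcal{F}^{s,x}_t),\mathbb{P}^{s,x})$). This modification is denoted $M[\phi]^{s,x}$; $\psi$ is unique up to zero potential sets and its class in $L^0_X$ is denoted $\mathfrak{a}(\phi)$. For $\phi_1,\phi_2\in\mathcal{D}(\mathfrak{a})$, $\mathfrak{G}(\phi_1,\phi_2)\in L^0_X$ is the (unique) class of Borel functions such that $\langle M[\phi_1]^{s,x},M[\phi_2]^{s,x}\rangle=\int_s^\cdot\mathfrak{G}(\phi_1,\phi_2)(r,X_r)dV_r$ on $[s,T]$ under every $\mathbb{P}^{s,x}$. ($\mathfrak{G}(\phi,\phi)$ is non-negative up to a zero potential set, so $\sqrt{\mathfrak{G}(\phi,\phi)}$ makes sense as a class.) $Pseudo\text{-}PDE(f,g)$: $a(u)(t,x)+f\left(t,x,u(t,x),\sqrt{\Gamma(u,u)(t,x)}\right)=0$ on $[0,T]\times E$, $u(T,\cdot)=g$.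 A classical solution is a $u\in\mathcal{D}(a)$ verifying these equalities pointwise. A martingale solution is a $u\in\mathcal{D}(\mathfrak{a})$ with $\mathfrak{a}(u)=-f(\cdot,\cdot,u,\sqrt{\mathfrak{G}(u,u)})$ (equality in $L^0_X$, i.e. up to a zero potential set) and $u(T,\cdot)=g$ (pointwise equality). *)

(* Defs.v *)
From HB Require Import structures.
From mathcomp Require Import all_boot all_order all_algebra.
From mathcomp Require Import all_classical all_reals all_analysis.
From mathcomp Require Import measurable_realfun.

Set Implicit Arguments.
Unset Strict Implicit.
Unset Printing Implicit Defensive.
Import Order.TTheory GRing.Theory Num.Theory.
Import numFieldNormedType.Exports.

Local Open Scope classical_set_scope.
Local Open Scope ring_scope.

Definition borel (X : ptopologicalType) := g_sigma_algebraType (@open X).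
HB.instance Definition _ (X : ptopologicalType) := Measurable.on (borel X).

(** A Polish space is presented by a complete metric: for a
    [completePseudoMetricType], being Hausdorff says that the pseudometric
    separates points. *)
Definition polish (R : realType) (E : completePseudoMetricType R) :=
  hausdorff_space E /\ exists2 D : set E, countable D & dense D.

(** * The time interval [0, T] *)

Section time.
Context {R : realType} (T : {posnum R}).

Definition time := set_type `[0, T%:num]%classic.

Lemma time0_subproof : 0 \in `[0, T%:num]%classic.
Proof. by rewrite inE /= in_itv /= lexx ge0. Qed.
Definition time0 : time := exist _ 0 time0_subproof.

Lemma timeT_subproof : T%:num \in `[0, T%:num]%classic.
Proof. by rewrite inE /= in_itv /= lexx ge0. Qed.
Definition timeT : time := exist _ T%:num timeT_subproof.

HB.instance Definition _ := Topological.on time.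
HB.instance Definition _ := isPointed.Build time time0.

End time.
Arguments timeT {R T}.
Arguments time0 {R T}.

Definition time_val (R : realType) (T : {posnum R}) (t : time T) : R := \val t.

(** Inverse of [time_val] on [0, T]; it is [time0] outside of [0, T]. *)
Definition time_of (R : realType) (T : {posnum R}) (r : R) : time T :=
  insubd time0 r.
Arguments time_of {R T}.

(** [f] is cadlag on [s, T].  The left and right neighbourhood filters are
    improper at the end points [s] and [T], where nothing is required. *)
Definition cadlag_from (R : realType) (T : {posnum R}) (U : topologicalType)
    (s : time T) (f : time T -> U) :=
  forall t, time_val s <= time_val t ->
    (f r @[r --> within [set r | time_val t < time_val r] (nbhs t)] --> f t) /\
    exists l : U,
      f r @[r --> within [set r | time_val s <= time_val r < time_val t]
                         (nbhs t)] --> l.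

(** * The canonical space *)

Section canonical_space.
Context {R : realType} (T : {posnum R}) (E : completePseudoMetricType R).

Record rcll_path := RcllPath {
  path_fun :> time T -> E ;
  path_cadlag : cadlag_from time0 path_fun ;
  path_cont_end : path_fun r @[r --> timeT] --> path_fun timeT }.

HB.instance Definition _ := gen_eqMixin rcll_path.
HB.instance Definition _ := gen_choiceMixin rcll_path.

Lemma cst_cadlag (x : E) : cadlag_from time0 (fun _ : time T => x).
Proof.
by move=> t _; split; [|exists x];
  apply: cvg_near_cst; exact: (filterE (F := within _ _)).
Qed.

Lemma cst_cont_end (x : E) :
  (fun _ : time T => x) r @[r --> timeT] --> (fun _ : time T => x) timeT.
Proof. exact: (@cvg_cst E x _ _ (nbhs_filter (timeT : time T))). Qed.

HB.instance Definition _ :=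
  isPointed.Build rcll_path
    (RcllPath (@cst_cadlag point) (@cst_cont_end point)).

(** The sets [X_t^-1(B)] with [t] in [D] and [B] Borel. *)
Definition cylinder (D : set (time T)) : set_system rcll_path :=
  [set A | exists2 t, D t & exists2 B : set (borel E), measurable B &
           A = [set w : rcll_path | B (w t)]].

Definition Omega := g_sigma_algebraType (cylinder setT).
HB.instance Definition _ := Measurable.on Omega.

Definition canonical_filtration (t : time T) : set_system Omega :=
  [set A : set Omega | if time_val t < T%:num
           then forall s : time T, time_val t < time_val s ->
                  <<s cylinder [set r | time_val r <= time_val s] >> A
           else (measurable : set_system Omega) A].

End canonical_space.

(** * Martingales *)

Section martingales.
Context {R : realType} {T : {posnum R}} {d : measure_display}
  {W : measurableType d}.
Implicit Types (Q : probability W R) (F : time T -> set_system W).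
Implicit Types (X Y : W -> R) (M N A : time T -> W -> R).

Definition measurable_wrt (S : Type) (G : set_system S) (X : S -> R) :=
  forall B : set R, measurable B -> G (X @^-1` B).

(** [G] augmented by the [Q]-null sets. *)
Definition augment Q (G : set_system W) : set_system W :=
  <<s G `|` [set A | Q.-negligible A] >>.

(** Expectations of random variables that are only measurable with respect to
    the [Q]-completion also occur below.  The library integral of a nonnegative
    function is the supremum of the integrals of the measurable simple functions
    below it, so on such variables it agrees with the integral of the
    completion of [Q]. *)
Definition L1 Q X := (\int[Q]_w `|X w|%:E < +oo)%E.
Definition L2 Q X := (\int[Q]_w (X w ^+ 2)%:E < +oo)%E.

(** [Y] is a version of the conditional expectation E[X | G]. *)
Definition is_condexp Q (G : set_system W) X Y :=
  [/\ L1 Q X, L1 Q Y, measurable_wrt G Y &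
      forall B, G B ->
        (\int[Q]_(w in B) (X w)%:E = \int[Q]_(w in B) (Y w)%:E)%E].

(** Martingale on [s, T]; adaptedness and integrability are the case [r = t]. *)
Definition martingale Q F (s : time T) M :=
  forall r t, time_val s <= time_val r -> time_val r <= time_val t ->
    is_condexp Q (F r) (M t) (M r).

(** Stopping times with values in [s, T] or infinite ([None] is +oo). *)
Definition stopping_time F (s : time T) (tau : W -> option (time T)) :=
  (forall w r, tau w = Some r -> time_val s <= time_val r) /\
  (forall t, time_val s <= time_val t ->
    F t [set w | exists2 r, tau w = Some r & time_val r <= time_val t]).

Definition stopped (tau : W -> option (time T)) M : time T -> W -> R :=
  fun t w => match tau w with
             | Some r => if time_val r <= time_val t then M r w else M t w
             | None => M t w
             end.

Definition stop_le (tau1 tau2 : option (time T)) : Prop :=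
  match tau1, tau2 with
  | Some r1, Some r2 => time_val r1 <= time_val r2
  | None, Some _ => False
  | _, None => True
  end.

Definition localizing Q F (s : time T) (tau : nat -> W -> option (time T)) :=
  [/\ forall n, stopping_time F s (tau n),
      {ae Q, forall w, forall n, stop_le (tau n w) (tau n.+1 w)} &
      {ae Q, forall w, exists n, tau n w = None}].

(** Paths are required to be cadlag up to a null set. *)
Definition cadlag_local_martingale Q F (s : time T) M :=
  {ae Q, forall w, cadlag_from s (M ^~ w)} /\
  exists2 tau, localizing Q F s tau &
    forall n, martingale Q F s (stopped (tau n) M).

(** The space H^2_0 on [0, T]. *)
Definition H20 Q F M :=
  [/\ martingale Q F time0 M, {ae Q, forall w, cadlag_from time0 (M ^~ w)},
      {ae Q, forall w, M time0 w = 0} & forall t, L2 Q (M t)].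

Definition predictable_sets F : set_system (time T * W) :=
  <<s [set C | (exists2 B, F time0 B & C = [set time0] `*` B) \/
               (exists r t : time T, exists2 B, F r B &
                  C = [set u | time_val r < time_val u <= time_val t]
                      `*` B)] >>.

(** [A] is the angle bracket <M, N>: the predictable finite variation process
    null at 0 such that M N - A is a local martingale. *)
Definition angle_bracket Q F M N A :=
  [/\ measurable_wrt (predictable_sets F) (fun z => A z.1 z.2),
      {ae Q, forall w, A time0 w = 0},
      {ae Q, forall w, cadlag_from time0 (A ^~ w)},
      {ae Q, forall w,
        bounded_variation 0 T%:num (fun r => A (time_of r) w)} &
      cadlag_local_martingale Q F time0 (fun t w => M t w * N t w - A t w)].

End martingales.

(** * Markov classes, martingale problems and pseudo-PDEs *)

Section pseudo_pde.
Context {R : realType} {T : {posnum R}} {E : completePseudoMetricType R}.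

Local Notation spacetime := (borel (time T) * borel E)%type.
Local Notation fam := (time T -> E -> probability (Omega T E) R).

Definition transition_function
    (p : time T -> E -> time T -> probability (borel E) R) :=
  [/\ forall t (A : set (borel E)), measurable A ->
        measurable_fun setT (fun z : spacetime => p z.1 z.2 t A : \bar R),
      forall s x t (A : set (borel E)), measurable A ->
        time_val t <= time_val s -> p s x t A = \d_(x : borel E) A &
      forall s t u x (A : set (borel E)), measurable A ->
        time_val s < time_val t -> time_val t < time_val u ->
        (\int[p s x t]_y p t y u A = p s x u A)%E].

Definition canonical_markov_class
    (p : time T -> E -> time T -> probability (borel E) R) (P : fam) :=
  (forall s x t (A : set (borel E)), measurable A ->
     P s x [set w : Omega T E | A (w t)] = p s x t A) /\
  (forall s x t u (A : set (borel E)), measurable A ->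
     time_val s <= time_val t -> time_val t <= time_val u ->
     is_condexp (P s x) (@canonical_filtration R T E t)
       (fun w => \1_A (w u : borel E)) (fun w => fine (p t (w t) u A))).

(** [V] is given on the whole real line, but only its increments on [0, T]
    are ever used. *)
Definition clock (V : cumulative R R) :=
  {within `[0, T%:num], continuous V} /\ V 0 = 0.

Section clocked.
Variable V : cumulative R R.

(** Integrals of h(r, X_r) against dV_r. *)
Definition eintegral_along (h : spacetime -> \bar R) (s t : time T)
    (w : Omega T E) : \bar R :=
  (\int[lebesgue_stieltjes_measure V]_(r in `]time_val s, time_val t])
     h (time_of r, w (time_of r)))%E.

Definition integral_along (h : spacetime -> R) (s t : time T)
    (w : Omega T E) : R :=
  \int[lebesgue_stieltjes_measure V]_(r in `]time_val s, time_val t])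
     h (time_of r, w (time_of r)).

Definition as_integrable_along (Q : probability (Omega T E) R)
    (h : spacetime -> R) (s : time T) :=
  {ae Q, forall w, (eintegral_along (fun z => `|h z|%:E) s timeT w < +oo)%E}.

Section generator.
Variables (D : set (spacetime -> R)) (a : (spacetime -> R) -> spacetime -> R).

Definition function_algebra :=
  [/\ forall phi, D phi -> measurable_fun setT phi,
      D (fun=> 0),
      forall phi psi, D phi -> D psi -> D (fun z => phi z + psi z),
      forall (c : R) phi, D phi -> D (fun z => c * phi z) &
      forall phi psi, D phi -> D psi -> D (fun z => phi z * psi z)].

Definition linear_operator :=
  [/\ forall phi, D phi -> measurable_fun setT (a phi),
      forall phi psi, D phi -> D psi ->
        a (fun z => phi z + psi z) = (fun z => a phi z + a psi z) &
      forall (c : R) phi, D phi ->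
        a (fun z => c * phi z) = (fun z => c * a phi z)].

(** [Q] satisfies (a) and (b) for the starting point (s, x).  The almost sure
    integrability says that the integral in (b) is well defined. *)
Definition solves_from (s : time T) (x : E) (Q : probability (Omega T E) R) :=
  Q [set w | forall t, time_val t <= time_val s -> w t = x] = 1%E /\
  forall phi, D phi ->
    as_integrable_along Q (a phi) s /\
    cadlag_local_martingale Q (@canonical_filtration R T E) s
      (fun t w => phi (t, w t) - phi (s, x) - integral_along (a phi) s t w).

Definition solves_martingale_problem (P : fam) :=
  forall s x, solves_from s x (P s x).

Definition well_posed (P : fam) :=
  forall s x (Q : probability (Omega T E) R), solves_from s x Q ->
    forall A, measurable A -> Q A = P s x A.

Definition Gamma (phi psi : spacetime -> R) : spacetime -> R :=
  fun z => a (fun z' => phi z' * psi z') z - phi z * a psi z - psi z * a phi z.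

Definition classical_solution (f : spacetime * R * R -> R) (g : E -> R)
    (u : spacetime -> R) :=
  [/\ D u,
      forall z, a u z + f (z, u z, Num.sqrt (Gamma u u z)) = 0 &
      forall x, u (timeT, x) = g x].

End generator.

Section markov.
Variable P : fam.

Definition LpX (q : R) (h : spacetime -> R) :=
  measurable_fun setT h /\
  forall s x, (\int[P s x]_w
    eintegral_along (fun z => (`|h z| `^ q)%:E) s timeT w < +oo)%E.

Definition L0X (h : spacetime -> R) :=
  measurable_fun setT h /\ forall s x, as_integrable_along (P s x) h s.

Definition zero_potential (A : set spacetime) :=
  measurable A /\
  forall s x, (\int[P s x]_w
    eintegral_along (fun z => (\1_A z)%:E) s timeT w = 0)%E.

(** The classes of L^0_X are represented by sets of functions, and compared
    through representatives by [eq_zp]. *)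
Definition eq_zp (h k : spacetime -> R) := zero_potential [set z | h z <> k z].

Definition completed_filtration (s : time T) (x : E) (t : time T) :
    set_system (Omega T E) :=
  augment (P s x) (@canonical_filtration R T E t).

(** [M] is M[phi]^{s,x}, where [psi] represents the extended generator at
    [phi]. *)
Definition ext_martingale (s : time T) (x : E) (phi psi : spacetime -> R)
    (M : time T -> Omega T E -> R) :=
  H20 (P s x) (completed_filtration s x) M /\
  forall t, {ae (P s x), forall w,
    M t w = if time_val s <= time_val t
            then phi (t, w t) - phi (s, x) - integral_along psi s t w
            else 0}.

(** The class [ext_a phi], as the set of its representatives. *)
Definition ext_a (phi : spacetime -> R) : set (spacetime -> R) :=
  [set psi | [/\ measurable_fun setT phi, L0X psi &
     forall s x, exists M, ext_martingale s x phi psi M]].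

Definition ext_domain : set (spacetime -> R) :=
  [set phi | ext_a phi !=set0].

(** The class of the extended carre du champ of [phi1] and [phi2], as the set
    of its representatives. *)
Definition ext_Gamma (phi1 phi2 : spacetime -> R) : set (spacetime -> R) :=
  [set h | [/\ ext_domain phi1, ext_domain phi2, L0X h &
     forall psi1 psi2, ext_a phi1 psi1 -> ext_a phi2 psi2 ->
     forall s x M1 M2,
       ext_martingale s x phi1 psi1 M1 -> ext_martingale s x phi2 psi2 M2 ->
       exists2 A, angle_bracket (P s x) (completed_filtration s x) M1 M2 A &
         {ae (P s x), forall w, forall t, time_val s <= time_val t ->
           A t w = integral_along h s t w}]].

Definition martingale_solution (f : spacetime * R * R -> R) (g : E -> R)
    (u : spacetime -> R) :=
  [/\ ext_domain u,
      exists psi h, [/\ ext_a u psi, ext_Gamma u u h &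
        eq_zp psi (fun z => - f (z, u z, Num.sqrt (h z)))] &
      forall x, u (timeT, x) = g x].

End markov.
End clocked.
End pseudo_pde.

(* Main.v *)
From HB Require Import structures.
Require Import Defs.
From mathcomp Require Import all_boot all_order all_algebra.
From mathcomp Require Import all_classical all_reals all_analysis.
From mathcomp Require Import measurable_realfun.
From mathcomp Require Import ring lra.
Import Order.TTheory GRing.Theory Num.Theory.
Import numFieldNormedType.Exports.

Local Open Scope classical_set_scope.
Local Open Scope ring_scope.

(** For [u] in [D(a)] the function [u^2] is in [D(a)] as well, so that
    [M = u(., X) - u(s, x) - A] with [A = \int a(u)(r, X_r) dV_r], and the same process
    for [u^2], are local martingales.  As [A] is continuous with finite variation,
    [M A - \int M dA] is a local martingale: up to the time at which the total variation of [A]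
    reaches a level this is Fubini's theorem and the martingale property of [M].  Hence
    [M^2 - \int Gamma(u, u)(r, X_r) dV_r] is a local martingale.  Applied to a local martingale
    [C = \int k(r, X_r) dV_r], integration by parts makes [C^2 / 2] a nonnegative local martingale
    starting at 0, so that [C = 0].

    For (i), [E (M_t^tau)^2] is bounded by [E \int |Gamma(u, u)|] for the localizing times [tau],
    so that [M] is a square integrable martingale, whose bracket is [\int Gamma(u, u) dV].
    For (ii), [M] and [M^u] differ by [\int (a(u) - psi) dV] and their brackets by
    [\int (Gamma(u, u) - h) dV]; both vanish, and so do their densities up to zero potential.

    The usual conditions hold on the completed probability space, to which the processes are
    transferred, extended by 0 before [s]. *)

Set Implicit Arguments.
Unset Strict Implicit.
Unset Printing Implicit Defensive.

(** * Time *)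

Section timelems.
Context {R : realType} {T : {posnum R}}.
Implicit Types (r t : time T).

(** No stochastic integral against [M] is formed. With [u(., X) = M + u(s, x) + A] and [N] the local
    martingale of [u^2], expanding the square gives [M^2 - \int Gamma(u, u) dV = N - 2 u(s, x) M - 2
    (M A - \int M dA)], where only an integral against the finite variation process [A] has to be
    compensated. The level on the variation of [A] makes Fubini's theorem applicable: if the
    variation up to [t] is at most [c], then [E \int |M| |dA| <= c E |M_t|]. The processes of [u]
    and of [u^2] come with unrelated localizing sequences, and the variation of [A] with a third;
    optional stopping lets the minimum of the three serve for all. It rests on right-continuity and
    on the uniform integrability of the discretized values. The extended operators speak of every
    representative [psi] and of every version of [M[u]]. Even (i) therefore needs the uniqueness of
    the decomposition, by which all versions are identified with the process built from [a(u)]. In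
    (ii) the given bracket is an integral of [h] from [s] on only, so that a local martingale has to
    be restarted at [s]. *)

Lemma time_val_ge0 t : 0 <= time_val t.
Proof. by have := valP t; rewrite inE /= in_itv /= => /andP[]. Qed.

Lemma time_val_leT t : time_val t <= T%:num.
Proof. by have := valP t; rewrite inE /= in_itv /= => /andP[]. Qed.

Lemma time_val_inj r t : time_val r = time_val t -> r = t.
Proof. exact: val_inj. Qed.

Lemma time_of_val t : time_of (time_val t) = t.
Proof. exact: valKd. Qed.

Lemma time_ofK (x : R) : 0 <= x -> x <= T%:num -> time_val (time_of x : time T) = x.
Proof.
by move=> x0 xT; rewrite /time_val insubdK// inE /= in_itv /= x0.
Qed.

Lemma time_nbhsP t (A : set (time T)) :
  nbhs t A <-> exists2 e, 0 < e & forall r, `|time_val r - time_val t| < e -> A r.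
Proof.
split.
  move=> [B [[C oC <-] /= Ct] BA].
  have /nbhs_ballP[e e0 eC] : nbhs (time_val t) C by apply: open_nbhs_nbhs; split.
  exists e => // r re; apply: BA; apply: eC; rewrite /ball/= distrC; exact: re.
move=> [e e0 h]; apply: (@filterS _ (nbhs t) _ ((fun r : time T => time_val r) @^-1` ball (time_val t) e)).
  by move=> r /=; rewrite /ball /= distrC => /h.
by apply: initial_continuous; exact: nbhsx_ballx.
Qed.

Lemma cvg_timeP (u : nat -> time T) t :
  (time_val (u n) @[n --> \oo] --> time_val t) -> u n @[n --> \oo] --> t.
Proof.
move=> ut A /time_nbhsP[e e0 eA].
move/cvgrPdist_lt : ut => /(_ e e0); apply: filterS => n /= h.
by apply: eA; rewrite distrC.
Qed.

(** Sequential right-continuity in which terms may equal the limit, as happens when a time is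
    rounded up to a grid; [cadlag_from] looks at strictly later times only. *)
Definition rc (U : topologicalType) (X : time T -> U) :=
  forall (u : nat -> time T) t, (forall n, time_val t <= time_val (u n)) ->
  time_val (u n) @[n --> \oo] --> time_val t -> X (u n) @[n --> \oo] --> X t.

Lemma cadlag_rc (U : topologicalType) (X : time T -> U) : cadlag_from time0 X -> rc X.
Proof.
move=> cX u t tu ut.
have t0 : time_val (time0 : time T) <= time_val t.
  by rewrite {1}/time_val/= time_val_ge0.
have [Xt _] := cX t t0.
move=> A At; have {Xt} := Xt _ At; rewrite /= /within /=.
move/time_nbhsP => [e e0 eA].
move/cvgrPdist_lt : ut => /(_ e e0); apply: filterS => n /= h.
have := tu n; rewrite le_eqVlt => /predU1P[/time_val_inj <-|tn].
  exact: nbhs_singleton.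
by apply: eA => //; rewrite distrC.
Qed.

Definition tmin r t : time T := if time_val r <= time_val t then r else t.

Lemma tmin_val r t : time_val (tmin r t) = Num.min (time_val r) (time_val t).
Proof. by rewrite /tmin; case: leP. Qed.

(** The points of mesh [1/(n+1)], replaced by [T] beyond [T]. [cell] is the index of the first grid
    point at or after [r], so that [dsc] rounds up: this fits right-continuity, and a rounded
    stopping time takes finitely many values. *)
Definition grid (n k : nat) : time T := time_of (Num.min T%:num (k%:R / n.+1%:R)).

Definition cell (n : nat) r : nat := `|Num.ceil (time_val r * n.+1%:R)|%N.

Definition dsc n r := grid n (cell n r).

Lemma grid_val n k : time_val (grid n k) = Num.min T%:num (k%:R / n.+1%:R).
Proof.
by rewrite time_ofK// ge_min lexx.
Qed.

(** The adjunction between the ceiling and the embedding of the integers; the cap at [T] is harmless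
    because [r] is at most [T]. Events about indices become events about times. *)
Lemma cell_leE n r k : (cell n r <= k)%N = (time_val r <= time_val (grid n k)).
Proof.
rewrite grid_val le_min time_val_leT/= ler_pdivlMr//.
have -> : (cell n r <= k)%N = (Num.ceil (time_val r * n.+1%:R) <= k%:Z)%R.
  rewrite -lez_nat /cell gez0_abs// ceil_ge0 (lt_le_trans (ltrN10 _))//.
  by rewrite mulr_ge0// time_val_ge0.
by rewrite ceil_le_int.
Qed.

Lemma dsc_ge n r : time_val r <= time_val (dsc n r).
Proof. by rewrite -cell_leE. Qed.

Lemma cell_mono n r t : time_val r <= time_val t -> (cell n r <= cell n t)%N.
Proof. by move=> rt; rewrite cell_leE (le_trans rt (dsc_ge n t)). Qed.

Lemma cell_bound n r : (cell n r < (cell n timeT).+1)%N.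
Proof. by rewrite ltnS cell_mono// {2}/time_val/= time_val_leT. Qed.

Lemma dsc_le n r : time_val (dsc n r) <= time_val r + n.+1%:R^-1.
Proof.
rewrite grid_val ge_min; apply/orP; right.
rewrite ler_pdivrMr// mulrDl mulVf ?pnatr_eq0//.
have x0 : 0 <= time_val r * n.+1%:R by rewrite mulr_ge0// time_val_ge0.
have -> : (cell n r)%:R = (Num.ceil (time_val r * n.+1%:R))%:~R :> R.
  by rewrite /cell natr_absz ger0_norm// ceil_ge0 (lt_le_trans (ltrN10 _)).
have := ceilB1_lt (time_val r * n.+1%:R); rewrite intrD /= => h.
by rewrite -lerBlDr ltW.
Qed.

Lemma invnS_cvg0 : (n.+1%:R^-1 : R) @[n --> \oo] --> 0.
Proof. exact: cvg_harmonic. Qed.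

Lemma dsc_cvg r : time_val (dsc n r) @[n --> \oo] --> time_val r.
Proof.
apply: (@squeeze_cvgr _ _ _ _ (fun=> time_val r) (fun n => time_val r + n.+1%:R^-1)).
- by apply: nearW => n; rewrite dsc_ge dsc_le.
- exact: cvg_cst.
- rewrite -[X in _ --> X]addr0; apply: cvgD; [exact: cvg_cst|exact: invnS_cvg0].
Qed.

Lemma tmin_cvg (u : nat -> time T) r t : time_val (u n) @[n --> \oo] --> time_val r ->
  time_val (tmin (u n) t) @[n --> \oo] --> time_val (tmin r t).
Proof.
move/cvgrPdist_lt => ur; apply/cvgrPdist_lt => e e0.
apply: filterS (ur e e0) => n; apply: le_lt_trans; rewrite !tmin_val.
have := ler_norm (time_val r - time_val (u n)).
have := ler_norm (- (time_val r - time_val (u n))); rewrite normrN.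
rewrite ler_norml !minEle; do 2 case: ifPn; rewrite -?ltNge => *;
  by apply/andP; split; lra.
Qed.

Lemma time_val_continuous : continuous (fun t : time T => time_val t).
Proof. exact: initial_continuous. Qed.

Lemma measurable_time_val : measurable_fun setT (fun t : borel (time T) => time_val t).
Proof.
apply: (@measurability _ _ _ _ setT (fun t : borel (time T) => time_val t)
  _ (RGenOpens.measurableE R)).
move=> _ [_ [x [y ->]] <-]; rewrite setTI; apply: sub_sigma_algebra.
have /continuousP := time_val_continuous; apply; exact: interval_open.
Qed.

Lemma measurable_time_of : measurable_fun setT (time_of : R -> borel (time T)).
Proof.
apply: (@measurability _ _ _ (borel (time T)) setT
  (time_of : R -> borel (time T)) open erefl).
move=> _ [B [C oC <-] <-]; rewrite setTI.
(* Outside of [[0, T]] the default value [time0] is taken, so that there the preimage is everything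
   or nothing according to whether 0 is in [C]. *)
have -> : time_of @^-1` (set_val @^-1` C : set (time T)) =
  (`[0, T%:num] `&` C) `|` (~` `[0, T%:num] `&` [set r : R | C 0]).
  apply/seteqP; split=> r /=; rewrite /time_of /insubd; case: insubP => /=.
  - by move=> t; rewrite inE /= => rI tr Ct; left; split => //; rewrite -tr.
  - by rewrite notin_setE /= => rI Ct; right.
  - move=> t; rewrite inE /= => rI tr [[_ Cr]|[//]].
    by have -> : set_val t = r by exact: tr.
  - by rewrite notin_setE /= => rI [[//]|[]].
apply: measurableU; apply: measurableI => //.
- exact: open_measurable.
- exact: measurableC.
- by have [C0|C0] := pselect (C 0); [rewrite (_ : mkset _ = setT)|rewrite (_ : mkset _ = set0)]; rewrite // predeqE; intuition.
Qed.

Lemma measurable_time_le (c : R) : measurable [set t : borel (time T) | time_val t <= c].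
Proof.
rewrite -[X in measurable X]setTI.
have -> : [set t | time_val t <= c] = (fun t : borel (time T) => time_val t) @^-1` `]-oo, c].
  by apply/seteqP; split => t /=; rewrite in_itv.
exact: measurable_time_val.
Qed.

Lemma measurable_time_ge (c : R) : measurable [set t : borel (time T) | c <= time_val t].
Proof.
rewrite -[X in measurable X]setTI.
have -> : [set t | c <= time_val t] = (fun t : borel (time T) => time_val t) @^-1` `[c, +oo[.
  by apply/seteqP; split => t /=; rewrite in_itv/= andbT.
exact: measurable_time_val.
Qed.

Lemma measurable_time1 (t : borel (time T)) : measurable [set t].
Proof.
have -> : [set t] = [set r : borel (time T) | time_val r <= time_val t] `&` [set r | time_val t <= time_val r].
  apply/seteqP; split => r /=; first by move=> ->.
  by move=> [rt tr]; apply/time_val_inj/le_anti; rewrite rt.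
by apply: measurableI; [exact: measurable_time_le|exact: measurable_time_ge].
Qed.

Lemma measurable_time_fun d (U : measurableType d) (f : U -> borel (time T)) :
  measurable_fun setT (fun x => time_val (f x)) -> measurable_fun setT f.
Proof.
move=> mf; rewrite (_ : f = time_of \o (fun x => time_val (f x))).
  exact: measurableT_comp measurable_time_of mf.
by apply/funext => x /=; rewrite time_of_val.
Qed.

Lemma measurable_tmin d (U : measurableType d) (f g : U -> borel (time T)) :
  measurable_fun setT f -> measurable_fun setT g ->
  measurable_fun setT (fun x => tmin (f x) (g x) : borel (time T)).
Proof.
move=> mf mg; apply: measurable_time_fun.
under eq_fun do rewrite tmin_val.
by apply: measurable_minr; exact: measurableT_comp measurable_time_val _.
Qed.

End timelems.

(** * Random variables measurable for a sub-sigma-algebra *)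

Lemma time0_le (R : realType) (T : {posnum R}) (t : time T) :
  time_val (time0 : time T) <= time_val t.
Proof. by rewrite {1}/time_val/= time_val_ge0. Qed.

Lemma time_leT (R : realType) (T : {posnum R}) (t : time T) :
  time_val t <= time_val (timeT : time T).
Proof. by rewrite {2}/time_val/= time_val_leT. Qed.

Section measurable_wrt.
Context d (W : measurableType d) (R : realType).
Implicit Types (X Y : W -> R) (G : set_system W).

(** A sigma-algebra generates itself, so that the closure properties of measurable functions carry
    over to [measurable_wrt]. *)
Lemma mwrtP G X : sigma_algebra setT G ->
  measurable_wrt G X <-> measurable_fun setT (X : g_sigma_algebraType G -> R).
Proof.
move=> sG; split=> [mX _ B mB|mX B mB].
  by rewrite setTI; apply: sub_sigma_algebra; exact: mX.
have := mX measurableT B mB; rewrite setTI.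
by rewrite [in X in X -> _](measurable_g_measurableTypeE sG).
Qed.

Lemma mwrtS G (G' : set_system W) X : G `<=` G' -> measurable_wrt G X -> measurable_wrt G' X.
Proof. by move=> GG mX B mB; apply/GG/mX. Qed.

Lemma mwrt_measurable G X : G `<=` measurable -> measurable_wrt G X ->
  measurable_fun setT X.
Proof. by move=> GG mX _ B mB; rewrite setTI; apply/GG/mX. Qed.

Section sigma.
Variables (G : set_system W) (sG : sigma_algebra setT G).

Lemma mwrt_cst (c : R) : measurable_wrt G (fun=> c).
Proof. by apply/mwrtP => //; exact: measurable_cst. Qed.

Lemma mwrtD X Y : measurable_wrt G X -> measurable_wrt G Y ->
  measurable_wrt G (fun w => X w + Y w).
Proof. by move=> /mwrtP mX /mwrtP mY; apply/mwrtP => //; apply: measurable_funD; [exact: mX|exact: mY]. Qed.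

Lemma mwrtB X Y : measurable_wrt G X -> measurable_wrt G Y ->
  measurable_wrt G (fun w => X w - Y w).
Proof. by move=> /mwrtP mX /mwrtP mY; apply/mwrtP => //; apply: measurable_funB; [exact: mX|exact: mY]. Qed.

Lemma mwrtM X Y : measurable_wrt G X -> measurable_wrt G Y ->
  measurable_wrt G (fun w => X w * Y w).
Proof. by move=> /mwrtP mX /mwrtP mY; apply/mwrtP => //; apply: measurable_funM; [exact: mX|exact: mY]. Qed.

Lemma mwrt_comp (h : R -> R) X : measurable_fun setT h -> measurable_wrt G X ->
  measurable_wrt G (fun w => h (X w)).
Proof. by move=> mh mX B mB; apply: (mX (h @^-1` B)); rewrite -[X in measurable X]setTI; exact: mh. Qed.

Lemma mwrt_indic (B : set W) : G B -> measurable_wrt G (\1_B : W -> R).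
Proof.
move=> GB; apply/mwrtP => //; apply: measurable_indic.
exact: sub_sigma_algebra.
Qed.

Lemma mwrt_cvg (h : nat -> W -> R) X : (forall n, measurable_wrt G (h n)) ->
  (forall w, h n w @[n --> \oo] --> X w) -> measurable_wrt G X.
Proof.
move=> mh hX; apply/mwrtP => //; apply: (@measurable_fun_cvg _ (g_sigma_algebraType G) R setT (h : nat -> g_sigma_algebraType G -> R)).
- by move=> n; apply: (mwrtP _ sG).1.
- by move=> w _; exact: hX.
Qed.

Lemma sigmaI (A B : set W) : G A -> G B -> G (A `&` B).
Proof.
rewrite -[G](measurable_g_measurableTypeE sG); exact: measurableI.
Qed.

Lemma sigmaU (A B : set W) : G A -> G B -> G (A `|` B).
Proof.
rewrite -[G](measurable_g_measurableTypeE sG); exact: measurableU.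
Qed.

Lemma sigmaC (A : set W) : G A -> G (~` A).
Proof.
rewrite -[G](measurable_g_measurableTypeE sG); exact: measurableC.
Qed.

Lemma sigmaD (A B : set W) : G A -> G B -> G (A `\` B).
Proof.
rewrite -[G](measurable_g_measurableTypeE sG); exact: measurableD.
Qed.

Lemma sigmaT : G setT.
Proof. by rewrite -[G](measurable_g_measurableTypeE sG); exact: measurableT. Qed.

Lemma sigma0 : G set0.
Proof. by rewrite -[G](measurable_g_measurableTypeE sG); exact: measurable0. Qed.

Lemma sigma_bigcup (A : nat -> set W) : (forall n, G (A n)) -> G (\bigcup_n A n).
Proof.
rewrite -[G](measurable_g_measurableTypeE sG) => h; exact: bigcupT_measurable.
Qed.

Lemma mwrt_gt X (c : R) : measurable_wrt G X -> G [set w | c < X w].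
Proof.
move=> mX; have -> : [set w | c < X w] = X @^-1` `]c, +oo[.
  by apply/seteqP; split => w /=; rewrite in_itv/= andbT.
exact: mX.
Qed.

Lemma mwrt_lt X (c : R) : measurable_wrt G X -> G [set w | X w < c].
Proof.
move=> mX; have -> : [set w | X w < c] = X @^-1` `]-oo, c[.
  by apply/seteqP; split => w /=; rewrite in_itv.
exact: mX.
Qed.

End sigma.
End measurable_wrt.

(** * Integrable random variables and the pull-out inequality *)

Section integrable_random_variables.
Context d (W : measurableType d) (R : realType) (Q : probability W R).
Implicit Types (X Y : W -> R) (G : set_system W).

Definition intg X := Q.-integrable setT (EFin \o X).

Lemma intg_measurable X : intg X -> measurable_fun setT X.
Proof. by move=> /measurable_int /measurable_EFinP. Qed.

Lemma intgD X Y : intg X -> intg Y -> intg (fun w => X w + Y w).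
Proof. by move=> iX iY; exact: (integrableD measurableT iX iY). Qed.

Lemma intgB X Y : intg X -> intg Y -> intg (fun w => X w - Y w).
Proof. by move=> iX iY; exact: (integrableB measurableT iX iY). Qed.

Lemma intgZ c X : intg X -> intg (fun w => c * X w).
Proof. by move=> iX; exact: (integrableZl measurableT c iX). Qed.

Lemma intg_cst c : intg (fun=> c).
Proof. exact: finite_measure_integrable_cst. Qed.

Lemma intg_norm X : intg X -> intg (fun w => `|X w|).
Proof. by move=> iX; exact: integrable_norm. Qed.

Lemma intg_le X Y : measurable_fun setT X -> (forall w, `|X w| <= `|Y w|) ->
  intg Y -> intg X.
Proof.
move=> mX XY; apply: le_integrable => //; first exact/measurable_EFinP.
by move=> w _ /=; rewrite lee_fin.
Qed.

Lemma intg_mulb X Y c : measurable_fun setT X -> (forall w, `|X w| <= c) ->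
  intg Y -> intg (fun w => X w * Y w).
Proof.
move=> mX Xc iY; apply: (@intg_le _ (fun w => c * Y w)).
- by apply: measurable_funM => //; exact: intg_measurable.
- move=> w; rewrite !normrM ler_wpM2r// (le_trans (Xc w))//.
  by rewrite ler_norm.
- exact: intgZ.
Qed.

Lemma intg_indic X B : measurable B -> intg X -> intg (fun w => \1_B w * X w).
Proof.
move=> mB; apply: (@intg_mulb _ _ 1) => //.
by move=> w; rewrite indicE; case: (_ \in _); rewrite ?normr1 ?normr0.
Qed.

Lemma intgS X B : measurable B -> intg X -> Q.-integrable B (EFin \o X).
Proof. by move=> mB; apply: integrableS. Qed.

Lemma intg_ae X Y : measurable_fun setT X -> {ae Q, forall w, X w = Y w} ->
  intg Y -> intg X.
Proof.
move=> mX XY iY; have /integrableP[mY iYoo] := iY.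
apply/integrableP; split; first exact/measurable_EFinP.
rewrite (@ae_eq_integral _ _ _ _ _ (fun w => `|(EFin \o Y) w|)%E) //.
- by apply: measurableT_comp => //; exact/measurable_EFinP.
- by apply: measurableT_comp.
- by apply: filterS XY => w /= -> _.
Qed.

Lemma Rint_ae X Y B : measurable B -> measurable_fun setT X -> measurable_fun setT Y ->
  {ae Q, forall w, X w = Y w} -> \int[Q]_(w in B) X w = \int[Q]_(w in B) Y w.
Proof.
move=> mB mX mY XY; rewrite /Rintegral; congr fine; apply: ae_eq_integral => //.
- by apply/measurable_EFinP; exact: measurable_funTS.
- by apply/measurable_EFinP; exact: measurable_funTS.
- by apply: filterS XY => w /= -> _.
Qed.

Lemma Rint_indic X B : measurable B ->
  \int[Q]_(w in B) X w = \int[Q]_w (\1_B w * X w).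
Proof.
move=> mB; rewrite Rintegral_mkcond; apply: eq_Rintegral => w _.
by rewrite patchE indicE; case: (_ \in _); rewrite ?mul1r ?mul0r.
Qed.

Lemma RintK X B : measurable B -> intg X ->
  (\int[Q]_(w in B) (X w)%:E = (\int[Q]_(w in B) X w)%:E)%E.
Proof. by move=> mB iX; rewrite fineK//; apply: integrable_fin_num => //; exact: intgS. Qed.

Lemma L1_intg X : measurable_fun setT X -> L1 Q X <-> intg X.
Proof.
move=> mX; split => [h|/integrableP[]//].
by apply/integrableP; split => //; exact/measurable_EFinP.
Qed.

(* [xi w = \int 1_{0 <= c < xi w} dc], so that only the sets [c < xi] matter. *)
Lemma pullout_ge0 G (xi : W -> R) (Z1 Z2 : W -> R) :
  G `<=` measurable -> measurable_wrt G xi -> sigma_algebra setT G ->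
  (forall w, 0 <= xi w) -> (forall w, 0 <= Z1 w) -> (forall w, 0 <= Z2 w) ->
  measurable_fun setT Z1 -> measurable_fun setT Z2 ->
  (forall B, G B -> (\int[Q]_(w in B) (Z1 w)%:E <= \int[Q]_(w in B) (Z2 w)%:E)%E) ->
  (\int[Q]_w (xi w * Z1 w)%:E <= \int[Q]_w (xi w * Z2 w)%:E)%E.
Proof.
move=> GG mxi sG xi0 Z10 Z20 mZ1 mZ2 Z12.
have mxi' := mwrt_measurable GG mxi.
have key (Z : W -> R) : (forall w, 0 <= Z w) -> measurable_fun setT Z ->
  measurable_fun setT (fun z : W * R => (\1_[set z | 0 <= z.2 /\ z.2 < xi z.1] z * Z z.1)%:E) /\
  (\int[Q]_w (xi w * Z w)%:E =
   \int[lebesgue_measure]_c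
     \int[Q]_w (\1_[set z : W * R | (0 <= z.2 /\ z.2 < xi z.1)%R] (w, c) * Z w)%:E)%E.
  move=> Z0 mZ.
  have mS : measurable [set z : W * R | 0 <= z.2 /\ z.2 < xi z.1].
    rewrite (_ : mkset _ = [set z : W * R | (0 <= z.2) && (z.2 < xi z.1)]); last first.
      by apply/seteqP; split=> z /= => [[-> ->]//|/andP].
    rewrite -[X in measurable X]setTI; apply: measurable_and => //.
      exact: measurable_fun_ler.
    by apply: measurable_fun_ltr => //; exact: measurableT_comp.
  have mf : measurable_fun setT
    (fun z : W * R => (\1_[set z | 0 <= z.2 /\ z.2 < xi z.1] z * Z z.1)%:E).
    apply/measurable_EFinP; apply: measurable_funM => //.
    exact: measurableT_comp.
  split => //.
  rewrite -(@fubini_tonelli _ _ _ _ _ Q lebesgue_measure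
    (fun z : W * R => (\1_[set z | 0 <= z.2 /\ z.2 < xi z.1] z * Z z.1)%:E)) //=.
    apply: eq_integral => w _.
    rewrite (_ : (fun c => _) = (fun c => (Z w)%:E * (\1_(`[0, xi w[%classic : set R) c)%:E)%E); last first.
      apply/funext => c; rewrite -EFinM mulrC; congr (_ * _)%:E.
      rewrite !indicE; congr (_ %:R); congr nat_of_bool.
      apply/idP/idP; rewrite !inE /= in_itv/=; first by move=> [-> ->].
      by move=> /andP.
    rewrite ge0_integralZl//=; last 2 first.
      by apply/measurable_EFinP; exact: measurable_indic.
      by rewrite lee_fin.
    have L : (lebesgue_measure (`[0%R, xi w[%classic : set R) = (xi w)%:E)%E.
      rewrite lebesgue_measure_itv/= lte_fin.
      case: ltP => [_|xi0']; first by rewrite -EFinB subr0.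
      by congr EFin; apply/le_anti; rewrite xi0' xi0.
    by rewrite integral_indic// setIT EFinM muleC; congr (_ * _)%E; exact/esym/L.
  by move=> z; rewrite lee_fin mulr_ge0.
have [m1 ->] := key _ Z10 mZ1; have [m2 ->] := key _ Z20 mZ2.
have e (Z : W -> R) c : (\int[Q]_w (\1_[set z : W * R | (0 <= z.2 /\ z.2 < xi z.1)%R] (w, c) * Z w)%:E =
   \int[Q]_(w in [set w | (0 <= c)%R /\ (c < xi w)%R]) (Z w)%:E)%E.
  rewrite [RHS]integral_mkcond; apply: eq_integral => w _.
  rewrite patchE indicE.
  rewrite (_ : ((w, c) \in _) = (w \in [set w | 0 <= c /\ c < xi w])) //.
  by case: ifP => _; rewrite ?mul1r ?mul0r.
apply: ge0_le_integral => //=.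
- by move=> c _; apply: integral_ge0 => w _; rewrite lee_fin mulr_ge0.
- apply: (measurable_fun_fubini_tonelli_G (m1 := Q)
   (fun z : W * R => (\1_[set z | 0 <= z.2 /\ z.2 < xi z.1] z * Z1 z.1)%:E)) => //.
  by move=> z; rewrite lee_fin mulr_ge0.
- apply: (measurable_fun_fubini_tonelli_G (m1 := Q)
   (fun z : W * R => (\1_[set z | 0 <= z.2 /\ z.2 < xi z.1] z * Z2 z.1)%:E)) => //.
  by move=> z; rewrite lee_fin mulr_ge0.
- move=> c _; rewrite !e; apply: Z12.
  have [c0|c0] := leP 0 c.
    rewrite (_ : mkset _ = [set w | c < xi w]); first exact: mwrt_gt.
    by apply/seteqP; split => w /= => [[]|].
  rewrite (_ : mkset _ = set0); first exact: sigma0.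
  by apply/seteqP; split => w //= => [[]].
Qed.

End integrable_random_variables.

(** * Martingales under the usual conditions *)

(** As [c >= 0] the two cases exclude each other. The convex function is affine on each of two sets
    determined by [a]; integrating over these sets takes the place of a conditional Jensen
    inequality. *)
Lemma clip_split (R : realFieldType) (a c : R) : 0 <= c ->
  Num.max (`|a| - c) 0 = (c < a)%R%:R * (a - c) + (a < - c)%R%:R * (- 1 * a - c).
Proof.
move=> c0; have [a0|a0] := leP 0 a.
- rewrite ger0_norm//; have /negbTE -> : ~~ (a < - c) by rewrite -leNgt; lra.
  by rewrite mul0r addr0; case: ltP => h; [rewrite mul1r max_l|rewrite mul0r max_r]; lra.
- rewrite ltr0_norm//; have /negbTE -> : ~~ (c < a) by rewrite -leNgt; lra.
  by rewrite mul0r add0r; case: ltP => h; [rewrite mul1r max_l|rewrite mul0r max_r]; lra.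
Qed.

(** Supporting lines: the affine piece selected at [a] stays below the convex function at every
    [b]. *)
Lemma clip_dominates (R : realFieldType) (a b c : R) : 0 <= c ->
  (c < a)%R%:R * (b - c) + (a < - c)%R%:R * (- 1 * b - c) <= Num.max (`|b| - c) 0.
Proof.
move=> c0; rewrite le_max.
have h1 := ler_norm b; have h2 : - b <= `|b| by rewrite -normrN ler_norm.
case: (ltP c a) => ca; case: (ltP a (- c)) => ac; rewrite ?mul1r ?mul0r ?addr0 ?add0r ?lexx ?orbT//.
- by exfalso; lra.
- by apply/orP; left; lra.
- by apply/orP; left; lra.
Qed.

Lemma le_Rint_integral d (W : measurableType d) (R : realType) (Q : probability W R)
  (B : set W) (X Y : W -> R) : measurable B -> intg Q X -> intg Q Y ->
  \int[Q]_(w in B) X w <= \int[Q]_(w in B) Y w ->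
  (\int[Q]_(w in B) (X w)%:E <= \int[Q]_(w in B) (Y w)%:E)%E.
Proof. by move=> mB iX iY XY; rewrite !RintK. Qed.

Section martingale_theory.
Context (R : realType) (T : {posnum R}) d (W : measurableType d) (Q : probability W R).
Implicit Types (X Y : W -> R) (M : time T -> W -> R) (F : time T -> set_system W).

(** The term covers monotonicity and completeness. As [F t] contains the null sets, adaptedness
    depends on almost sure values only. *)
Definition usual F := [/\ forall t, sigma_algebra setT (F t),
  forall r t, time_val r <= time_val t -> F r `<=` F t,
  forall t, F t `<=` measurable &
  forall t A, Q.-negligible A -> F t A].

Lemma martP F M : usual F -> martingale Q F time0 M <->
  [/\ forall t, measurable_wrt (F t) (M t), forall t, intg Q (M t) &
   forall r t, time_val r <= time_val t -> forall B, F r B ->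
     \int[Q]_(w in B) M t w = \int[Q]_(w in B) M r w].
Proof.
move=> [sF mF FF nF]; split.
  move=> hM.
  have adM t : measurable_wrt (F t) (M t) by have [] := hM t t (time0_le t) (lexx _).
  have mM t : measurable_fun setT (M t) by exact: mwrt_measurable (FF t) (adM t).
  split => //.
    move=> t; have [h _ _ _] := hM t t (time0_le t) (lexx _).
    exact/L1_intg.
  move=> r t rt B FB; have [_ _ _ h] := hM r t (time0_le r) rt.
  by rewrite /Rintegral h.
move=> [adM iM hM] r t _ rt.
have mM q : measurable_fun setT (M q) by exact: mwrt_measurable (FF q) (adM q).
split; [exact/L1_intg|exact/L1_intg|exact: adM|].
move=> B FB; rewrite !RintK//; try exact: FF FB.
by rewrite (hM r t).
Qed.

(** The factor [xi] is split into its positive and negative parts. For a nonnegative factor, the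
    inequality for nonnegative variables is used in both directions on [|X| + |Y|] and on the same
    variable increased by [X - Y]. *)
Lemma pullout_eq G (xi X Y : W -> R) :
  G `<=` measurable -> sigma_algebra setT G -> measurable_wrt G xi ->
  intg Q X -> intg Q Y -> intg Q (fun w => xi w * X w) -> intg Q (fun w => xi w * Y w) ->
  (forall B, G B -> \int[Q]_(w in B) X w = \int[Q]_(w in B) Y w) ->
  \int[Q]_w (xi w * X w) = \int[Q]_w (xi w * Y w).
Proof.
move=> GG sG.
have key (eta : W -> R) : (forall w, 0 <= eta w) -> measurable_wrt G eta ->
  intg Q X -> intg Q Y -> intg Q (fun w => eta w * X w) -> intg Q (fun w => eta w * Y w) ->
  (forall B, G B -> \int[Q]_(w in B) X w = \int[Q]_(w in B) Y w) ->
  \int[Q]_w (eta w * X w) = \int[Q]_w (eta w * Y w).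
  move=> eta0 meta iX iY iX' iY' XY.
  pose Z2 w := `|X w| + `|Y w|; pose Z1 w := Z2 w + (X w - Y w).
  have iZ2 : intg Q Z2 by apply: intgD; exact: intg_norm.
  have iZ1 : intg Q Z1 by apply: intgD => //; exact: intgB.
  have Z20 w : 0 <= Z2 w by rewrite addr_ge0.
  have Z10 w : 0 <= Z1 w.
    have := ler_norm (- X w); have := ler_norm (Y w); rewrite normrN /Z1 /Z2; lra.
  have Z12 B : G B -> (\int[Q]_(w in B) (Z1 w)%:E = \int[Q]_(w in B) (Z2 w)%:E)%E.
    move=> GB; have mB := GG _ GB; rewrite !RintK// RintegralD// ?RintegralB//; try exact: intgS.
      by rewrite XY// subrr addr0.
    by apply: (intgS mB); exact: intgB.
  have ie2 : intg Q (fun w => eta w * Z2 w).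
    rewrite (_ : (fun _ => _) = (fun w => `|eta w * X w| + `|eta w * Y w|)).
      by apply: intgD; exact: intg_norm.
    by apply/funext => w; rewrite /Z2 !normrM mulrDr (ger0_norm (eta0 w)).
  have ied : intg Q (fun w => eta w * X w - eta w * Y w) by exact: intgB.
  have H : (\int[Q]_w (eta w * Z1 w)%:E = \int[Q]_w (eta w * Z2 w)%:E)%E.
    have mZ1 := intg_measurable iZ1; have mZ2 := intg_measurable iZ2.
    by apply/le_anti/andP; split; apply: (pullout_ge0 GG meta sG) => // B /Z12 ->.
  have : \int[Q]_w (eta w * Z1 w) = \int[Q]_w (eta w * Z2 w) by rewrite /Rintegral H.
  rewrite (_ : (fun w => eta w * Z1 w) = (fun w => eta w * Z2 w + (eta w * X w - eta w * Y w))); last first.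
    by apply/funext => w; rewrite /Z1; ring.
  by rewrite RintegralD// RintegralB//; lra.
move=> mxi iX iY iX' iY' XY.
pose xp w := Num.max (xi w) 0; pose xm w := Num.max (- xi w) 0.
have xE w : xi w = xp w - xm w.
  by rewrite /xp /xm; case: (leP (xi w) 0); case: (leP (- xi w) 0); lra.
have mxp : measurable_wrt G xp.
  by apply: (mwrt_comp (h := fun x => Num.max x 0)) mxi; exact: measurable_maxr.
have mxm : measurable_wrt G xm.
  apply: (mwrt_comp (h := fun x => Num.max (- x) 0)) mxi.
  by apply: measurable_maxr => //; exact: measurable_funN.
have bp w : `|xp w| <= `|xi w|.
  rewrite /xp; have := ler_norm (xi w); have := normr_ge0 (xi w).
  by case: (leP (xi w) 0) => h; rewrite ?normr0//.
have bm w : `|xm w| <= `|xi w|.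
  rewrite /xm; have := normr_ge0 (xi w); rewrite -normrN.
  by case: (leP (- xi w) 0) => h; rewrite ?normr0//.
have ip (x Z : W -> R) : measurable_wrt G x -> (forall w, `|x w| <= `|xi w|) ->
  intg Q Z -> intg Q (fun w => xi w * Z w) -> intg Q (fun w => x w * Z w).
  move=> mx bx iZ; apply: intg_le.
    apply: measurable_funM; [exact: mwrt_measurable mx|exact: intg_measurable iZ].
  by move=> w; rewrite !normrM ler_wpM2r.
rewrite (_ : (fun w => xi w * X w) = (fun w => xp w * X w - xm w * X w)); last first.
  by apply/funext => w; rewrite -mulrBl -xE.
rewrite (_ : (fun w => xi w * Y w) = (fun w => xp w * Y w - xm w * Y w)); last first.
  by apply/funext => w; rewrite -mulrBl -xE.
rewrite !RintegralB//; try exact: ip.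
by rewrite (key xp)//; first rewrite (key xm)//; try exact: ip;
  move=> w; rewrite le_max lexx orbT.
Qed.

Section with_filtration.
Variables (F : time T -> set_system W) (uF : usual F).

Lemma usual_sigma t : sigma_algebra setT (F t). Proof. by case: uF. Qed.
Lemma usual_mono r t : time_val r <= time_val t -> F r `<=` F t.
Proof. by case: uF => _ h _ _; exact: h. Qed.
Lemma usual_meas t : F t `<=` measurable. Proof. by case: uF => _ _ h _; exact: h. Qed.
Lemma usual_null t A : Q.-negligible A -> F t A. Proof. by case: uF => _ _ _; exact. Qed.

Lemma mwrt_ae t X Y : {ae Q, forall w, X w = Y w} -> measurable_wrt (F t) X ->
  measurable_wrt (F t) Y.
Proof.
move=> XY mX B mB; set N := ~` [set w | X w = Y w].
have nN : Q.-negligible N by exact: XY.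
have -> : Y @^-1` B = ((X @^-1` B) `\` N) `|` ((Y @^-1` B) `&` N).
  apply/seteqP; split => w /=.
    move=> Bw; have [XYw|h] := pselect (X w = Y w); last by right.
    by left; rewrite XYw; split => //; exact.
  by move=> [[BX /contrapT <-]|[]].
apply: (sigmaU (usual_sigma t)).
  apply: (sigmaD (usual_sigma t)); [exact: mX|exact: usual_null].
by apply: usual_null; apply: negligibleS nN => w [].
Qed.

(** On the sets [c < M r] and [M r < - c], which belong to [F r], the affine pieces have the same
    integrals at [r] and at [t]; at [t] they lie below the clipped function. With [c = 0] this is
    the submartingale property of [|M|]; for large [c] it controls uniform integrability. *)
Lemma mart_submart M r t B c : martingale Q F time0 M -> 0 <= c ->
  time_val r <= time_val t -> F r B ->
  (\int[Q]_(w in B) (Num.max (`|M r w| - c) 0)%:E <=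
   \int[Q]_(w in B) (Num.max (`|M t w| - c) 0)%:E)%E.
Proof.
move=> /(martP _ uF)[adM iM hM] c0 rt FB.
pose h (x : R) := Num.max (`|x| - c) 0.
have h0 x : 0 <= h x by rewrite le_max lexx orbT.
have mh : measurable_fun setT h.
  by apply: measurable_maxr => //; apply: measurable_funB => //; exact: measurableT_comp.
have mB := usual_meas FB.
have mM q : measurable_fun setT (M q) by exact: intg_measurable (iM q).
have ih q : intg Q (fun w => h (M q w)).
  apply: (@intg_le _ _ _ _ _ (M q)) => //; first exact: measurableT_comp.
  move=> w; rewrite ger0_norm// ge_max normr_ge0 andbT.
  by rewrite lerBlDr lerDl.
pose Bp := B `&` [set w | c < M r w]; pose Bm := B `&` [set w | M r w < - c].
have FBp : F r Bp.
  by apply: (sigmaI (usual_sigma r)) => //; apply: mwrt_gt => //; exact: usual_sigma.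
have FBm : F r Bm.
  by apply: (sigmaI (usual_sigma r)) => //; apply: mwrt_lt => //; exact: usual_sigma.
have mBp := usual_meas FBp; have mBm := usual_meas FBm.
change (\int[Q]_(w in B) (h (M r w))%:E <= \int[Q]_(w in B) (h (M t w))%:E)%E.
apply: (le_Rint_integral mB (ih r) (ih t)); rewrite !(Rint_indic _ _ mB).
have iD (S : set W) X : measurable S -> intg Q X -> intg Q (fun w => \1_S w * X w) by move=> *; exact: intg_indic.
have ->: \int[Q]_w (\1_B w * h (M r w)) =
  \int[Q]_w ((\1_Bp w * (M r w - c)) + (\1_Bm w * (- 1 * M r w - c))).
  apply: eq_Rintegral => w _; rewrite !indicE /Bp /Bm /h !in_setI.
  case: (w \in B); rewrite /= ?mul0r ?addr0// mul1r.
  rewrite (_ : (w \in [set w | c < M r w]) = (c < M r w)); last by apply/idP/idP; rewrite inE.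
  rewrite (_ : (w \in [set w | M r w < - c]) = (M r w < - c)); last by apply/idP/idP; rewrite inE.
  by rewrite clip_split.
rewrite RintegralD//; last 2 first.
  by apply: iD => //; apply: intgB => //; exact: intg_cst.
  by apply: iD => //; apply: intgB; [exact: intgZ|exact: intg_cst].
have e1 : \int[Q]_w (\1_Bp w * (M r w - c)) = \int[Q]_w (\1_Bp w * (M t w - c)).
  rewrite -!Rint_indic// !RintegralB//; try exact: intgS; try exact: (intgS _ (intg_cst _ _)).
  by rewrite (hM r t).
have e2 : \int[Q]_w (\1_Bm w * (- 1 * M r w - c)) = \int[Q]_w (\1_Bm w * (- 1 * M t w - c)).
  rewrite -!Rint_indic// !RintegralB//; try exact: (intgS _ (intg_cst _ _)); try exact: (intgS _ (intgZ _ _)).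
  by rewrite !RintegralZl//; try exact: intgS; rewrite (hM r t).
rewrite e1 e2 -RintegralD//; last 2 first.
  by apply: iD => //; apply: intgB => //; exact: intg_cst.
  by apply: iD => //; apply: intgB; [exact: intgZ|exact: intg_cst].
apply: le_Rintegral => //.
- apply: intgD; apply: iD => //.
    by apply: intgB => //; exact: intg_cst.
  by apply: intgB; [exact: intgZ|exact: intg_cst].
- exact: iD.
- move=> w _; rewrite !indicE /Bp /Bm /h !in_setI.
  case: (w \in B); rewrite /= ?mul0r ?addr0// mul1r.
  rewrite (_ : (w \in [set w | c < M r w]) = (c < M r w)); last by apply/idP/idP; rewrite inE.
  rewrite (_ : (w \in [set w | M r w < - c]) = (M r w < - c)); last by apply/idP/idP; rewrite inE.
  exact: clip_dominates.
Qed.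

End with_filtration.
End martingale_theory.

(** * Stochastic Fubini theorem *)

Section Fubini_real.
Context d1 d2 (U : measurableType d1) (W : measurableType d2) (R : realType).
Variables (m1 : {sigma_finite_measure set U -> \bar R}) (m2 : {sigma_finite_measure set W -> \bar R}).
Variable f : U -> W -> R.
Hypothesis If : (m1 \x m2)%E.-integrable setT (fun z : U * W => (f z.1 z.2)%:E).

(** The inner real integral is [fine] of the extended one. The two are known to agree where the
    section is integrable, hence almost everywhere, which is enough for the outer integral. *)
Lemma Rint_fubini_r : m2.-integrable setT (fun w => (\int[m1]_q f q w)%:E) /\
  (\int[m1 \x m2]_z (f z.1 z.2)%:E = \int[m2]_w (\int[m1]_q f q w)%:E)%E.
Proof.
have ae2 := ae_integrable2 If.
have e : {ae m2, forall w, (\int[m1]_q f q w)%:E = (\int[m1]_q (f q w)%:E)%E}.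
  by apply: filterS ae2 => w hw; rewrite fineK//; exact: integrable_fin_num hw.
have mG := measurable_fubini_G If.
have mR : measurable_fun setT (fun w => (\int[m1]_q f q w)%:E).
  by apply/measurable_EFinP; apply: measurableT_comp mG.
have iG : m2.-integrable setT (fun w => \int[m1]_q (f q w)%:E)%E.
  apply/integrableP; split; first exact: mG.
  have mf := measurable_int (m1 \x m2)%E If.
  apply: le_lt_trans ((integrable21ltyP m1 m2 mf).1 If).
  apply: ge0_le_integral => //.
  - exact: measurableT_comp.
  - apply: (measurable_fun_fubini_tonelli_G (m1 := m1) (abse \o (fun z : U * W => (f z.1 z.2)%:E))) => //=.
    exact: measurableT_comp.
  - move=> w _; apply: le_abse_integral => //.
    exact: (measurable_fun_pair1 w mf).
have ee : (\int[m2]_w (\int[m1]_q f q w)%:E = \int[m2]_w \int[m1]_q (f q w)%:E)%E.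
  by apply: ae_eq_integral => //; apply: filterS e.
split; last by rewrite ee (integral21_prod_meas1 If).
apply/integrableP; split => //.
have /integrableP[_] := iG; apply: le_lt_trans; rewrite le_eqVlt; apply/orP; left; apply/eqP.
apply: ae_eq_integral => //.
- exact: measurableT_comp.
- exact: measurableT_comp.
- by apply: filterS e => w hw _; congr (`|_|)%E.
Qed.

Lemma Rint_fubini_l : m1.-integrable setT (fun q => (\int[m2]_w f q w)%:E) /\
  (\int[m1 \x m2]_z (f z.1 z.2)%:E = \int[m1]_q (\int[m2]_w f q w)%:E)%E.
Proof.
have ae1 := ae_integrable1 If.
have e : {ae m1, forall q, (\int[m2]_w f q w)%:E = (\int[m2]_w (f q w)%:E)%E}.
  by apply: filterS ae1 => w hw; rewrite fineK//; exact: integrable_fin_num hw.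
have mG := measurable_fubini_F If.
have mR : measurable_fun setT (fun q => (\int[m2]_w f q w)%:E).
  by apply/measurable_EFinP; apply: measurableT_comp mG.
have iG := integrable_fubini_F If.
have ee : (\int[m1]_q (\int[m2]_w f q w)%:E = \int[m1]_q \int[m2]_w (f q w)%:E)%E.
  by apply: ae_eq_integral => //; apply: filterS e.
split; last by rewrite ee (integral12_prod_meas1 If).
apply/integrableP; split => //.
have /integrableP[_] := iG; apply: le_lt_trans; rewrite le_eqVlt; apply/orP; left; apply/eqP.
apply: ae_eq_integral => //.
- exact: measurableT_comp.
- exact: measurableT_comp.
- by apply: filterS e => w hw _; congr (`|_|)%E.
Qed.

Lemma Rint_fubini : \int[m2]_w (\int[m1]_q f q w) = \int[m1]_q (\int[m2]_w f q w).
Proof. by rewrite /Rintegral -(Rint_fubini_r).2 (Rint_fubini_l).2. Qed.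

End Fubini_real.

Lemma Rint_ae_eq d (U : measurableType d) (R : realType) (m : {measure set U -> \bar R})
  (f g : U -> R) : measurable_fun setT f -> measurable_fun setT g ->
  {ae m, forall x, f x = g x} -> \int[m]_x f x = \int[m]_x g x.
Proof.
move=> mf mg fg; rewrite /Rintegral; congr fine; apply: ae_eq_integral => //.
- exact/measurable_EFinP.
- exact/measurable_EFinP.
- by apply: filterS fg => x /= -> _.
Qed.

Section process.
Context (R : realType) (T : {posnum R}) d (W : measurableType d) (Q : probability W R).
Implicit Types (M al : time T -> W -> R) (F : time T -> set_system W).

(** Joint measurability in time and outcome, as Fubini's theorem for [mu] and [Q] requires. *)
Definition jm M := measurable_fun setT (fun z : borel (time T) * W => M z.1 z.2).

Lemma jmM M al : jm M -> jm al -> jm (fun q w => M q w * al q w).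
Proof. by move=> mM ma; apply: measurable_funM. Qed.

Lemma jmB M al : jm M -> jm al -> jm (fun q w => M q w - al q w).
Proof. by move=> mM ma; apply: measurable_funB. Qed.

Lemma jm1 (h : time T -> R) : measurable_fun setT (h : borel (time T) -> R) -> jm (fun q w => h q).
Proof. by move=> mh; exact: (@measurableT_comp _ _ _ (borel (time T) * W)%type (borel (time T)) R h setT fst mh measurable_fst). Qed.

Lemma jm2 (h : W -> R) : measurable_fun setT h -> jm (fun q w => h w).
Proof. by move=> mh; exact: (@measurableT_comp _ _ _ (borel (time T) * W)%type W R h setT snd mh measurable_snd). Qed.

Lemma jm_w M w : jm M -> measurable_fun setT (fun q : borel (time T) => M q w).
Proof. by move=> mM; exact: (measurable_fun_pair1 w mM). Qed.

Lemma jm_q M q : jm M -> measurable_fun setT (M q).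
Proof. by move=> mM; exact: (measurable_fun_pair2 (q : borel (time T)) mM). Qed.

Definition upto (t : time T) : set (borel (time T)) :=
  [set q | time_val q <= time_val t].

Lemma measurable_upto t : measurable (upto t).
Proof. exact: measurable_time_le. Qed.

Variable mu : {finite_measure set (borel (time T)) -> \bar R}.

(** Tonelli's theorem for the positive and the negative part; the difference and [fine] are
    measurable whatever infinite values occur. *)
Lemma measurable_Rint al : jm al -> measurable_fun setT (fun w => \int[mu]_q al q w).
Proof.
move=> jal; apply: (measurableT_comp (f := fine)) => //.
pose f : borel (time T) * W -> \bar R := fun z => (al z.1 z.2)%:E.
have mf : measurable_fun setT f by apply/measurable_EFinP; exact: jal.
rewrite (_ : (fun _ => _) =
  (fun w => \int[mu]_q f^\+ (q, w) - \int[mu]_q f^\- (q, w))%E); last first.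
  apply/funext => w; rewrite integralE.
  by congr (_ - _)%E; apply: eq_integral => q _; rewrite ?funeposE ?funenegE.
apply: emeasurable_funB.
- apply: (measurable_fun_fubini_tonelli_G (m1 := mu)).
    exact: measurable_funepos.
  by move=> x; exact: funepos_ge0.
- apply: (measurable_fun_fubini_tonelli_G (m1 := mu)).
    exact: measurable_funeneg.
  by move=> x; exact: funeneg_ge0.
Qed.

Section core.
Variables (F : time T -> set_system W) (uF : usual Q F) (M al : time T -> W -> R)
  (t : time T) (c : R).
Hypotheses (hM : martingale Q F time0 M) (jM : jm M) (jal : jm al)
  (adal : forall q, measurable_wrt (F q) (al q))
  (al0 : forall q w, time_val t < time_val q -> al q w = 0)
  (c0 : 0 <= c)
  (alc : {ae Q, forall w, (\int[mu]_q `|al q w|%:E <= c%:E)%E}).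

Let iM q : intg Q (M q). Proof. by have [_ h _] := (martP _ uF).1 hM. Qed.
Let mM q : measurable_fun setT (M q). Proof. exact: intg_measurable. Qed.
Let mal q : measurable_fun setT (al q). Proof. exact: jm_q. Qed.

Let mn M' : jm M' -> measurable_fun setT (fun z : borel (time T) * W => (`|M' z.1 z.2|)%:E).
Proof. by move=> h; apply/measurable_EFinP; exact: measurableT_comp. Qed.

Let jMt : jm (fun q w => M t w * al q w). Proof. by apply: jmM => //; exact: jm2. Qed.
Let jMq : jm (fun q w => M q w * al q w). Proof. exact: jmM. Qed.

Let ltb : (\int[Q]_w \int[mu]_q (`|M t w * al q w|)%:E <=
  c%:E * \int[Q]_w (`|M t w|)%:E)%E.
Proof.
have iMt := intg_norm (iM t).
have -> : (\int[Q]_w \int[mu]_q (`|M t w * al q w|)%:E =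
  \int[Q]_w (`|M t w|%:E * \int[mu]_q (`|al q w|)%:E))%E.
  apply: eq_integral => w _.
  under eq_integral do rewrite normrM EFinM.
  rewrite ge0_integralZl//; apply/measurable_EFinP.
  by apply: measurableT_comp => //; exact: jm_w.
have mI : measurable_fun setT (fun w => \int[mu]_q (`|al q w|)%:E)%E.
  exact: (measurable_fun_fubini_tonelli_G (m1 := mu) _ (mn jal)).
have mMt : measurable_fun setT (fun w => `|M t w|%:E).
  by apply/measurable_EFinP/measurableT_comp.
rewrite -ge0_integralZl//=.
apply: ae_ge0_le_integral => //.
- by move=> w _; apply: mule_ge0 => //; exact: integral_ge0.
- exact: emeasurable_funM.
- by move=> w _; apply: mule_ge0.
- exact: measurable_funeM.
- apply: filterS alc => w h _; rewrite [leRHS]muleC.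
  by apply: lee_wpmul2l.
Qed.

(** By Tonelli's theorem the time integral comes outside. For [q <= t] the weight [|al q|] is
    measurable for [F q] and [|M|] is a submartingale, so that [|M q|] may be replaced by [|M t|];
    the bound [c] on the total variation does the rest. *)
Lemma core_bound : (\int[Q]_w \int[mu]_q (`|M q w * al q w|)%:E <=
  c%:E * \int[Q]_w (`|M t w|)%:E)%E.
Proof.
apply: le_trans ltb.
rewrite -(fubini_tonelli (fun z : borel (time T) * W => (`|M z.1 z.2 * al z.1 z.2|)%:E))//=;
  last exact: (mn jMq).
rewrite -(fubini_tonelli (fun z : borel (time T) * W => (`|M t z.2 * al z.1 z.2|)%:E))//=;
  last exact: (mn jMt).
apply: ge0_le_integral => //.
- by move=> q _; exact: integral_ge0.
- exact: (measurable_fun_fubini_tonelli_F (m2 := Q) _ (mn jMq)).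
- exact: (measurable_fun_fubini_tonelli_F (m2 := Q) _ (mn jMt)).
- move=> q _; have [qt|tq] := leP (time_val q) (time_val t); last first.
    by rewrite !integral0_eq// => w _; rewrite al0// mulr0 normr0.
  under eq_integral do rewrite normrM mulrC.
  under [leRHS]eq_integral do rewrite normrM mulrC.
  apply: (pullout_ge0 (G := F q)) => //.
  + exact: usual_meas uF q.
  + by apply: (mwrt_comp (h := fun x => `|x|)) => //; exact: measurableT_comp.
  + exact: usual_sigma uF q.
  + exact: measurableT_comp.
  + exact: measurableT_comp.
  + move=> B FB; have := mart_submart uF hM (lexx 0) qt FB.
    have e q' : (\int[Q]_(w in B) (Num.max (`|M q' w| - 0) 0)%:E = \int[Q]_(w in B) (`|M q' w|)%:E)%E.
      by apply: eq_integral => w _; rewrite subr0 max_l.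
    by rewrite !e.
Qed.

Let fin : (c%:E * \int[Q]_w (`|M t w|)%:E < +oo)%E.
Proof.
by apply: lte_mul_pinfty => //; have /integrableP[] := iM t.
Qed.

Let f1 : borel (time T) -> W -> R := fun q w => M q w * al q w.
Let f2 : borel (time T) -> W -> R := fun q w => M t w * al q w.

Let If : (mu \x Q)%E.-integrable setT (fun z => (f1 z.1 z.2)%:E).
Proof.
apply/integrable21ltyP => /=; first by apply/measurable_EFinP; exact: jMq.
by apply: le_lt_trans fin; exact: core_bound.
Qed.

Let Ig : (mu \x Q)%E.-integrable setT (fun z => (f2 z.1 z.2)%:E).
Proof.
apply/integrable21ltyP => /=; first by apply/measurable_EFinP; exact: jMt.
by apply: le_lt_trans fin; exact: ltb.
Qed.

Lemma core_ae : {ae Q, forall w, mu.-integrable setT (fun q => (M q w * al q w)%:E)}.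
Proof. exact: (ae_integrable2 If). Qed.

Lemma core_intg : intg Q (fun w => \int[mu]_q (M q w * al q w)).
Proof. exact: (@Rint_fubini_r _ _ _ _ _ mu Q f1 If).1. Qed.

(** By Fubini's theorem both sides are time integrals of expectations. For almost every [q <= t] the
    factor [al q], measurable for [F q], is pulled out and [M t] is replaced by [M q]. This is the
    whole reason why [\int M dA] compensates [M A]. *)
Lemma core_eq : intg Q (fun w => M t w * \int[mu]_q al q w) /\
  \int[Q]_w (M t w * \int[mu]_q al q w) = \int[Q]_w \int[mu]_q (M q w * al q w).
Proof.
have ig : intg Q (fun w => \int[mu]_q (M t w * al q w)) := (@Rint_fubini_r _ _ _ _ _ mu Q f2 Ig).1.
have aei : {ae Q, forall w, \int[mu]_q (M t w * al q w) = M t w * \int[mu]_q al q w}.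
  apply: filterS alc => w hw; rewrite RintegralZl//.
  apply/integrableP; split; first by apply/measurable_EFinP; exact: jm_w.
  by apply: le_lt_trans hw _; rewrite ltry.
have mI : measurable_fun setT (fun w => M t w * \int[mu]_q al q w).
  by apply: measurable_funM => //; exact: measurable_Rint.
have mg := intg_measurable ig.
split.
  by apply: intg_ae ig => //; apply: filterS aei.
rewrite -(Rint_ae measurableT mg mI aei).
transitivity (\int[mu]_q (\int[Q]_w f2 q w)); first exact: (@Rint_fubini _ _ _ _ _ mu Q f2 Ig).
transitivity (\int[mu]_q (\int[Q]_w f1 q w)); last exact/esym/(@Rint_fubini _ _ _ _ _ mu Q f1 If).
apply: Rint_ae_eq.
- by apply/measurable_EFinP; exact: (measurable_int mu (@Rint_fubini_l _ _ _ _ _ mu Q f2 Ig).1).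
- by apply/measurable_EFinP; exact: (measurable_int mu (@Rint_fubini_l _ _ _ _ _ mu Q f1 If).1).
have A1 := @ae_integrable1 _ _ _ _ _ mu Q _ If; have A2 := @ae_integrable1 _ _ _ _ _ mu Q _ Ig.
apply: filterS2 A1 A2 => q I1 I2.
have [qt|tq] := leP (time_val q) (time_val t); last first.
  by apply: eq_Rintegral => w _; rewrite /f1 /f2 al0// !mulr0.
have e1 : f1 q = (fun w => al q w * M q w) by apply/funext => w; rewrite /f1 mulrC.
have e2 : f2 q = (fun w => al q w * M t w) by apply/funext => w; rewrite /f2 mulrC.
have I1' : intg Q (fun w => al q w * M q w) by rewrite -e1.
have I2' : intg Q (fun w => al q w * M t w) by rewrite -e2.
rewrite e1 e2; apply: (pullout_eq (usual_meas uF (t := q)) (usual_sigma uF q)) => //.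
by move=> B FB; have [_ _ h] := (martP _ uF).1 hM; apply: h.
Qed.

End core.
End process.

(** * Uniform integrability *)

Section limits.
Context d (W : measurableType d) (R : realType).

Lemma Rint_dct (mu : {measure set W -> \bar R}) (D : set W) (h : nat -> W -> R) (h0 g : W -> R) :
  measurable D -> (forall n, measurable_fun D (h n)) -> measurable_fun D h0 ->
  {ae mu, forall w, D w -> h n w @[n --> \oo] --> h0 w} ->
  mu.-integrable D (EFin \o g) ->
  {ae mu, forall w, forall n, D w -> `|h n w| <= g w} ->
  mu.-integrable D (EFin \o h0) /\
  \int[mu]_(w in D) h n w @[n --> \oo] --> \int[mu]_(w in D) h0 w.
Proof.
move=> mD mh mh0 hh ig hg.
have D1 : {ae mu, forall w, D w -> (h n w)%:E @[n --> \oo] --> (h0 w)%:E}.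
  by apply: filterS hh => w hw Dw; apply: cvg_EFin; [exact: nearW|exact: hw].
have D2 : {ae mu, forall w, forall n, D w -> (`|(h n w)%:E| <= (g w)%:E)%E}.
  by apply: filterS hg => w hw n Dw; rewrite lee_fin; exact: hw.
have [i1 _ c1] := dominated_convergence mD (fun n => (measurable_EFinP _ _).2 (mh n))
  ((measurable_EFinP _ _).2 mh0) D1 ig D2.
split => //; apply: fine_cvg; rewrite fineK//.
exact: integrable_fin_num i1.
Qed.

Variable Q : probability W R.

Lemma fatou_le (X : nat -> W -> R) (Y : W -> R) (C : \bar R) :
  (forall n, measurable_fun setT (X n)) -> measurable_fun setT Y ->
  (forall n w, 0 <= X n w) -> (forall w, 0 <= Y w) ->
  {ae Q, forall w, X n w @[n --> \oo] --> Y w} ->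
  (forall n, \int[Q]_w (X n w)%:E <= C)%E -> (\int[Q]_w (Y w)%:E <= C)%E.
Proof.
move=> mX mY X0 Y0 XY XC.
have := fatou Q measurableT (fun n => (measurable_EFinP _ _).2 (mX n))
  (fun n w _ => X0 n w : (0 <= (X n w)%:E)%E).
rewrite (@ae_eq_integral _ _ _ Q setT (fun w => (Y w)%:E)) //.
- move=> /le_trans; apply; rewrite limn_einf_lim; apply: lime_le.
    exact: is_cvg_einfs.
  by apply: nearW => n; apply: le_trans (XC n); apply: ereal_inf_lbound; exists n => /=.
- rewrite /limn_einf; apply: measurableT_comp => //.
  apply: measurable_fun_limn_esup => n; apply: measurableT_comp => //.
  exact/measurable_EFinP.
- exact/measurable_EFinP.
- apply: filterS XY => w hw _; apply: (cvg_limn_einf_sup _).1.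
  by apply: cvg_EFin => //; exact: nearW.
Qed.

Lemma Rint_sum n (h : nat -> W -> R) : (forall k, intg Q (h k)) ->
  intg Q (fun w => \sum_(k < n) h k w) /\
  \int[Q]_w (\sum_(k < n) h k w) = \sum_(k < n) \int[Q]_w h k w.
Proof.
move=> ih; elim: n => [|n [IH1 IH2]].
  rewrite (_ : (fun _ => _) = fun=> 0); last by apply/funext => w; rewrite big_ord0.
  by split; [exact: intg_cst|rewrite big_ord0 Rintegral_cst ?mul0r].
rewrite (_ : (fun _ => _) = (fun w => (\sum_(k < n) h k w) + h n w)); last first.
  by apply/funext => w; rewrite big_ord_recr.
split; first exact: intgD.
rewrite big_ord_recr /= -IH2; exact: (RintegralD measurableT IH1 (ih n)).
Qed.

(** The excess of [|x|] over the level [c]. Uniform integrability is expressed by integrals of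
    [clipe k] that are bounded, for a whole sequence at once, by a quantity tending to 0 with
    growing [k]. *)
Definition clipe (c x : R) := Num.max (`|x| - c) 0.

Lemma clipe_ge0 c x : 0 <= clipe c x. Proof. by rewrite /clipe le_max lexx orbT. Qed.

Lemma clipe_le c x : 0 <= c -> clipe c x <= `|x|.
Proof. by move=> c0; rewrite /clipe ge_max normr_ge0 andbT lerBlDr lerDl. Qed.

Lemma measurable_clipe c : measurable_fun setT (clipe c).
Proof. by apply: measurable_maxr => //; apply: measurable_funB => //; exact: measurableT_comp. Qed.

(** The projection on [[-c, c]]: bounded and Lipschitz, at distance at most [clipe c x] from [x]. *)
Definition trunc (c x : R) := Num.max (- c) (Num.min c x).

Lemma trunc_clip c x : 0 <= c -> `|x - trunc c x| <= clipe c x.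
Proof.
move=> c0; rewrite /clipe /trunc.
have h1 := ler_norm x; have h2 : - x <= `|x| by rewrite -normrN ler_norm.
rewrite le_max; case: (leP c x) => cx.
  by rewrite max_r; [rewrite ger0_norm; [rewrite ger0_norm|]|]; rewrite ?lexx//; lra.
case: (leP (-c) x) => cx'; first by rewrite subrr normr0 lexx orbT.
by rewrite ler0_norm; [rewrite ler0_norm|]; [apply/orP; left|..]; lra.
Qed.

Lemma trunc_bound c x : 0 <= c -> `|trunc c x| <= c.
Proof.
move=> c0; rewrite ler_norml /trunc le_max lexx/= ge_max ge_min lexx/= andbT.
by lra.
Qed.

Lemma trunc_lip c x y : `|trunc c x - trunc c y| <= `|x - y|.
Proof.
rewrite /trunc.
have h1 := ler_norm (x - y); have h2 : - (x - y) <= `|x - y| by rewrite -normrN ler_norm.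
rewrite ler_norml; case: (leP c x) => ?; case: (leP c y) => ?;
 rewrite ?maxEle; do ? case: ifPn; rewrite -?ltNge => *; apply/andP; split; lra.
Qed.

Lemma trunc_cvg c (u : nat -> R) x : u n @[n --> \oo] --> x ->
  trunc c (u n) @[n --> \oo] --> trunc c x.
Proof.
move=> /cvgrPdist_lt ux; apply/cvgrPdist_lt => e e0.
by apply: filterS (ux e e0) => n; apply: le_lt_trans; exact: trunc_lip.
Qed.

Lemma measurable_trunc c : measurable_fun setT (trunc c).
Proof. by apply: measurable_maxr => //; exact: measurable_minr. Qed.

Lemma clipe_lip c x y : `|clipe c x - clipe c y| <= `|x - y|.
Proof.
rewrite /clipe; have h : `| `|x| - `|y| | <= `|x - y| by exact: ler_dist_dist.
move: h; rewrite !ler_norml => /andP[h1 h2].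
case: (leP (`|x| - c) 0) => ?; case: (leP (`|y| - c) 0) => ?; apply/andP; split;
  have := normr_ge0 (x - y); lra.
Qed.

Lemma clipe_cvg c (u : nat -> R) x : u n @[n --> \oo] --> x ->
  clipe c (u n) @[n --> \oo] --> clipe c x.
Proof.
move=> /cvgrPdist_lt ux; apply/cvgrPdist_lt => e e0.
by apply: filterS (ux e e0) => n; apply: le_lt_trans; exact: clipe_lip.
Qed.

Lemma clip_int_cvg0 (Y : W -> R) : intg Q Y ->
  \int[Q]_w clipe n%:R (Y w) @[n --> \oo] --> (0 : R).
Proof.
move=> iY; have mY := intg_measurable iY.
have D1 : {ae Q, forall w, setT w -> clipe n%:R (Y w) @[n --> \oo] --> (0 : R)}.
  apply: aeW => w _; apply: cvg_near_cst.
  exists `|Num.ceil `|Y w| |%N => // n /= hn; rewrite /clipe max_r// subr_le0.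
  apply: le_trans (ceil_ge _) _; rewrite -(@ler_nat R) in hn; apply: le_trans hn.
  by rewrite natr_absz ler_int ler_norm.
have D2 : {ae Q, forall w, forall n, setT w -> `|clipe n%:R (Y w)| <= `|Y w|}.
  by apply: aeW => w n _; rewrite ger0_norm ?clipe_ge0//; exact: clipe_le.
have [_] := Rint_dct measurableT
  (fun n => measurableT_comp (measurable_clipe n%:R) mY) (measurable_cst _) D1 (intg_norm iY) D2.
by rewrite Rintegral_cst// mul0r.
Qed.

Section uniformly_integrable.
Variables (X : nat -> W -> R) (X0 : W -> R) (e : nat -> R).
Hypotheses (iX : forall n, intg Q (X n)) (mX0 : measurable_fun setT X0)
  (XX0 : {ae Q, forall w, X n w @[n --> \oo] --> X0 w})
  (e0 : e k @[k --> \oo] --> 0)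
  (Xe : forall k n, (\int[Q]_w (clipe k%:R (X n w))%:E <= (e k)%:E)%E).

Let mX n : measurable_fun setT (X n). Proof. exact: intg_measurable. Qed.

Let X0e k : (\int[Q]_w (clipe k%:R (X0 w))%:E <= (e k)%:E)%E.
Proof.
apply: (@fatou_le (fun n w => clipe k%:R (X n w))) => //.
- by move=> n; exact: measurableT_comp (measurable_clipe k%:R) _.
- exact: measurableT_comp (measurable_clipe k%:R) _.
- by move=> n w; exact: clipe_ge0.
- by move=> w; exact: clipe_ge0.
- by apply: filterS XX0 => w; exact: clipe_cvg.
Qed.

(** Fatou's lemma carries the bounds to the limit, and at level 0 the excess is [|X0|] itself. *)
Lemma uniformly_integrable_intg : intg Q X0.
Proof.
apply/integrableP; split; first exact/measurable_EFinP.
have E (Z : W -> R) : (\int[Q]_w (clipe 0%:R (Z w))%:E = \int[Q]_w `|(EFin \o Z) w|)%E.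
  by apply: eq_integral => w _; rewrite /clipe subr0 max_l.
by have := X0e 0; rewrite E => /le_lt_trans; apply; rewrite ltry.
Qed.

Let iX0 := uniformly_integrable_intg.

(** The difference [X n - X0] is a difference of truncations, which tends to 0 in mean by bounded
    convergence, plus two remainders of mean at most [e k] each. First [n], then [k] tends to
    infinity. *)
Lemma uniformly_integrable_limit (B : set W) (b : R) : measurable B ->
  (forall n, \int[Q]_(w in B) X n w = b) -> \int[Q]_(w in B) X0 w = b.
Proof.
move=> mB Xb.
have iclip Z c : 0 <= c -> intg Q Z -> intg Q (fun w => clipe c (Z w)).
  move=> c0 iZ; apply: (intg_le _ _ iZ).
    exact: measurableT_comp (measurable_clipe c) (intg_measurable iZ).
  by move=> w; rewrite ger0_norm ?clipe_ge0//; exact: clipe_le.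
have itr Z c : 0 <= c -> intg Q Z -> intg Q (fun w => trunc c (Z w)).
  move=> c0 iZ; apply: (intg_le (Y := fun=> c) _ _ (intg_cst _ _)).
    exact: measurableT_comp (measurable_trunc c) (intg_measurable iZ).
  by move=> w; rewrite [leRHS]ger0_norm//; exact: trunc_bound.
have eR Z k : intg Q Z -> (\int[Q]_w (clipe k%:R (Z w))%:E <= (e k)%:E)%E ->
  \int[Q]_w clipe k%:R (Z w) <= e k.
  by move=> iZ; rewrite RintK ?lee_fin//; exact: iclip.
have step1 k n : `|\int[Q]_(w in B) X0 w - b| <=
    \int[Q]_w `|trunc k%:R (X n w) - trunc k%:R (X0 w)| + (e k + e k).
  have c0 : 0 <= k%:R :> R by [].
  rewrite -(Xb n) distrC -RintegralB//; try exact: intgS.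
  have iXX : intg Q (fun w => X n w - X0 w) by exact: intgB.
  apply: le_trans (le_normr_Rintegral mB (intgS mB iXX)) _.
  have it : intg Q (fun w => `|trunc k%:R (X n w) - trunc k%:R (X0 w)|).
    by apply: intg_norm; apply: intgB; exact: itr.
  have ic : intg Q (fun w => clipe k%:R (X n w) + clipe k%:R (X0 w)).
    by apply: intgD; exact: iclip.
  rewrite Rint_indic//.
  apply: (@le_trans _ _ (\int[Q]_w (`|trunc k%:R (X n w) - trunc k%:R (X0 w)| +
    (clipe k%:R (X n w) + clipe k%:R (X0 w))))).
    apply: le_Rintegral => //.
    - by apply: intg_indic => //; exact: intg_norm.
    - exact: intgD.
    - move=> w _; have h1 := trunc_clip (X n w) c0; have h2 := trunc_clip (X0 w) c0.
      apply: (@le_trans _ _ `|X n w - X0 w|).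
        by rewrite indicE; case: (_ \in _); rewrite ?mul1r ?mul0r.
      rewrite (_ : X n w - X0 w = (X n w - trunc k%:R (X n w)) +
        (trunc k%:R (X n w) - trunc k%:R (X0 w)) - (X0 w - trunc k%:R (X0 w))); last by ring.
      have := ler_normB (X n w - trunc k%:R (X n w) + (trunc k%:R (X n w) - trunc k%:R (X0 w))) (X0 w - trunc k%:R (X0 w)).
      have := ler_normD (X n w - trunc k%:R (X n w)) (trunc k%:R (X n w) - trunc k%:R (X0 w)).
      lra.
  rewrite RintegralD// RintegralD//; try exact: iclip.
  by rewrite lerD2l lerD//; apply: eR.
have step2 k : `|\int[Q]_(w in B) X0 w - b| <= e k + e k.
  have c0 : 0 <= k%:R :> R by [].
  have D0 n : measurable_fun setT (fun w => `|trunc k%:R (X n w) - trunc k%:R (X0 w)|).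
    by apply: measurableT_comp => //; apply: measurable_funB; exact: measurableT_comp (measurable_trunc _) _.
  have D1 : {ae Q, forall w, setT w -> `|trunc k%:R (X n w) - trunc k%:R (X0 w)| @[n --> \oo] --> (0 : R)}.
    apply: filterS XX0 => w hw _; rewrite -(normr0 R) -(subrr (trunc k%:R (X0 w))).
    by apply: cvg_norm; apply: cvgB; [exact: trunc_cvg|exact: cvg_cst].
  have D2 : {ae Q, forall w, forall n, setT w -> `| `|trunc k%:R (X n w) - trunc k%:R (X0 w)| | <= k%:R + k%:R}.
    apply: aeW => w n _; rewrite normr_id; apply: le_trans (ler_normB _ _) _.
    by apply: lerD; exact: trunc_bound.
  have [_] := Rint_dct measurableT D0 (measurable_cst _) D1 (intg_cst _ _) D2.
  rewrite Rintegral_cst// mul0r => h.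
  have h' : \int[Q]_w `|trunc k%:R (X n w) - trunc k%:R (X0 w)| + (e k + e k) @[n --> \oo] --> (0 + (e k + e k)).
    by apply: cvgD => //; exact: cvg_cst.
  rewrite -[leRHS]add0r -(cvg_lim _ h')//; apply: limr_ge.
    by apply/cvg_ex; eexists; exact: h'.
  by apply: nearW => n; exact: step1.
apply/eqP; rewrite -subr_eq0 -normr_le0.
have h : e n + e n @[n --> \oo] --> (0 + 0 : R) by apply: cvgD; exact: e0.
rewrite -[leRHS](addr0 0) -(cvg_lim _ h)//; apply: limr_ge.
  by apply/cvg_ex; eexists; exact: h.
by apply: nearW => n; exact: step2.
Qed.

End uniformly_integrable.

(** With [y = |x|] this is [(y - k) (k + 1) <= 1 + y^2], a form of Chebyshev's inequality; dividing
    by [k + 1] and not by [k] covers [k = 0]. *)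
Lemma clipe_le_square (k : nat) (x : R) : clipe k%:R x <= k.+1%:R^-1 * (1 + x ^+ 2).
Proof.
rewrite /clipe -(real_normK (num_real x)) ge_max; apply/andP; split; last first.
  by rewrite mulr_ge0 ?invr_ge0// addr_ge0// sqr_ge0.
rewrite mulrC ler_pdivlMr ?ltr0Sn// -natr1.
have := normr_ge0 x; have : 0 <= k%:R :> R by [].
move: `|x| (k%:R : R) => y m; nra.
Qed.

(** A bound in L2 gives uniform integrability at the rate [(1 + K) / (k + 1)]. *)
Lemma L2_bounded_limit (X : nat -> W -> R) (X0 : W -> R) (K : R) :
  (forall n, intg Q (X n)) -> measurable_fun setT X0 ->
  {ae Q, forall w, X n w @[n --> \oo] --> X0 w} ->
  (forall n, (\int[Q]_w (X n w ^+ 2)%:E <= K%:E)%E) ->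
  intg Q X0 /\ forall B b, measurable B -> (forall n, \int[Q]_(w in B) X n w = b) ->
    \int[Q]_(w in B) X0 w = b.
Proof.
move=> iX mX0 XX0 XK.
pose e (k : nat) : R := k.+1%:R^-1 * (1 + K).
have e0 : e k @[k --> \oo] --> 0.
  rewrite -(mul0r (1 + K)); apply: cvgM; [exact: invnS_cvg0|exact: cvg_cst].
have Xe k n : (\int[Q]_w (clipe k%:R (X n w))%:E <= (e k)%:E)%E.
  have mXn := intg_measurable (iX n).
  have m2 : measurable_fun setT (fun w => (X n w ^+ 2)%:E).
    by apply/measurable_EFinP; exact: measurable_funX.
  have m3 : measurable_fun setT (fun w => 1%:E + (X n w ^+ 2)%:E)%E.
    by apply/measurable_EFinP; apply: measurable_funD => //; exact: measurable_funX.
  have p0 w : (0 <= (X n w ^+ 2)%:E)%E by rewrite lee_fin sqr_ge0.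
  apply: (@le_trans _ _ (\int[Q]_w ((k.+1%:R^-1)%:E * (1%:E + (X n w ^+ 2)%:E))%E)%E).
    apply: ge0_le_integral => //.
    - by move=> w _; rewrite lee_fin clipe_ge0.
    - by apply/measurable_EFinP; exact: measurableT_comp (measurable_clipe _) _.
    - exact: measurable_funeM.
    - by move=> w _; rewrite lee_fin; exact: clipe_le_square.
  rewrite ge0_integralZl//; last by move=> w _; apply: adde_ge0.
  have i1 : (\int[Q]_w 1%:E = 1%:E)%E by rewrite integral_cst// mul1e; exact: probability_setT.
  rewrite ge0_integralD// i1 EFinM.
  by apply: lee_wpmul2l; [rewrite lee_fin invr_ge0|rewrite EFinD leeD2l].
split; first exact: uniformly_integrable_intg iX mX0 XX0 Xe.
by move=> B b; exact: (uniformly_integrable_limit iX mX0 XX0 e0 Xe).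
Qed.

End limits.

(** * Stopping times and optional stopping *)

Section stopping.
Context (R : realType) (T : {posnum R}).
Implicit Types (o : option (time T)) (r t : time T).

(** The minimum of a possibly infinite time and [t], as a point of [[0, T]]: stopping a process at
    [o] is reading it at [capt o t]. *)
Definition capt o t := if o is Some r then tmin r t else t.

Definition omin o1 o2 := if o1 is Some r1 then
  if o2 is Some r2 then Some (tmin r1 r2) else o1 else o2.

Lemma tminC r t : tmin r t = tmin t r.
Proof. by apply: time_val_inj; rewrite !tmin_val minC. Qed.

Lemma tminA r q t : tmin r (tmin q t) = tmin (tmin r q) t.
Proof. by apply: time_val_inj; rewrite !tmin_val minA. Qed.

Lemma tmin_idl r t : time_val r <= time_val t -> tmin r t = r.
Proof. by rewrite /tmin => ->. Qed.

Lemma capt_omin o1 o2 t : capt (omin o1 o2) t = capt o1 (capt o2 t).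
Proof. by case: o1 => [r1|]; case: o2 => [r2|] //=; rewrite tminA. Qed.

Lemma capt_le o t : time_val (capt o t) <= time_val t.
Proof. by case: o => [r|] //=; rewrite tmin_val ge_min lexx orbT. Qed.

Lemma capt_mono o r t : time_val r <= time_val t -> time_val (capt o r) <= time_val (capt o t).
Proof. by case: o => [q|] //= rt; rewrite !tmin_val le_min !ge_min lexx rt orbT. Qed.

Lemma capt_cvg o (u : nat -> time T) t : time_val (u n) @[n --> \oo] --> time_val t ->
  time_val (capt o (u n)) @[n --> \oo] --> time_val (capt o t).
Proof.
case: o => [r|] //= ut; rewrite tminC; under eq_fun do rewrite tminC.
exact: tmin_cvg.
Qed.

Lemma stop_le_omin o1 o2 o1' o2' : stop_le o1 o1' -> stop_le o2 o2' ->
  stop_le (omin o1 o2) (omin o1' o2').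
Proof.
case: o1 => [?|]; case: o2 => [?|]; case: o1' => [?|]; case: o2' => [?|] //=;
  rewrite ?tmin_val ?le_min ?ge_min => h1 h2; rewrite ?h1 ?h2 ?orbT//.
Qed.

End stopping.

Section optional_stopping.
Context (R : realType) (T : {posnum R}) d (W : measurableType d) (Q : probability W R).
Implicit Types (M N : time T -> W -> R) (tau sigma : W -> option (time T)).
Variables (F : time T -> set_system W) (uF : usual Q F).

Lemma stoppedE tau M t w : stopped tau M t w = M (capt (tau w) t) w.
Proof. by rewrite /stopped /capt; case: (tau w) => [r|] //; rewrite /tmin; case: ifP. Qed.

Lemma rc_stopped tau M w : rc (M ^~ w) -> rc (stopped tau M ^~ w).
Proof.
move=> rM u t tu ut; rewrite stoppedE; under eq_fun do rewrite stoppedE.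
by apply: rM; [move=> n; exact: capt_mono|exact: capt_cvg].
Qed.

Lemma stopped_omin tau sigma M : stopped (fun w => omin (tau w) (sigma w)) M =
  stopped sigma (stopped tau M).
Proof. by apply/funext => t; apply/funext => w; rewrite !stoppedE capt_omin. Qed.

Lemma ominC (o1 o2 : option (time T)) : omin o1 o2 = omin o2 o1.
Proof. by case: o1; case: o2 => //= a b; rewrite tminC. Qed.

Definition stop_ev sigma (t : time T) : set W :=
  [set w | exists2 r, sigma w = Some r & time_val r <= time_val t].

Lemma stop_evP sigma t : stopping_time F time0 sigma -> F t (stop_ev sigma t).
Proof. by case=> _; apply; exact: time0_le. Qed.

Lemma stopping_timeP sigma : (forall t, F t (stop_ev sigma t)) -> stopping_time F time0 sigma.
Proof. by move=> h; split => [w r _|t _]; [exact: time0_le|exact: h]. Qed.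

Lemma stopping_omin tau sigma : stopping_time F time0 tau -> stopping_time F time0 sigma ->
  stopping_time F time0 (fun w => omin (tau w) (sigma w)).
Proof.
move=> h1 h2; apply: stopping_timeP => t.
have -> : stop_ev (fun w => omin (tau w) (sigma w)) t = stop_ev tau t `|` stop_ev sigma t.
  apply/seteqP; split => w /=.
    move=> [r]; rewrite /omin; case E1: (tau w) => [r1|]; case E2: (sigma w) => [r2|] //=.
    - move=> [<-]; rewrite tmin_val ge_min => /orP[]; [left; exists r1|right; exists r2] => //.
    - by move=> [<-]; left; exists r1.
    - by move=> [<-]; right; exists r2.
  move=> [[r Er rt]|[r Er rt]]; rewrite /stop_ev /= Er.
    case: (sigma w) => [q|] /=; [exists (tmin r q) => //|by exists r].
    by rewrite tmin_val ge_min rt.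
  case: (tau w) => [q|] /=; [exists (tmin q r) => //|by exists r].
  by rewrite tmin_val ge_min rt orbT.
by apply: (sigmaU (usual_sigma uF t)); exact: stop_evP.
Qed.

Lemma localizing_omin (tau sigma : nat -> W -> option (time T)) :
  localizing Q F time0 tau -> localizing Q F time0 sigma ->
  localizing Q F time0 (fun n w => omin (tau n w) (sigma n w)).
Proof.
move=> [s1 i1 n1] [s2 i2 n2]; split.
- by move=> n; exact: stopping_omin.
- by apply: filterS2 i1 i2 => w h1 h2 n; exact: stop_le_omin.
- apply: filterS2 (filterI i1 i2) (filterI n1 n2) => w [h1 h2] [[m1 e1] [m2 e2]].
  have up (f : nat -> option (time T)) m : (forall n, stop_le (f n) (f n.+1)) -> f m = None ->
    forall n, (m <= n)%N -> f n = None.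
    move=> hf fm n; elim: n => [|n IH]; first by rewrite leqn0 => /eqP <-.
    rewrite leq_eqVlt => /predU1P[<- //|]; rewrite ltnS => /IH fn.
    by have := hf n; rewrite fn; case: (f n.+1).
  exists (maxn m1 m2).
  by rewrite (up _ _ h1 e1) ?leq_maxl// (up _ _ h2 e2) ?leq_maxr.
Qed.

Lemma localizing_None (tau : nat -> W -> option (time T)) : localizing Q F time0 tau ->
  {ae Q, forall w, \forall n \near \oo, tau n w = None}.
Proof.
move=> [_ i1 n1]; apply: filterS2 i1 n1 => w hf [m fm].
exists m => // n /=; elim: n => [|n IH]; first by rewrite leqn0 => /eqP <-.
rewrite leq_eqVlt => /predU1P[<- //|]; rewrite ltnS => /IH fn.
by have := hf n; rewrite fn; case: (tau n.+1 w).
Qed.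

Section discretize.
Variables (sigma : W -> option (time T)) (t : time T).
Hypothesis hs : stopping_time F time0 sigma.

(** The capped stopping time rounded up to the grid, then capped at [t] again. It takes finitely
    many values and converges from above to [capt (sigma w) t]. *)
Definition dstop n w : time T := tmin (dsc n (capt (sigma w) t)) t.

Definition dcell n k : set W := [set w | cell n (capt (sigma w) t) = k].

Let capt_stop q w : time_val q < time_val t ->
  (time_val (capt (sigma w) t) <= time_val q) <-> stop_ev sigma q w.
Proof.
move=> qt; rewrite /stop_ev /capt /=; case: (sigma w) => [r|]; last first.
  by split; [rewrite leNgt qt|case].
rewrite tmin_val ge_min [time_val t <= _]leNgt qt orbF.
by split => [h|[_ [<-]] //]; exists r.
Qed.

(** The hypothesis on [S] says that [S] belongs to the sigma-algebra of [sigma]. When the [k]-th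
    grid point is before [t], the index is at most [k] exactly if [sigma] has occurred by that
    point; otherwise it always is. *)
Lemma dcell_le (S : set W) n k : (forall q, F q (S `&` stop_ev sigma q)) -> F t S ->
  F (tmin (grid n k) t) (S `&` [set w | (cell n (capt (sigma w) t) <= k)%N]).
Proof.
move=> FS FtS; have [tq|qt] := leP (time_val t) (time_val (grid n k : time T)); last first.
  rewrite tmin_idl ?(ltW qt)// (_ : S `&` _ = S `&` stop_ev sigma (grid n k)) //.
  apply/seteqP; split => w [Sw] /= h; split => //.
    by apply/(capt_stop w qt); rewrite -cell_leE.
  by rewrite /= cell_leE; apply/(capt_stop w qt).
rewrite tminC tmin_idl// (_ : S `&` _ = S)//.
apply/seteqP; split => [w []//|w Sw]; split => //=.
by rewrite cell_leE (le_trans _ tq)// capt_le.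
Qed.

Lemma dcell_ev (S : set W) n k : (forall q, F q (S `&` stop_ev sigma q)) -> F t S ->
  F (tmin (grid n k) t) (S `&` dcell n k).
Proof.
move=> FS FtS; case: k => [|k].
  rewrite (_ : _ `&` _ = (S `&` [set w | (cell n (capt (sigma w) t) <= 0)%N])).
    exact: dcell_le.
  by apply/seteqP; split => w [Sw]; rewrite /dcell /= leqn0 => /eqP.
rewrite (_ : _ `&` _ = (S `&` [set w | (cell n (capt (sigma w) t) <= k.+1)%N]) `\`
   (S `&` [set w | (cell n (capt (sigma w) t) <= k)%N])).
  apply: (sigmaD (usual_sigma uF _)); first exact: dcell_le.
  apply: (usual_mono uF _ (dcell_le n k FS FtS)).
  rewrite !tmin_val le_min !ge_min lexx orbT andbT; apply/orP; left.
  by rewrite -cell_leE ltnW// ltnS cell_leE.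
apply/seteqP; split => w; rewrite /dcell /=.
  by move=> [Sw e]; rewrite e; split; [split|rewrite ltnn; case].
move=> [[Sw h1] h2]; split => //; apply/eqP; rewrite eqn_leq h1/= ltnNge.
by apply/negP => h3; apply: h2.
Qed.

(** Exactly one cell contributes: a value at a random time becomes a finite sum of values at fixed
    times, weighted by events. *)
Lemma dstop_sum (V : nmodType) (h : time T -> V) n w :
  h (dstop n w) = \sum_(k < (cell n (timeT : time T)).+1)
     if (cell n (capt (sigma w) t) == k) then h (tmin (grid n k) t) else 0.
Proof.
pose k0 : 'I__ := Ordinal (cell_bound n (capt (sigma w) t)).
rewrite (bigD1 k0)//= eqxx big1 ?addr0//.
by move=> k; rewrite -val_eqE /= eq_sym => /negbTE ->.
Qed.

Lemma dstop_ge n w : time_val (capt (sigma w) t) <= time_val (dstop n w).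
Proof. by rewrite tmin_val le_min dsc_ge capt_le. Qed.

Lemma dstop_cvg w : time_val (dstop n w) @[n --> \oo] --> time_val (capt (sigma w) t).
Proof.
rewrite -[X in _ --> time_val X](tmin_idl (capt_le (sigma w) t)).
by apply: tmin_cvg; exact: dsc_cvg.
Qed.

End discretize.

Let evT sigma : stopping_time F time0 sigma -> forall q, F q (setT `&` stop_ev sigma q).
Proof. by move=> h q; rewrite setTI; exact: stop_evP. Qed.

Lemma mwrt_dstop N sigma t n : stopping_time F time0 sigma ->
  (forall q, measurable_wrt (F q) (N q)) ->
  measurable_wrt (F t) (fun w => N (dstop sigma t n w) w).
Proof.
move=> hs adN.
rewrite (_ : (fun _ => _) = (fun w => \sum_(k < (cell n (timeT : time T)).+1)
   \1_(dcell sigma t n k) w * N (tmin (grid n k) t) w)); last first.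
  apply/funext => w; rewrite (@dstop_sum sigma t _ (fun q => N q w)); apply: eq_bigr => k _.
  rewrite indicE /dcell; case: ifPn => [/eqP h|/eqP h].
    by rewrite mem_set ?mul1r.
  by rewrite memNset ?mul0r.
elim: (cell n timeT).+1 => [|K IH].
  rewrite (_ : (fun _ => _) = fun=> 0); last by apply/funext => w; rewrite big_ord0.
  exact: mwrt_cst (usual_sigma uF t) _.
rewrite (_ : (fun _ => _) = (fun w => (\sum_(k < K) \1_(dcell sigma t n k) w * N (tmin (grid n k) t) w) +
  \1_(dcell sigma t n K) w * N (tmin (grid n K) t) w)); last first.
  by apply/funext => w; rewrite big_ord_recr.
apply: (mwrtD (usual_sigma uF t)) => //; apply: (mwrtM (usual_sigma uF t)).
  apply: (mwrt_indic (usual_sigma uF t)); rewrite -[dcell _ _ _ _]setTI.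
  apply: (usual_mono uF _ (dcell_ev (S := setT) n K (evT hs) (sigmaT (usual_sigma uF t)))).
  by rewrite tmin_val ge_min lexx orbT.
apply: mwrtS (adN _); apply: (usual_mono uF).
by rewrite tmin_val ge_min lexx orbT.
Qed.

(** The set of convergence has a negligible complement, hence belongs to [F t]; multiplication by
    its indicator makes the convergence hold everywhere. *)
Lemma mwrt_ae_cvg t (h : nat -> W -> R) (X : W -> R) :
  (forall n, measurable_wrt (F t) (h n)) ->
  {ae Q, forall w, h n w @[n --> \oo] --> X w} -> measurable_wrt (F t) X.
Proof.
move=> mh hX; pose A := [set w | h n w @[n --> \oo] --> X w].
have nA : Q.-negligible (~` A) by exact: hX.
have FA : F t A by rewrite -[A]setCK; apply: (sigmaC (usual_sigma uF t)); exact: usual_null uF t _ nA.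
apply: (@mwrt_ae _ _ _ _ _ _ uF t (fun w => \1_A w * X w)).
  by apply: filterS hX => w hw; rewrite indicE mem_set// mul1r.
apply: (mwrt_cvg (usual_sigma uF t) (h := fun n w => \1_A w * h n w)).
  move=> n; apply: (mwrtM (usual_sigma uF t)) => //; exact: mwrt_indic (usual_sigma uF t) _ FA.
move=> w; rewrite indicE; have [Aw|Aw] := pselect (A w).
  by rewrite mem_set// mul1r; under eq_fun do rewrite mul1r.
by rewrite memNset// mul0r; under eq_fun do rewrite mul0r; exact: cvg_cst.
Qed.

Lemma mwrt_stopped N sigma t : stopping_time F time0 sigma ->
  {ae Q, forall w, rc (N ^~ w)} -> (forall q, measurable_wrt (F q) (N q)) ->
  measurable_wrt (F t) (stopped sigma N t).
Proof.
move=> hs rN adN; apply: (mwrt_ae_cvg (h := fun n w => N (dstop sigma t n w) w)).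
  by move=> n; exact: mwrt_dstop.
apply: filterS rN => w hw; rewrite stoppedE.
by apply: hw; [move=> n; exact: dstop_ge|exact: dstop_cvg].
Qed.

Section optional.
Variables (N : time T -> W -> R) (sigma : W -> option (time T)).
Hypotheses (hN : martingale Q F time0 N) (rN : {ae Q, forall w, rc (N ^~ w)})
  (hs : stopping_time F time0 sigma).

Let adN q : measurable_wrt (F q) (N q). Proof. by have [h _ _] := (martP _ uF).1 hN. Qed.
Let iN q : intg Q (N q). Proof. by have [_ h _] := (martP _ uF).1 hN. Qed.

Let dsumE (S : set W) (h : R -> R) t n w :
  \1_S w * h (N (dstop sigma t n w) w) = \sum_(k < (cell n (timeT : time T)).+1)
     \1_(S `&` dcell sigma t n k) w * h (N (tmin (grid n k) t) w).
Proof.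
rewrite (@dstop_sum sigma t _ (fun q => h (N q w))) mulr_sumr; apply: eq_bigr => k _.
rewrite !indicE in_setI /dcell; case: ifPn => [/eqP e|/eqP e].
  by rewrite [X in _ && X]mem_set// andbT.
by rewrite [X in _ && X]memNset// andbF mul0r mulr0.
Qed.

Let dsumt (S : set W) (X : W -> R) t n w :
  \1_S w * X w = \sum_(k < (cell n (timeT : time T)).+1)
     \1_(S `&` dcell sigma t n k) w * X w.
Proof.
transitivity (\sum_(k < (cell n (timeT : time T)).+1)
    if cell n (capt (sigma w) t) == k then \1_S w * X w else 0 : R).
  exact: (@dstop_sum sigma t _ (fun q => \1_S w * X w) n w).
apply: eq_bigr => k _.
rewrite !indicE in_setI /dcell; case: ifPn => [/eqP e|/eqP e].
  by rewrite [X in _ && X]mem_set// andbT.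
by rewrite [X in _ && X]memNset// andbF mul0r.
Qed.

Let idstop t n : intg Q (fun w => N (dstop sigma t n w) w).
Proof.
have H k : intg Q (fun w => \1_(setT `&` dcell sigma t n k) w * N (tmin (grid n k) t) w).
  apply: intg_indic => //.
  apply: (usual_meas uF (t := tmin (grid n k) t)); apply: dcell_ev => //; first exact: evT.
  exact: sigmaT (usual_sigma uF t).
rewrite (_ : (fun _ => _) = (fun w => \sum_(k < (cell n (timeT : time T)).+1)
     \1_(setT `&` dcell sigma t n k) w * N (tmin (grid n k) t) w)).
  exact: (Rint_sum _ H).1.
apply/funext => w; rewrite -(dsumE setT id t n w) indicE mem_set ?mul1r//.
Qed.

Let dstop_eq (S : set W) t n : (forall q, F q (S `&` stop_ev sigma q)) -> F t S ->
  \int[Q]_(w in S) N (dstop sigma t n w) w = \int[Q]_(w in S) N t w.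
Proof.
move=> FS FtS; have mS := usual_meas uF FtS.
have FSk k := dcell_ev n k FS FtS.
have mSk k : measurable (S `&` dcell sigma t n k) by exact: (usual_meas uF (FSk k)).
rewrite (Rint_indic _ _ mS) [RHS](Rint_indic _ _ mS).
under eq_Rintegral do rewrite (dsumE S id t n).
under [RHS]eq_Rintegral do rewrite (dsumt S (N t) t n).
rewrite (Rint_sum (h := fun k w => \1_(S `&` dcell sigma t n k) w * N (tmin (grid n k) t) w) _ (fun k => intg_indic (mSk k) (iN (tmin (grid n k) t)))).2.
rewrite (Rint_sum (h := fun k w => \1_(S `&` dcell sigma t n k) w * N t w) _ (fun k => intg_indic (mSk k) (iN t))).2.
(* Cell by cell: the intersection of [S] with the cell is an event of [F] at the capped grid point,
   from which the martingale property leads to [t]. *)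
apply: eq_bigr => k _; rewrite -!(Rint_indic _ _ (mSk k)).
have [_ _ h] := (martP _ uF).1 hN; apply/esym/h => //.
by rewrite tmin_val ge_min lexx orbT.
Qed.

(** The same decomposition into cells, with the submartingale property of the excess. The bound is
    the same for all [n], which makes the discretized values uniformly integrable. *)
Let dstop_clip t n c : 0 <= c ->
  (\int[Q]_w (clipe c (N (dstop sigma t n w) w))%:E <= \int[Q]_w (clipe c (N t w))%:E)%E.
Proof.
move=> c0; have FT := sigmaT (usual_sigma uF t).
have FSk k := dcell_ev (S := setT) n k (evT hs) FT.
have mSk k : measurable (setT `&` dcell sigma t n k) by exact: (usual_meas uF (FSk k)).
have ic q : intg Q (fun w => clipe c (N q w)).
  apply: (intg_le _ _ (iN q)).
    exact: measurableT_comp (measurable_clipe c) (intg_measurable (iN q)).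
  by move=> w; rewrite ger0_norm ?clipe_ge0//; exact: clipe_le.
have icd : intg Q (fun w => clipe c (N (dstop sigma t n w) w)).
  apply: (intg_le _ _ (idstop t n)).
    exact: measurableT_comp (measurable_clipe c) (intg_measurable (idstop t n)).
  by move=> w; rewrite ger0_norm ?clipe_ge0//; exact: clipe_le.
apply: le_Rint_integral => //.
rewrite (Rint_indic _ _ measurableT) [leRHS](Rint_indic _ _ measurableT).
under eq_Rintegral do rewrite (dsumE setT (clipe c) t n).
under [leRHS]eq_Rintegral do rewrite (dsumt setT (fun w => clipe c (N t w)) t n).
rewrite (Rint_sum (h := fun k w => \1_(setT `&` dcell sigma t n k) w * clipe c (N (tmin (grid n k) t) w)) _ (fun k => intg_indic (mSk k) (ic (tmin (grid n k) t)))).2.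
rewrite (Rint_sum (h := fun k w => \1_(setT `&` dcell sigma t n k) w * clipe c (N t w)) _ (fun k => intg_indic (mSk k) (ic t))).2.
apply: ler_sum => k _; rewrite -!(Rint_indic _ _ (mSk k)).
rewrite -lee_fin -(RintK (mSk k) (ic _)) -(RintK (mSk k) (ic t)).
apply: (mart_submart uF hN c0 _ (FSk k)).
by rewrite tmin_val ge_min lexx orbT.
Qed.

(** For every [n] the discretized values have over [S] the integral of [N t]. Right-continuity gives
    their limit, and uniform integrability lets the integrals follow. *)
Lemma optional_stopping_event (S : set W) t : (forall q, F q (S `&` stop_ev sigma q)) -> F t S ->
  intg Q (stopped sigma N t) /\
  \int[Q]_(w in S) stopped sigma N t w = \int[Q]_(w in S) N t w.
Proof.
move=> FS FtS.
have ms : measurable_fun setT (stopped sigma N t).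
  exact: mwrt_measurable (usual_meas uF (t := t)) (mwrt_stopped t hs rN adN).
have cv : {ae Q, forall w, N (dstop sigma t n w) w @[n --> \oo] --> stopped sigma N t w}.
  apply: filterS rN => w hw; rewrite stoppedE.
  by apply: hw; [move=> n; exact: dstop_ge|exact: dstop_cvg].
have Xe k n : (\int[Q]_w (clipe k%:R (N (dstop sigma t n w) w))%:E <=
    (\int[Q]_w clipe k%:R (N t w))%:E)%E.
  rewrite -RintK//; first exact: dstop_clip.
  apply: (intg_le _ _ (iN t)).
    exact: measurableT_comp (measurable_clipe _) (intg_measurable (iN t)).
  by move=> w; rewrite ger0_norm ?clipe_ge0//; exact: clipe_le.
split; first exact: uniformly_integrable_intg (idstop t) ms cv Xe.
apply: (uniformly_integrable_limit (idstop t) ms cv (clip_int_cvg0 (iN t)) Xe).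
  exact: (usual_meas uF FtS).
by move=> n; exact: dstop_eq.
Qed.

(** An event of [F r] is cut along [sigma <= r]. On the first piece the stopped process is constant
    from [r] to [t]; the second belongs to the sigma-algebra of [sigma]. *)
Theorem optional_stopping : martingale Q F time0 (stopped sigma N).
Proof.
have i t : intg Q (stopped sigma N t).
  by have [] := @optional_stopping_event setT t (evT hs) (sigmaT (usual_sigma uF t)).
apply/(martP _ uF); split => [t|//|r t rt B FB]; first exact: mwrt_stopped.
have FtB := usual_mono uF rt FB.
have mB := usual_meas uF FB.
have FE : F r (B `&` stop_ev sigma r) by apply: (sigmaI (usual_sigma uF r)) => //; exact: stop_evP.
have FE' : F r (B `\` stop_ev sigma r) by apply: (sigmaD (usual_sigma uF r)) => //; exact: stop_evP.
have mE := usual_meas uF FE; have mE' := usual_meas uF FE'.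
have split_int (X : W -> R) : intg Q X -> \int[Q]_(w in B) X w =
   \int[Q]_(w in B `&` stop_ev sigma r) X w + \int[Q]_(w in B `\` stop_ev sigma r) X w.
  move=> iX; rewrite -{1}(setUIDK B (stop_ev sigma r)) Rintegral_setU//.
    by rewrite setUIDK; exact: intgS.
  by rewrite disj_set2E; apply/eqP; apply/seteqP; split => // w [[_ h] [_]].
rewrite (split_int _ (i t)) (split_int _ (i r)); congr (_ + _).
  apply: eq_Rintegral => w; rewrite inE => -[Bw [q sq qr]].
  by rewrite !stoppedE sq /= !tmin_idl// (le_trans qr).
(* For [q' < r] this piece does not meet [sigma <= q'], so that it satisfies the hypothesis of
   [optional_stopping_event]. Stopping is invisible in its integral, at [r] as well as at [t]. *)
have key q : time_val r <= time_val q ->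
  \int[Q]_(w in B `\` stop_ev sigma r) stopped sigma N q w =
  \int[Q]_(w in B `\` stop_ev sigma r) N q w.
  move=> rq; apply: (@optional_stopping_event _ q _ _).2; last exact: (usual_mono uF rq).
  move=> q'; have [rq'|q'r] := leP (time_val r) (time_val q').
    apply: (sigmaI (usual_sigma uF q')); last exact: stop_evP.
    exact: (usual_mono uF rq').
  rewrite (_ : _ `&` _ = set0); first exact: sigma0 (usual_sigma uF q').
  apply/seteqP; split => // w [[_ h]] [x sx xq']; apply: h; exists x => //.
  by rewrite (le_trans xq')// ltW.
rewrite key// key//; have [_ _ h] := (martP _ uF).1 hN; exact: h.
Qed.

End optional.
End optional_stopping.

(** * Integrals along a path *)

Section square.
Context d (U : measurableType d) (R : realType).
Variables (mu : {finite_measure set U -> \bar R}) (v : U -> R) (f : U -> R).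
Hypotheses (mv : measurable_fun setT v) (nv : forall r, {ae mu, forall q, v q <> v r}).
Hypothesis h : mu.-integrable setT (EFin \o f).

(* Fubini on the square, split along its diagonal. *)
Lemma square_integral :
  (\int[mu]_q f q) ^+ 2 = 2 * \int[mu]_q ((\int[mu]_r (\1_[set r | v r <= v q] r * f r)) * f q) /\
  mu.-integrable setT (fun q => ((\int[mu]_r (\1_[set r | v r <= v q] r * f r)) * f q)%:E).
Proof.
have mf : measurable_fun setT f by move/measurable_int : h => /measurable_EFinP.
pose p q := \int[mu]_r (\1_[set r | v r <= v q] r * f r).
rewrite -/(p _); set G := \int[mu]_q f q.
have mle q : measurable [set r | v r <= v q].
  by rewrite -[X in measurable X]setTI; exact: measurable_fun_ler.
have b1 (d' : measure_display) (U' : measurableType d') (A : set U') x : `|\1_A x : R| <= 1.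
  by rewrite indicE; case: (_ \in _); rewrite ?normr1 ?normr0.
have mif q : measurable_fun setT (fun r => \1_[set r | v r <= v q] r * f r).
  by apply: measurable_funM => //; exact: measurable_indic.
have i1 q : mu.-integrable setT (EFin \o (fun r => \1_[set r | v r <= v q] r * f r)).
  apply: le_integrable h => //; first exact/measurable_EFinP.
  by move=> r _ /=; rewrite lee_fin normrM ler_piMl.
pose S : set (U * U) := [set z | v z.2 <= v z.1].
have mS : measurable S.
  have m1 : measurable_fun setT (fun z : U * U => v z.1) by exact: measurableT_comp mv measurable_fst.
  have m2 : measurable_fun setT (fun z : U * U => v z.2) by exact: measurableT_comp mv measurable_snd.
  by rewrite -[S]setTI; apply: measurable_fun_ler.
have m1 : measurable_fun setT (fun z : U * U => f z.1) by exact: measurableT_comp mf measurable_fst.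
have m2 : measurable_fun setT (fun z : U * U => f z.2) by exact: measurableT_comp mf measurable_snd.
have I0 : (mu \x mu)%E.-integrable setT (fun z : U * U => (f z.1 * f z.2)%:E).
  apply/integrable12ltyP; first by apply/measurable_EFinP; exact: measurable_funM.
  have mn : measurable_fun setT (fun x => `|f x|%:E) by apply/measurable_EFinP; exact: measurableT_comp.
  have -> : (\int[mu]_x \int[mu]_y `|(f x * f y)%:E| = \int[mu]_x `|f x|%:E * \int[mu]_x `|f x|%:E)%E.
    rewrite -ge0_integralZr//; last by apply: integral_ge0 => x _; rewrite lee_fin.
    apply: eq_integral => q _ /=.
    under eq_integral do rewrite normrM EFinM.
    by rewrite ge0_integralZl.
  have /integrableP[_ hoo] := h.
  have h0 : (0 <= \int[mu]_x `|f x|%:E)%E by apply: integral_ge0 => x _; rewrite lee_fin.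
  by apply: lte_mul_pinfty => //; rewrite ge0_fin_numE.
have I (A : set (U * U)) : measurable A ->
  (mu \x mu)%E.-integrable setT (fun z : U * U => (\1_A z * (f z.1 * f z.2))%:E).
  move=> mA; apply: le_integrable I0 => //.
    apply/measurable_EFinP; apply: measurable_funM; first exact: measurable_indic.
    exact: measurable_funM.
  by move=> z _ /=; rewrite lee_fin normrM ler_piMl.
have Ih := I _ mS; have Ik := I _ (measurableC mS).
have eh q : \int[mu]_r (\1_S (q, r) * (f q * f r)) = p q * f q.
  rewrite -(RintegralZr _ measurableT (i1 q)); apply: eq_Rintegral => r _.
  by rewrite -mulrA [f r * _]mulrC.
have ek r : \int[mu]_q (\1_(~` S) (q, r) * (f q * f r)) = p r * f r.
  rewrite -(RintegralZr _ measurableT (i1 r)).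
  apply: Rint_ae_eq.
  - apply: measurable_funM; last by apply: measurable_funM.
    have mSC : measurable_fun setT (\1_(~` S) : U * U -> R) by apply: measurable_indic; exact: measurableC.
    exact: (measurable_fun_pair1 r mSC).
  - by apply: measurable_funM.
  - apply: filterS (nv r) => q qr; rewrite mulrA; congr (_ * _ * _).
    rewrite !indicE in_setC; congr (_ %:R); congr nat_of_bool.
    apply/idP/idP.
      by rewrite notin_setE inE /S /= => /negP; rewrite -ltNge => /ltW.
    by rewrite inE notin_setE /S /= => h1; apply/negP; rewrite -ltNge lt_neqAle h1 andbT; apply/eqP.
have [ih _] := Rint_fubini_l (f := fun q r => \1_S (q, r) * (f q * f r)) Ih.
have fk := Rint_fubini (f := fun q r => \1_(~` S) (q, r) * (f q * f r)) Ik.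
have [ik _] := Rint_fubini_l (f := fun q r => \1_(~` S) (q, r) * (f q * f r)) Ik.
have ipf : mu.-integrable setT (EFin \o (fun q => p q * f q)).
  rewrite (_ : EFin \o _ = (fun q => (\int[mu]_r (\1_S (q, r) * (f q * f r)))%:E)); first exact: ih.
  by apply/funext => q /=; rewrite eh.
split; last exact: ipf.
have iA (A : set (U * U)) q : measurable A -> mu.-integrable setT (EFin \o (fun r => \1_A (q, r) * (f q * f r))).
  move=> mA; have mAq : measurable_fun setT (fun r => \1_A (q, r) : R).
    have mA' : measurable_fun setT (\1_A : U * U -> R) by exact: measurable_indic.
    exact: (measurable_fun_pair2 q mA').
  apply: (le_integrable measurableT _ _ (integrableZl measurableT (f q) h)).
    apply/measurable_EFinP; apply: (measurable_funM mAq).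
    by apply: measurable_funM; [exact: measurable_cst|exact: mf].
  by move=> r _ /=; rewrite lee_fin normrM ler_piMl.
have e q : f q * G = p q * f q + \int[mu]_r (\1_(~` S) (q, r) * (f q * f r)).
  rewrite -eh -(RintegralZl (f q) measurableT h).
  rewrite -(RintegralD measurableT (iA _ q mS) (iA _ q (measurableC mS))).
  apply: eq_Rintegral => r _; rewrite -mulrDl !indicE in_setC.
  by case: (_ \in _); rewrite /= ?addr0 ?add0r mul1r.
rewrite expr2 {1}/G -(RintegralZr G measurableT h).
under eq_Rintegral do rewrite e.
rewrite (RintegralD measurableT ipf ik) -fk.
under [X in _ + X]eq_Rintegral do rewrite ek.
by rewrite mulr2n mulrDl mul1r.
Qed.

End square.

Section path_integral.
Context (R : realType) (T : {posnum R}).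
Variable mu : {finite_measure set (borel (time T)) -> \bar R}.
Hypothesis mu0 : forall t : borel (time T), mu [set t] = 0.
Implicit Types (f g : borel (time T) -> R) (r t : time T).

Definition pint f t : R := \int[mu]_(q in upto t) f q.

Definition pintg f := mu.-integrable setT (EFin \o f).

Lemma pintg_measurable f : pintg f -> measurable_fun setT f.
Proof. by move=> /measurable_int /measurable_EFinP. Qed.

Lemma pintE f t : pint f t = \int[mu]_q (\1_(upto t) q * f q).
Proof.
rewrite /pint Rintegral_mkcond; apply: eq_Rintegral => q _.
by rewrite patchE indicE; case: (_ \in _); rewrite ?mul1r ?mul0r.
Qed.

Lemma pintg_le f g : measurable_fun setT f -> (forall q, `|f q| <= `|g q|) ->
  pintg g -> pintg f.
Proof.
move=> mf fg; apply: le_integrable => //; first exact/measurable_EFinP.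
by move=> q _ /=; rewrite lee_fin.
Qed.

Lemma pintg_norm f : pintg f -> pintg (fun q => `|f q|).
Proof. by move=> h; exact: integrable_norm. Qed.

Lemma pintgB f g : pintg f -> pintg g -> pintg (fun q => f q - g q).
Proof. by move=> h k; exact: (integrableB measurableT h k). Qed.

Lemma pintgZ c f : pintg f -> pintg (fun q => c * f q).
Proof. by move=> h; exact: (integrableZl measurableT c h). Qed.

Lemma pintg_mulb f g c : measurable_fun setT f -> (forall q, `|f q| <= c) ->
  pintg g -> pintg (fun q => f q * g q).
Proof.
move=> mf fc ig; apply: (@pintg_le _ (fun q => c * g q)).
- have mg := pintg_measurable ig; apply: measurable_funM; [exact: mf|exact: mg].
- move=> w; rewrite !normrM ler_wpM2r// (le_trans (fc w))//; exact: ler_norm.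
- exact: pintgZ.
Qed.

Lemma upto_indic_bound t q : `|\1_(upto t) q : R| <= 1.
Proof. by rewrite indicE; case: (_ \in _); rewrite ?normr1 ?normr0. Qed.

Lemma measurable_upto_indic t : measurable_fun setT (\1_(upto t) : borel (time T) -> R).
Proof. by apply: measurable_indic; exact: measurable_upto. Qed.

Lemma pintg_upto f t : pintg f -> pintg (fun q => \1_(upto t) q * f q).
Proof. by apply: pintg_mulb; [exact: measurable_upto_indic|exact: upto_indic_bound]. Qed.

Lemma pintB f g t : pintg f -> pintg g -> pint (fun q => f q - g q) t = pint f t - pint g t.
Proof.
move=> h k; rewrite !pintE -(RintegralB measurableT (pintg_upto t h) (pintg_upto t k)).
by apply: eq_Rintegral => q _; rewrite mulrBr.
Qed.

Lemma pintZ c f t : pintg f -> pint (fun q => c * f q) t = c * pint f t.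
Proof.
move=> h; rewrite !pintE -(RintegralZl _ measurableT (pintg_upto t h)).
by apply: eq_Rintegral => q _; rewrite mulrCA.
Qed.

Lemma pint_norm f t : pintg f -> `|pint f t| <= pint (fun q => `|f q|) t.
Proof.
move=> h; apply: le_normr_Rintegral; first exact: measurable_upto.
by apply: integrableS h => //; exact: measurable_upto.
Qed.

(** With [b] the indicator of an event at a given outcome, this is the weight under which the
    integration by parts from [r] to [t] is carried out. *)
Lemma pint_increment f r t b : pintg f ->
  \int[mu]_q (b * (\1_(upto t) q - \1_(upto r) q) * f q) = b * (pint f t - pint f r).
Proof.
move=> h; rewrite !pintE -(RintegralB measurableT (pintg_upto t h) (pintg_upto r h)).
rewrite -(RintegralZl _ measurableT (pintgB (pintg_upto t h) (pintg_upto r h))).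
by apply: eq_Rintegral => q _; rewrite -mulrBl mulrA.
Qed.

Lemma pint_mono f r t : pintg f -> (forall q, 0 <= f q) -> time_val r <= time_val t ->
  pint f r <= pint f t.
Proof.
move=> h f0 rt; rewrite !pintE.
apply: (le_Rintegral measurableT (pintg_upto r h) (pintg_upto t h)) => q _.
rewrite ler_wpM2r// !indicE ler_nat; case: (boolP (q \in upto r)) => //.
by rewrite inE => qr; rewrite mem_set//; exact: le_trans qr rt.
Qed.

Lemma pint_timeT f : pint f timeT = \int[mu]_q f q.
Proof.
rewrite pintE; apply: eq_Rintegral => q _.
by rewrite indicE mem_set ?mul1r//; exact: time_leT.
Qed.

Lemma null_ae (t : borel (time T)) : {ae mu, forall q, q <> t}.
Proof.
by exists [set t]; split; [exact: measurable_time1|exact: mu0|move=> q /= /contrapT].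
Qed.

Lemma pint_continuous f t : pintg f -> pint f r @[r --> t] --> pint f t.
Proof.
(* Closed intervals of radius [1/(k+1)] around [t]. They shrink to a point of measure 0, so that the
   integral of [|f|] over them tends to 0; it bounds the increments of [pint f] near [t]. *)
move=> h; pose D k : set (borel (time T)) := [set q | time_val t - k.+1%:R^-1 <= time_val q] `&`
   [set q | time_val q <= time_val t + k.+1%:R^-1].
have mD k : measurable (D k).
  by apply: measurableI; [exact: measurable_time_ge|exact: measurable_time_le].
have mf := pintg_measurable h.
have b1 (k : nat) q : `|\1_(D k) q : R| <= 1.
  by rewrite indicE; case: (_ \in _); rewrite ?normr1 ?normr0.
have iD k : pintg (fun q => \1_(D k) q * `|f q|).
  by apply: pintg_mulb => //; exact: pintg_norm.
have D1 : {ae mu, forall q, setT q -> \1_(D k) q * `|f q| @[k --> \oo] --> (0 : R)}.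
  apply: filterS (null_ae t) => q qt _; apply: cvg_near_cst.
  have d0 : 0 < `|time_val q - time_val t|.
    rewrite normr_gt0 subr_eq0; apply/eqP => h'; apply: qt; exact: time_val_inj.
  have /cvgrPdist_lt /(_ _ d0) := @invnS_cvg0 R.
  apply: filterS => k; rewrite sub0r normrN ger0_norm ?invr_ge0// => hk.
  rewrite indicE memNset ?mul0r// => -[/= h1 h2]; move: hk; apply/negP; rewrite -leNgt.
  by rewrite ler_distl h1 h2.
have D2 : {ae mu, forall q, forall k, setT q -> `|\1_(D k) q * `|f q| | <= `|f q|}.
  apply: aeW => q k _; rewrite normrM normr_id ler_piMl//.
have [_] := Rint_dct measurableT (fun k => pintg_measurable (iD k)) (measurable_cst _) D1 (pintg_norm h) D2.
rewrite Rintegral_cst// mul0r => /cvgrPdist_lt hc.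
have FF : Filter (nbhs t) := nbhs_filter t.
apply/cvgrPdist_lt => e e0; have [k _ /(_ k (leqnn k))] := hc e e0.
rewrite sub0r normrN => hk; apply/time_nbhsP; exists k.+1%:R^-1; first by rewrite invr_gt0.
move=> r rt; apply: le_lt_trans hk.
rewrite !pintE -(RintegralB measurableT (pintg_upto t h) (pintg_upto r h)).
apply: le_trans (le_normr_Rintegral measurableT (pintgB (pintg_upto t h) (pintg_upto r h))) _.
apply: le_trans (ler_norm _).
apply: le_Rintegral => //.
- by apply: pintg_norm; apply: pintgB; exact: pintg_upto.
- exact: iD.
- move=> q _; rewrite -mulrBl normrM ler_wpM2r//.
  have := rt; rewrite ltr_distl => /andP[r1 r2].
  rewrite !indicE; case: (boolP (q \in upto t)); case: (boolP (q \in upto r)).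
  + by rewrite subrr normr0.
  + rewrite notin_setE inE /upto /= => /negP; rewrite -ltNge => h1 h2.
    suff Dq : D k q by rewrite (mem_set Dq) subr0 normr1.
    split => /=.
      by apply/ltW; apply: le_lt_trans h1; apply: ltW.
    by apply: le_trans h2 _; rewrite lerDl invr_ge0.
  + rewrite notin_setE inE /upto /= => h2 /negP; rewrite -ltNge => h1.
    suff Dq : D k q by rewrite (mem_set Dq) sub0r normrN normr1.
    split => /=.
      by apply: le_trans (ltW h1); rewrite gerBl invr_ge0.
    by apply: le_trans h2 _; apply: ltW.
  + by rewrite subrr normr0.
Qed.

Lemma pint_cvg f (u : nat -> time T) t : pintg f ->
  time_val (u n) @[n --> \oo] --> time_val t -> pint f (u n) @[n --> \oo] --> pint f t.
Proof.
move=> h ut; apply: (cvg_comp u (pint f)); last exact: pint_continuous h.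
exact: cvg_timeP.
Qed.

Lemma pint_time0 f : pintg f -> pint f time0 = 0.
Proof.
move=> h; rewrite pintE (@Rint_ae_eq _ _ _ _ _ (fun=> 0)) ?Rintegral_cst ?mul0r//.
  exact: pintg_measurable (pintg_upto time0 h).
apply: filterS (null_ae time0) => q q0; rewrite indicE memNset ?mul0r// => /= hq.
by apply: q0; apply/time_val_inj/le_anti; rewrite hq time0_le.
Qed.

Lemma pint_cadlag f (s : time T) : pintg f -> cadlag_from s (pint f).
Proof.
move=> h t _; have ct := @pint_continuous f t h; split.
  by apply: cvg_trans ct; apply: cvg_app; exact: cvg_within.
by exists (pint f t); apply: cvg_trans ct; apply: cvg_app; exact: cvg_within.
Qed.

Lemma pint_square f : pintg f ->
  (\int[mu]_q f q) ^+ 2 = 2 * \int[mu]_q (pint f q * f q) /\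
  pintg (fun q => pint f q * f q).
Proof.
move=> h.
have nul (r : borel (time T)) : {ae mu, forall q : borel (time T), time_val q <> time_val r}.
  by apply: filterS (null_ae r) => q qr /time_val_inj.
have EE : (fun q => pint f q * f q) =
    (fun q => (\int[mu]_r (\1_[set r : borel (time T) | time_val r <= time_val q] r * f r)) * f q).
  by apply/funext => q; rewrite pintE.
by rewrite EE; exact: (square_integral measurable_time_val nul h).
Qed.

(** The chain rule for the square of a continuous function of finite variation, obtained from
    [pint_square] for [f] cut off after [t]. *)
Lemma pint_square_upto f t : pintg f ->
  pint f t ^+ 2 = 2 * pint (fun q => pint f q * f q) t.
Proof.
move=> h; have := pint_square (pintg_upto t h) => -[e _].
rewrite {1}pintE e; congr (_ * _); rewrite pintE; apply: eq_Rintegral => q _.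
rewrite indicE; have [qt|tq] := boolP (q \in upto t); last by rewrite !mul0r mulr0.
rewrite !mul1r; congr (_ * _); rewrite /pint; apply: eq_Rintegral => r.
rewrite inE => rq; rewrite indicE mem_set ?mul1r//.
by move: qt; rewrite inE /upto /=; exact: le_trans.
Qed.

Lemma pintg_pint f : pintg f -> pintg (fun q => pint f q * f q).
Proof. by move=> h; have [] := pint_square h. Qed.

End path_integral.

(** * Integration by parts *)

Section hitting.
Context (R : realType) (T : {posnum R}).
Variables (g : time T -> R) (c : R).
Hypotheses (mg : forall r t, time_val r <= time_val t -> g r <= g t)
  (cg : forall (u : nat -> time T) t, time_val (u n) @[n --> \oo] --> time_val t ->
     g (u n) @[n --> \oo] --> g t).

Definition hit : option (time T) := if g timeT < c then None
  else Some (time_of (inf [set time_val t | t in [set t | c <= g t]])).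

Let S := [set time_val t | t in [set t | c <= g t]].

Let hS : c <= g timeT -> [/\ has_inf S, 0 <= inf S & inf S <= T%:num].
Proof.
move=> cT; have ST : S T%:num by exists timeT.
have lb : lbound S 0 by move=> _ [t _ <-]; exact: time_val_ge0.
have hi : has_inf S by split; [exists T%:num|exists 0].
split => //; first by apply: lb_le_inf => //; exists T%:num.
exact: (ge_inf hi.2 ST).
Qed.

Let hit_reach : c <= g timeT -> c <= g (time_of (inf S)).
Proof.
move=> cT; have [hi i0 iT] := hS cT.
have H n : exists t, c <= g t /\ time_val t < inf S + n.+1%:R^-1.
  have e0 : (0 : R) < n.+1%:R^-1 by rewrite invr_gt0.
  by have [_ [t ct <-] tlt] := inf_adherent e0 hi; exists t.
have [u hu] := choice H.
have ucv : time_val (u n) @[n --> \oo] --> time_val (time_of (inf S) : time T).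
  rewrite time_ofK//; apply: (@squeeze_cvgr _ _ _ _ (fun=> inf S) (fun n => inf S + n.+1%:R^-1)).
  - apply: nearW => n; rewrite (ltW (hu n).2) andbT.
    by apply: (ge_inf hi.2); exists (u n) => //; exact: (hu n).1.
  - exact: cvg_cst.
  - by rewrite -[X in _ --> X]addr0; apply: cvgD; [exact: cvg_cst|exact: invnS_cvg0].
rewrite -(cvg_lim (@Rhausdorff R) (cg ucv)); apply: limr_ge.
  by apply/cvg_ex; eexists; exact: cg ucv.
by apply: nearW => n; exact: (hu n).1.
Qed.

(** By continuity the infimum is attained, and by monotonicity [g] stays above [c] afterwards. The
    event [hit <= t] is decided by the value at [t] alone, which makes [hit] a stopping time of the
    given filtration. *)
Lemma hit_le t : (exists2 r, hit = Some r & time_val r <= time_val t) <-> c <= g t.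
Proof.
rewrite /hit; split.
  case: ltP => [_ [//]|cT [_ [<-] h]].
  exact: le_trans (hit_reach cT) (mg h).
move=> ct; have cT : c <= g timeT by rewrite (le_trans ct)// mg// time_leT.
rewrite ltNge cT /=; eexists; first by [].
have [hi i0 iT] := hS cT.
by rewrite time_ofK//; apply: (ge_inf hi.2); exists t.
Qed.

(** Before the hitting time [g] is below [c], and continuity from the left excludes an overshoot;
    for a hitting time 0 the bound is the assumption at [time0]. *)
Lemma hit_bound : g time0 <= c -> g (capt hit timeT) <= c.
Proof.
move=> g0; rewrite /hit; case: ltP => [/ltW //|cT] /=.
rewrite tmin_idl ?time_leT//; have [hi i0 iT] := hS cT.
move: i0; rewrite le_eqVlt => /predU1P[<-|i0].
  by rewrite (_ : time_of 0 = time0)//; apply: time_val_inj; rewrite time_ofK.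
pose u n : time T := time_of (Num.max 0 (inf S - n.+1%:R^-1)).
have uv n : time_val (u n) = Num.max 0 (inf S - n.+1%:R^-1).
  rewrite time_ofK//; first by rewrite le_max lexx.
  by rewrite ge_max ge0/= (le_trans _ iT)// gerBl invr_ge0.
have ucv : time_val (u n) @[n --> \oo] --> time_val (time_of (inf S) : time T).
  rewrite time_ofK ?(ltW i0)//.
  apply: (@squeeze_cvgr _ _ _ _ (fun n => inf S - n.+1%:R^-1) (fun=> inf S)).
  - by apply: nearW => n; rewrite uv le_max lexx orbT/= ge_max (ltW i0)/= gerBl invr_ge0.
  - by rewrite -[X in _ --> X]subr0; apply: cvgB; [exact: cvg_cst|exact: invnS_cvg0].
  - exact: cvg_cst.
rewrite -(cvg_lim (@Rhausdorff R) (cg ucv)); apply: limr_le.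
  by apply/cvg_ex; eexists; exact: cg ucv.
apply: nearW => n; rewrite leNgt; apply/negP => /ltW cu.
have : inf S <= time_val (u n) by apply: (ge_inf hi.2); exists (u n).
by rewrite leNgt uv gt_max i0/= gtrBl invr_gt0 ltr0Sn.
Qed.

End hitting.

Lemma hit_stop_le (R : realType) (T : {posnum R}) (g : time T -> R) (c c' : R) :
  (forall r t, time_val r <= time_val t -> g r <= g t) ->
  (forall (u : nat -> time T) t, time_val (u n) @[n --> \oo] --> time_val t ->
     g (u n) @[n --> \oo] --> g t) -> c <= c' ->
  stop_le (hit g c) (hit g c').
Proof.
move=> mg cg cc; case E' : (hit g c') => [r'|]; last by case: (hit g c).
have c'r' : c' <= g r' by apply/(hit_le c' mg cg); exists r'.
have /(hit_le c mg cg)[r -> //] : c <= g r' by exact: le_trans c'r'.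
Qed.

(** * Stopping inside path integrals, and the compensated product *)

Section stopped_integrals.
Context (R : realType) (T : {posnum R}) d (W : measurableType d) (Q : probability W R).
Variable mu : {finite_measure set (borel (time T)) -> \bar R}.
Hypothesis mu0 : forall t : borel (time T), mu [set t] = 0.
Variables (F : time T -> set_system W) (uF : usual Q F).
Implicit Types (M al : time T -> W -> R) (sigma : W -> option (time T)).

Definition horizon (o : option (time T)) : time T := capt o timeT.

Lemma upto_capt o t (q : time T) :
  (time_val q <= time_val (capt o t)) = (time_val q <= time_val t) && (time_val q <= time_val (horizon o)).
Proof.
case: o => [r|] /=; last by rewrite time_leT andbT.
by rewrite !tmin_val !le_min time_leT andbT andbC.
Qed.

(** The indicator of the stochastic interval [[0, o]]: stopping an integral amounts to multiplying
    its density by it. *)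
Definition before (o : option (time T)) (q : time T) : R := (time_val q <= time_val (horizon o))%R%:R.

Lemma pint_capt (f : time T -> R) o t :
  pint mu f (capt o t) = pint mu (fun q => before o q * f q) t.
Proof.
rewrite !pintE; apply: eq_Rintegral => q _; rewrite mulrA; congr (_ * _).
rewrite !indicE /before -natrM mulnb; congr (_ %:R); congr nat_of_bool.
apply/idP/idP.
  by rewrite inE /upto /= upto_capt => /andP[h1 ->]; rewrite andbT mem_set.
by move=> /andP[]; rewrite inE /upto /= => h1 h2; apply/mem_set; rewrite /= upto_capt h1 h2.
Qed.

Lemma before_bound o q : `|before o q| <= 1.
Proof. by rewrite /before; case: (time_val q <= _); rewrite ?normr1 ?normr0. Qed.

Lemma measurable_before o : measurable_fun setT (before o : borel (time T) -> R).
Proof.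
rewrite (_ : before o = \1_(upto (horizon o))); first exact: measurable_upto_indic.
by apply/funext => q; rewrite indicE /before; congr (_ %:R); congr nat_of_bool;
  apply/idP/idP; rewrite inE.
Qed.

Lemma adapted_horizon sigma t : stopping_time F time0 sigma ->
  measurable_wrt (F t) (fun w => time_val (capt (sigma w) t)).
Proof.
(* The capped stopping time is time itself, as a deterministic process, stopped at [sigma]. *)
move=> hs; rewrite (_ : (fun _ => _) = stopped sigma (fun q _ => time_val q) t); last first.
  by apply/funext => w; rewrite stoppedE.
apply: (mwrt_stopped uF) => //.
  by apply: aeW => w u q _ uq; exact: uq.
by move=> q; exact: (mwrt_cst (usual_sigma uF q)).
Qed.

Lemma adapted_before sigma q : stopping_time F time0 sigma ->
  measurable_wrt (F q) (fun w => before (sigma w) q).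
Proof.
move=> hs; have mh := adapted_horizon q hs.
rewrite (_ : (fun _ => _) = \1_[set w | time_val q <= time_val (capt (sigma w) q)]).
  apply: (mwrt_indic (usual_sigma uF q)).
  rewrite (_ : mkset _ = ~` [set w | time_val (capt (sigma w) q) < time_val q]).
    apply: (sigmaC (usual_sigma uF q)); apply: mwrt_lt => //; exact: (usual_sigma uF q).
  by apply/seteqP; split => w /=; rewrite leNgt => /negP.
apply/funext => w; rewrite indicE /before; congr (_ %:R); congr nat_of_bool.
by apply/idP/idP; rewrite inE /= upto_capt lexx.
Qed.

Lemma measurable_horizon sigma : stopping_time F time0 sigma ->
  measurable_fun setT (fun w => horizon (sigma w) : borel (time T)).
Proof.
move=> hs; apply: measurable_time_fun.
exact: mwrt_measurable (usual_meas uF (t := timeT)) (adapted_horizon timeT hs).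
Qed.

Lemma jm_before sigma : stopping_time F time0 sigma -> jm (fun q w => before (sigma w) q).
Proof.
move=> hs; rewrite /jm (_ : (fun _ => _) =
  \1_[set z : borel (time T) * W | time_val z.1 <= time_val (horizon (sigma z.2))]).
  apply: measurable_indic; rewrite -[X in measurable X]setTI.
  have h1 : measurable_fun setT (fun z : borel (time T) * W => time_val z.1) :=
    measurableT_comp measurable_time_val measurable_fst.
  have h2 : measurable_fun setT (fun z : borel (time T) * W => time_val (horizon (sigma z.2))) :=
    measurableT_comp measurable_time_val (measurableT_comp (measurable_horizon hs) measurable_snd).
  exact: (measurable_fun_ler h1 h2 measurableT (Y := [set true])).
by apply/funext => z; rewrite indicE /before; congr (_ %:R); congr nat_of_bool;
  apply/idP/idP; rewrite inE.
Qed.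

Lemma capt_horizon o t : capt o t = tmin t (horizon o).
Proof.
case: o => [r|] /=; last by rewrite tmin_idl// time_leT.
by rewrite /horizon /= tminC [tmin r timeT]tmin_idl// time_leT.
Qed.

Lemma jm_stopped sigma M : stopping_time F time0 sigma -> jm M -> jm (stopped sigma M).
Proof.
move=> hs jM; rewrite /jm (_ : (fun _ => _) =
  (fun z => M z.1 z.2) \o (fun z : borel (time T) * W => (tmin z.1 (horizon (sigma z.2)) : borel (time T), z.2))).
  have h : measurable_fun setT (fun z : borel (time T) * W => horizon (sigma z.2) : borel (time T)) :=
    measurableT_comp (measurable_horizon hs) measurable_snd.
  exact: (measurableT_comp jM (measurable_fun_pair (measurable_tmin measurable_fst h) measurable_snd)).
by apply/funext => z /=; rewrite stoppedE capt_horizon.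
Qed.

Lemma pint_stopped sigma M al w t :
  pint mu (fun q => M q w * al q w) (capt (sigma w) t) =
  pint mu (fun q => stopped sigma M q w * (before (sigma w) q * al q w)) t.
Proof.
rewrite pint_capt; apply: eq_Rintegral => q _.
rewrite stoppedE capt_horizon /before; case: leP => h; last by rewrite !mul0r mulr0.
by rewrite tmin_idl// !mul1r.
Qed.

(** The bound on [X] holds almost surely only; truncation at [c] changes [X] on a null set and makes
    the bound hold everywhere. *)
Lemma intg_mulb_ae (X Y : W -> R) (c : R) : 0 <= c -> measurable_fun setT X ->
  {ae Q, forall w, `|X w| <= c} -> intg Q Y -> intg Q (fun w => X w * Y w).
Proof.
move=> c0 mX Xc iY; have mY := intg_measurable iY.
apply: (intg_ae (Y := fun w => trunc c (X w) * Y w)).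
- exact: measurable_funM.
- apply: filterS Xc => w; rewrite ler_norml => /andP[h1 h2].
  by rewrite /trunc min_r// max_r.
- apply: (@intg_mulb _ _ _ Q (fun w => trunc c (X w)) Y c) => //.
    exact: measurableT_comp (measurable_trunc c) mX.
  by move=> w; exact: trunc_bound.
Qed.

Section ibp.
Variables (M al : time T -> W -> R) (rho : W -> option (time T)) (c : R).
Hypotheses (jM : jm M) (jal : jm al) (adal : forall q, measurable_wrt (F q) (al q))
  (hrho : stopping_time F time0 rho) (c0 : 0 <= c)
  (ial : {ae Q, forall w, pintg mu (al ^~ w)})
  (alc : {ae Q, forall w, pint mu (fun q => `|al q w|) (horizon (rho w)) <= c})
  (hM : martingale Q F time0 (stopped rho M)).

Let M' := stopped rho M.
Let al' q w := before (rho w) q * al q w.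

Let iM' t : intg Q (M' t). Proof. by have [_ h _] := (martP _ uF).1 hM. Qed.
Let jM' : jm M'. Proof. exact: jm_stopped. Qed.
Let jal' : jm al'. Proof. by apply: jmM => //; exact: jm_before. Qed.
Let adal' q : measurable_wrt (F q) (al' q).
Proof. by apply: (mwrtM (usual_sigma uF q)) => //; exact: adapted_before. Qed.

Let ial' : {ae Q, forall w, pintg mu (al' ^~ w)}.
Proof.
apply: filterS ial => w h; apply: pintg_mulb h; first exact: measurable_before.
exact: before_bound.
Qed.

Let alc' : {ae Q, forall w, (\int[mu]_q `|al' q w|%:E <= c%:E)%E}.
Proof.
apply: filterS2 ial' alc => w h1; rewrite /horizon pint_capt pint_timeT => h2.
have -> : (\int[mu]_q `|al' q w|%:E = (\int[mu]_q (before (rho w) q * `|al q w|))%:E)%E.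
  rewrite /Rintegral fineK.
    apply: eq_integral => q _; rewrite /al' normrM; congr (_ * _)%:E.
    by rewrite /before ger0_norm.
  apply: integrable_fin_num => //.
  apply: eq_integrable (pintg_norm h1) => // q _ /=; rewrite /al' normrM; congr (_ * _)%:E.
  by rewrite /before ger0_norm.
by rewrite lee_fin.
Qed.

(** The compensation formula [core_eq] for the stopped process and the density [k * al']. The weight
    1 gives the integrability; the indicator of an event [B] of [F r] times that of []r, t]] gives
    the increments on [B]. *)
Let weighted (k : time T -> W -> R) t : jm k -> (forall q, measurable_wrt (F q) (fun w => k q w * al' q w)) ->
  (forall q w, `|k q w| <= 1) -> (forall q w, time_val t < time_val q -> k q w = 0) ->
  [/\ {ae Q, forall w, pintg mu (fun q => M' q w * (k q w * al' q w))},
    intg Q (fun w => \int[mu]_q (M' q w * (k q w * al' q w))),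
    intg Q (fun w => M' t w * \int[mu]_q (k q w * al' q w)) &
    \int[Q]_w (M' t w * \int[mu]_q (k q w * al' q w)) = \int[Q]_w \int[mu]_q (M' q w * (k q w * al' q w))].
Proof.
move=> jk adk k1 k0.
have jka : jm (fun q w => k q w * al' q w) by exact: jmM.
have ka0 q w : time_val t < time_val q -> k q w * al' q w = 0 by move=> /k0 ->; rewrite mul0r.
have kac : {ae Q, forall w, (\int[mu]_q `|k q w * al' q w|%:E <= c%:E)%E}.
  apply: filterS alc' => w; apply: le_trans; apply: ge0_le_integral => //.
  - by apply/measurable_EFinP; apply: measurableT_comp => //; exact: (jm_w w jka).
  - by apply/measurable_EFinP; apply: measurableT_comp => //; exact: (jm_w w jal').
  - by move=> q _; rewrite lee_fin normrM ler_piMl.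
have [e1 e2] := core_eq uF hM jM' jka adk ka0 c0 kac.
split => //; first exact: (core_ae uF hM jM' jka adk ka0 c0 kac).
exact: (core_intg uF hM jM' jka adk ka0 c0 kac).
Qed.

Lemma ibp_integrable :
  {ae Q, forall w, pintg mu (fun q => stopped rho M q w * (before (rho w) q * al q w))}.
Proof.
have [] := @weighted (fun=> fun=> 1) timeT.
- exact: measurable_cst.
- by move=> q; rewrite (_ : (fun _ => _) = al' q)//; apply/funext => w; rewrite mul1r.
- by move=> q w; rewrite normr1.
- by move=> q w; rewrite ltNge time_leT.
- by move=> h _ _ _; apply: filterS h => w; under eq_fun do rewrite mul1r.
Qed.

Hypotheses (rM : {ae Q, forall w, rc (M ^~ w)})
  (adM : forall t, measurable_wrt (F t) (M t))
  (adA : forall t, measurable_wrt (F t) (fun w => pint mu (al ^~ w) t))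
  (iMal : {ae Q, forall w, pintg mu (fun q => M q w * al q w)})
  (adJ : forall t, measurable_wrt (F t) (fun w => pint mu (fun q => M q w * al q w) t)).

(** The process [M A - \int M dA], where [A] has the density [al]: formally the stochastic integral
    of [A] against [M]. *)
Definition ibp t w := M t w * pint mu (al ^~ w) t - pint mu (fun q => M q w * al q w) t.

Let A' t w := pint mu (al' ^~ w) t.
Let J' t w := pint mu (fun q => M' q w * al' q w) t.

Let ibpE t w : stopped rho ibp t w = M' t w * A' t w - J' t w.
Proof. by rewrite stoppedE /ibp pint_capt pint_stopped -stoppedE. Qed.

Let rcA : {ae Q, forall w, rc (fun t => pint mu (al ^~ w) t)}.
Proof. by apply: filterS ial => w h u t _; exact: pint_cvg. Qed.

Let adA' t : measurable_wrt (F t) (A' t).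
Proof.
rewrite (_ : A' t = stopped rho (fun t w => pint mu (al ^~ w) t) t).
  exact: (mwrt_stopped uF).
by apply/funext => w; rewrite stoppedE pint_capt.
Qed.

Let Ac t : {ae Q, forall w, `|A' t w| <= c}.
Proof.
apply: filterS2 ial' alc' => w h1 h2; apply: le_trans (pint_norm t h1) _.
apply: le_trans (pint_mono (pintg_norm h1) _ (time_leT t)) _ => //.
rewrite pint_timeT -lee_fin; apply: le_trans h2; rewrite /Rintegral fineK//.
by apply: integrable_fin_num => //; exact: pintg_norm.
Qed.

Let mA t : measurable_fun setT (A' t).
Proof. exact: mwrt_measurable (usual_meas uF (t := t)) (adA' t). Qed.

Let iMA s t : intg Q (fun w => A' s w * M' t w).
Proof. exact: intg_mulb_ae c0 (mA s) (Ac s) (iM' t). Qed.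

Let inc_jm (B : set W) r t : measurable B -> jm (fun (q : time T) (w : W) => \1_B w * (\1_(upto t) q - \1_(upto r) q)).
Proof.
move=> mB; apply: jmM; first by apply: (jm2 (h := \1_B)); exact: measurable_indic.
by apply: jmB; apply: jm1; exact: measurable_upto_indic.
Qed.

Let key (B : set W) r t : time_val r <= time_val t -> F r B ->
  [/\ intg Q (fun w => \1_B w * (J' t w - J' r w)) ,
  intg Q (fun w => \1_B w * (M' t w * (A' t w - A' r w))) &
  \int[Q]_w (\1_B w * (M' t w * (A' t w - A' r w))) = \int[Q]_w (\1_B w * (J' t w - J' r w))].
Proof.
move=> rt FB; have mB := usual_meas uF FB.
have uptor (q : time T) : time_val r < time_val q -> (\1_(upto r) q : R) = 0.
  by move=> rq; rewrite indicE memNset//= => /(lt_le_trans rq); rewrite ltxx.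
have k0 (q : time T) (w : W) : time_val t < time_val q -> \1_B w * (\1_(upto t) q - \1_(upto r) q) = 0 :> R.
  move=> tq; rewrite (uptor q); last exact: le_lt_trans tq.
  have -> : \1_(upto t) q = 0 :> R by rewrite indicE memNset//= => /(lt_le_trans tq); rewrite ltxx.
  by rewrite subr0 mulr0.
have k1 (q : time T) (w : W) : `|\1_B w * (\1_(upto t) q - \1_(upto r) q) : R| <= 1.
  rewrite normrM mulr_ile1// ?indicE; first by case: (w \in B); rewrite ?normr1 ?normr0.
  by do 2 case: (q \in _); rewrite ?subrr ?subr0 ?sub0r ?normrN ?normr1 ?normr0.
have ka (q : time T) : measurable_wrt (F q) (fun w : W => \1_B w * (\1_(upto t) q - \1_(upto r) q) * al' q w).
  apply: (mwrtM (usual_sigma uF q)) => //.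
  (* For [q <= r] the weight vanishes, so that the measurability of [B] for [F q] matters for [q]
     after [r] only. *)
  have [qr|rq] := leP (time_val q) (time_val r).
    rewrite (_ : (fun _ => _) = fun=> 0); first exact: (mwrt_cst (usual_sigma uF q)).
    apply/funext => w; rewrite [\1_(upto t) q]indicE [\1_(upto r) q]indicE.
    by rewrite !mem_set ?subrr ?mulr0//; exact: le_trans qr rt.
  apply: (mwrtM (usual_sigma uF q)); last exact: (mwrt_cst (usual_sigma uF q)).
  by apply: (mwrt_indic (usual_sigma uF q)); exact: (usual_mono uF (ltW rq)).
have [i0 i1 i2 e] := weighted (inc_jm r t mB) ka k1 k0.
have E1 : {ae Q, forall w, \int[mu]_q (\1_B w * (\1_(upto t) q - \1_(upto r) q) * al' q w) =
   \1_B w * (A' t w - A' r w)}.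
  by apply: filterS ial' => w h; rewrite (pint_increment _ _ _ h).
have E2 : {ae Q, forall w, \int[mu]_q (M' q w * (\1_B w * (\1_(upto t) q - \1_(upto r) q) * al' q w)) =
   \1_B w * (J' t w - J' r w)}.
  apply: filterS ibp_integrable => w h; rewrite -(pint_increment _ _ _ h).
  by apply: eq_Rintegral => q _; rewrite mulrCA.
have E3 : {ae Q, forall w, \1_B w * (M' t w * (A' t w - A' r w)) =
    M' t w * \int[mu]_q (\1_B w * (\1_(upto t) q - \1_(upto r) q) * al' q w)}.
  by apply: filterS E1 => w ->; rewrite mulrCA.
have mIB : measurable_fun setT (\1_B : W -> R) by exact: measurable_indic.
have mJ q : measurable_fun setT (J' q).
  rewrite (_ : J' q = fun w => \int[mu]_x (\1_(upto q) x * (M' x w * al' x w))); last first.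
    by apply/funext => w; rewrite /J' pintE.
  apply: measurable_Rint; apply: jmM; last exact: jmM.
  by apply: jm1; exact: measurable_upto_indic.
have m1 : measurable_fun setT (fun w => \1_B w * (J' t w - J' r w)).
  by apply: measurable_funM => //; exact: measurable_funB.
have m2 : measurable_fun setT (fun w => \1_B w * (M' t w * (A' t w - A' r w))).
  apply: measurable_funM => //; apply: measurable_funM; first exact: intg_measurable (iM' t).
  exact: measurable_funB.
split.
- by apply: intg_ae i1 => //; apply: filterS E2.
- exact: intg_ae i2.
- rewrite (Rint_ae measurableT m2 (intg_measurable i2) E3) e.
  exact: (Rint_ae measurableT (intg_measurable i1) m1 E2).
Qed.

Let J0 : {ae Q, forall w, J' time0 w = 0}.
Proof. by apply: filterS ibp_integrable => w h; rewrite /J' pint_time0. Qed.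

Let iJ t : intg Q (J' t).
Proof.
have [i _ _] := key (time0_le t) (sigmaT (usual_sigma uF time0)).
apply: (intg_ae _ _ i).
  rewrite (_ : J' t = fun w => \int[mu]_x (\1_(upto t) x * (M' x w * al' x w))); last first.
    by apply/funext => w; rewrite /J' pintE.
  apply: measurable_Rint; apply: jmM; last exact: jmM.
  by apply: jm1; exact: measurable_upto_indic.
by apply: filterS J0 => w ->; rewrite subr0 indicE mem_set ?mul1r.
Qed.

(** The product at [t] is written [M_t (A_t - A_r) + M_t A_r]. By [key] the first term is
    compensated by the increment of [\int M dA]; in the second the factor [1_B A_r] is almost surely
    bounded and measurable for [F r], so that [M_t] may be replaced by [M_r]. *)
Theorem ibp_martingale : martingale Q F time0 (stopped rho ibp).
Proof.
have iY t : intg Q (stopped rho ibp t).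
  rewrite (_ : stopped rho ibp t = fun w => A' t w * M' t w - J' t w); last first.
    by apply/funext => w; rewrite ibpE mulrC.
  by apply: intgB.
apply/(martP _ uF); split; [move=> t|exact: iY|move=> r t rt B FB].
  have adibp q : measurable_wrt (F q) (ibp q).
    by apply: (mwrtB (usual_sigma uF q)) => //; apply: (mwrtM (usual_sigma uF q)).
  apply: (mwrt_stopped uF) => //.
  apply: filterS3 ial rM iMal => w h1 h2 h3 u s su us; apply: cvgB.
    by apply: cvgM; [exact: h2|exact: pint_cvg].
  exact: pint_cvg.
have mB := usual_meas uF FB.
have [k1 k2 ke] := key rt FB.
have iI X : intg Q X -> intg Q (fun w => \1_B w * X w) by move=> ?; exact: intg_indic.
rewrite (Rint_indic _ _ mB) [RHS](Rint_indic _ _ mB).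
have pull : \int[Q]_w ((\1_B w * A' r w) * M' t w) = \int[Q]_w ((\1_B w * A' r w) * M' r w).
  apply: (pullout_eq (usual_meas uF (t := r)) (usual_sigma uF r)) => //.
  - apply: (mwrtM (usual_sigma uF r)) => //; exact: (mwrt_indic (usual_sigma uF r)).
  - by under eq_fun do rewrite -mulrA; exact: iI.
  - by under eq_fun do rewrite -mulrA; exact: iI.
  - by move=> C FC; have [_ _ h] := (martP _ uF).1 hM; apply: h.
have -> : \int[Q]_w (\1_B w * stopped rho ibp t w) =
  \int[Q]_w ((\1_B w * (M' t w * (A' t w - A' r w)) + (\1_B w * A' r w) * M' t w) - \1_B w * J' t w).
  by apply: eq_Rintegral => w _; rewrite ibpE; ring.
have -> : \int[Q]_w (\1_B w * stopped rho ibp r w) =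
  \int[Q]_w ((\1_B w * A' r w) * M' r w - \1_B w * J' r w).
  by apply: eq_Rintegral => w _; rewrite ibpE; ring.
have a1 s : intg Q (fun w => (\1_B w * A' r w) * M' s w).
  by under eq_fun do rewrite -mulrA; exact: iI.
have a2 := iI _ (iJ t); have a3 := iI _ (iJ r).
rewrite (RintegralB measurableT (intgD k2 (a1 t)) a2) (RintegralD measurableT k2 (a1 t)).
rewrite (RintegralB measurableT (a1 r) a3) pull ke.
have -> : \int[Q]_w (\1_B w * (J' t w - J' r w)) = \int[Q]_w (\1_B w * J' t w - \1_B w * J' r w).
  by apply: eq_Rintegral => w _; rewrite mulrBr.
have alg (x y z : R) : x - y + z - x = z - y by ring.
by rewrite (RintegralB measurableT a2 a3); exact: alg.
Qed.

End ibp.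
End stopped_integrals.

(** * Local martingales with absolutely continuous drift *)

(** The integrand of [pint] as a function of the integration time and of the pair formed by the
    upper limit and the outcome, the form that integration with a parameter takes. *)
Lemma measurable_triangle d1 d2 (U : measurableType d1) (W : measurableType d2) (R : realType)
    (v : U -> R) (al : U -> W -> R) :
  measurable_fun setT v -> measurable_fun setT (fun z : U * W => al z.1 z.2) ->
  measurable_fun setT (fun y : U * (U * W) => (v y.1 <= v y.2.1)%R%:R * al y.1 y.2.2).
Proof.
move=> mv ja; apply: measurable_funM; last first.
  have mg : measurable_fun setT (fun y : U * (U * W) => (y.1, y.2.2)).
    by apply: measurable_fun_pair => //; exact: (measurableT_comp measurable_snd measurable_snd).
  exact: (measurableT_comp ja mg).
rewrite (_ : (fun _ => _) = \1_[set y : U * (U * W) | v y.1 <= v y.2.1]).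
  apply: measurable_indic; rewrite -[X in measurable X]setTI.
  apply: measurable_fun_ler => //; apply: (measurableT_comp mv) => //.
  exact: (measurableT_comp measurable_fst measurable_snd).
by apply/funext => y; rewrite indicE; congr (_ %:R); congr nat_of_bool; apply/idP/idP; rewrite inE.
Qed.

Section local_martingales.
Context (R : realType) (T : {posnum R}) d (W : measurableType d) (Q : probability W R).
Variable mu : {finite_measure set (borel (time T)) -> \bar R}.
Hypothesis mu0 : forall t : borel (time T), mu [set t] = 0.
Variables (F : time T -> set_system W) (uF : usual Q F).
Implicit Types (M N al : time T -> W -> R) (sigma : W -> option (time T)).

Lemma mart_lin M N (a b : R) : martingale Q F time0 M -> martingale Q F time0 N ->
  martingale Q F time0 (fun t w => a * M t w + b * N t w).
Proof.
move=> /(martP _ uF)[m1 i1 e1] /(martP _ uF)[m2 i2 e2]; apply/(martP _ uF); split.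
- move=> t; have sg := usual_sigma uF t; apply: mwrtD => //; apply: mwrtM => //; exact: mwrt_cst.
- by move=> t; apply: intgD; exact: intgZ.
- move=> r t rt B FB; have mB := usual_meas uF FB.
  rewrite (RintegralD mB (intgS mB (intgZ a (i1 t))) (intgS mB (intgZ b (i2 t)))).
  rewrite (RintegralD mB (intgS mB (intgZ a (i1 r))) (intgS mB (intgZ b (i2 r)))).
  rewrite (RintegralZl _ mB (intgS mB (i1 t))) (RintegralZl _ mB (intgS mB (i2 t))).
  rewrite (RintegralZl _ mB (intgS mB (i1 r))) (RintegralZl _ mB (intgS mB (i2 r))).
  by rewrite (e1 r t) ?(e2 r t).
Qed.

Lemma mart_ae M N : martingale Q F time0 M ->
  (forall t, {ae Q, forall w, M t w = N t w}) -> martingale Q F time0 N.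
Proof.
move=> /(martP _ uF)[m1 i1 e1] MN.
have m2 t : measurable_wrt (F t) (N t) by exact: (mwrt_ae uF (MN t) (m1 t)).
have mN t : measurable_fun setT (N t) by exact: mwrt_measurable (usual_meas uF (t := t)) (m2 t).
apply/(martP _ uF); split => //.
  move=> t; apply: (intg_ae (mN t) _ (i1 t)).
  by apply: filterS (MN t) => w ->.
move=> r t rt B FB; have mB := usual_meas uF FB.
by rewrite -(Rint_ae mB (intg_measurable (i1 t)) (mN t) (MN t)) (e1 r)//
  (Rint_ae mB (intg_measurable (i1 r)) (mN r) (MN r)).
Qed.

Lemma ae_forall_time (P : time T -> W -> Prop) :
  (forall t, {ae Q, forall w, P t w}) ->
  {ae Q, forall w, forall n k, P (grid n k) w}.
Proof. by move=> h; apply: ae_foralln => n; apply: ae_foralln => k. Qed.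

(** Almost surely the equality holds at all of the countably many grid points, and right-continuity
    extends it to all times. *)
Lemma indistinguishable (X Y : time T -> W -> R) :
  {ae Q, forall w, rc (X ^~ w)} -> {ae Q, forall w, rc (Y ^~ w)} ->
  (forall t, {ae Q, forall w, X t w = Y t w}) -> {ae Q, forall w, forall t, X t w = Y t w}.
Proof.
move=> rX rY /ae_forall_time XY.
apply: filterS3 rX rY XY => w hX hY hXY t.
have ge n : time_val t <= time_val (dsc n t) := dsc_ge n t; have cv := @dsc_cvg _ _ t.
have h1 := hX _ _ ge cv; have h2 := hY _ _ ge cv.
have E : (fun n => X (dsc n t) w) = (fun n => Y (dsc n t) w).
  by apply/funext => n; exact: hXY.
by move: h1; rewrite E => h1; exact: (cvg_unique (@Rhausdorff R) h1 h2).
Qed.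

Lemma adapted_local N (tau : nat -> W -> option (time T)) : localizing Q F time0 tau ->
  (forall n, martingale Q F time0 (stopped (tau n) N)) ->
  forall t, measurable_wrt (F t) (N t).
Proof.
move=> lt mN t; apply: (mwrt_ae_cvg uF (h := fun n => stopped (tau n) N t)).
  by move=> n; have [h _ _] := (martP _ uF).1 (mN n).
apply: filterS (localizing_None lt) => w h; apply: cvg_near_cst.
by apply: filterS h => n; rewrite stoppedE => ->.
Qed.

Lemma jm_pint al : jm al -> jm (fun t w => pint mu (al ^~ w) t).
Proof.
move=> jal; rewrite /jm.
pose f (q : borel (time T)) (z : borel (time T) * W) : R :=
  (time_val q <= time_val z.1)%R%:R * al q z.2.
have mf := measurable_triangle measurable_time_val jal.
have -> : (fun z : borel (time T) * W => pint mu (al ^~ z.2) z.1) = (fun z => \int[mu]_q f q z).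
  apply/funext => z; rewrite pintE; apply: eq_Rintegral => q _; congr (_ * _).
  by rewrite indicE; congr (_ %:R); congr nat_of_bool; apply/idP/idP; rewrite inE.
exact: (@measurable_Rint R T _ (borel (time T) * W)%type mu f mf).
Qed.

(** Densities of continuous adapted processes of finite variation. The last condition makes the
    hitting times of the total variation, [level], stopping times. *)
Definition drift al := [/\ jm al, forall q, measurable_wrt (F q) (al q),
  {ae Q, forall w, pintg mu (al ^~ w)},
  forall t, measurable_wrt (F t) (fun w => pint mu (al ^~ w) t) &
  forall t, measurable_wrt (F t) (fun w => pint mu (fun q => `|al q w|) t)].

Definition level al (n : nat) w : option (time T) :=
  hit (fun t => pint mu (fun q => `|al q w|) t) n.+1%:R.

Section level.
Variable al : time T -> W -> R.
Hypothesis dal : drift al.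

Let good := [set w | pintg mu (al ^~ w)].

Let aegood : {ae Q, forall w, good w}. Proof. by case: dal. Qed.

Let mono w : good w -> forall r t, time_val r <= time_val t ->
  pint mu (fun q => `|al q w|) r <= pint mu (fun q => `|al q w|) t.
Proof. by move=> h r t; apply: pint_mono => //; exact: pintg_norm. Qed.

Let cont w : good w -> forall (u : nat -> time T) t, time_val (u n) @[n --> \oo] --> time_val t ->
  pint mu (fun q => `|al q w|) (u n) @[n --> \oo] --> pint mu (fun q => `|al q w|) t.
Proof. by move=> h u t; apply: pint_cvg => //; exact: pintg_norm. Qed.

Lemma localizing_level : localizing Q F time0 (level al).
Proof.
split.
- move=> n; apply: stopping_timeP => t.
  have [_ _ _ _ adG] := dal.
  (* The description of the hitting event by the value at [t] holds on almost every path. Indicators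
     turn the comparison of two events into one of random variables, to which the completeness of
     [F t] applies. *)
  pose X w := \1_[set w | pint mu (fun q => `|al q w|) t < n.+1%:R] w : R.
  pose Y w := \1_(~` stop_ev (level al n) t) w : R.
  have mX : measurable_wrt (F t) X.
    by apply: (mwrt_indic (usual_sigma uF t)); apply: mwrt_lt => //; exact: usual_sigma uF t.
  have mY : measurable_wrt (F t) Y.
    apply: (mwrt_ae uF _ mX); apply: filterS aegood => w gw.
    rewrite /X /Y !indicE; congr (_ %:R); congr nat_of_bool.
    have h := hit_le n.+1%:R (mono gw) (cont gw) t.
    apply/idP/idP; rewrite !inE /=.
      by move=> lt /h; rewrite leNgt lt.
    by move=> h'; rewrite ltNge; apply/negP => /h.
  have : F t [set w | Y w < 1] by apply: mwrt_lt => //; exact: usual_sigma uF t.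
  rewrite (_ : mkset _ = stop_ev (level al n) t)//.
  apply/seteqP; split => w /=; rewrite /Y indicE.
    by case: (boolP (w \in _)); rewrite ?ltxx// notin_setE /= => /contrapT.
  by move=> h; rewrite memNset//; exact.
- apply: filterS aegood => w gw n.
  by apply: hit_stop_le; [exact: mono|exact: cont|rewrite ler_nat].
- apply: filterS aegood => w gw.
  set x := pint mu (fun q => `|al q w|) timeT; exists `|Num.ceil x|%N.
  rewrite /level /hit -/x (_ : _ < _ = true)//.
  apply: le_lt_trans (ceil_ge _) _; rewrite -[X in _ < X]natr1.
  by rewrite natr_absz ltr_pwDr// ler_int ler_norm.
Qed.

Lemma level_bound n : {ae Q, forall w, pint mu (fun q => `|al q w|) (horizon (level al n w)) <= n.+1%:R}.
Proof.
apply: filterS aegood => w gw; apply: hit_bound; [exact: cont|].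
by rewrite pint_time0//; exact: pintg_norm.
Qed.

End level.

(** The minimum of three sequences reduces [M], caps the variation of [al] at [n + 1], and reduces
    whatever [tau'] reduces. The measurability of [\int M dA] is asked for under integrability only:
    in the applications it is read off an identity that presupposes this integrability. *)
Lemma localization M al (tau tau' : nat -> W -> option (time T)) :
  jm M -> {ae Q, forall w, rc (M ^~ w)} -> localizing Q F time0 tau ->
  (forall n, martingale Q F time0 (stopped (tau n) M)) -> drift al ->
  localizing Q F time0 tau' ->
  ({ae Q, forall w, pintg mu (fun q => M q w * al q w)} ->
   forall t, measurable_wrt (F t) (fun w => pint mu (fun q => M q w * al q w) t)) ->
  exists rho, [/\ localizing Q F time0 rho,
    forall n, martingale Q F time0 (stopped (rho n) M),
    {ae Q, forall w, pintg mu (fun q => M q w * al q w)},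
    forall n, martingale Q F time0 (stopped (rho n) (ibp mu M al)) &
    forall N, {ae Q, forall w, rc (N ^~ w)} ->
      (forall n, martingale Q F time0 (stopped (tau' n) N)) ->
      forall n, martingale Q F time0 (stopped (rho n) N)].
Proof.
move=> jM rM lt mM dal lt' adJ; have [jal adal ial adA adG] := dal.
have ll := localizing_level dal.
pose rho n w := omin (tau' n w) (omin (tau n w) (level al n w)).
have lrho : localizing Q F time0 rho by apply: localizing_omin => //; exact: localizing_omin.
have [srho _ _] := lrho; have [st _ _] := lt; have [st' _ _] := lt'; have [sl _ _] := ll.
have rcst N (sigma : W -> option (time T)) : {ae Q, forall w, rc (N ^~ w)} -> {ae Q, forall w, rc (stopped sigma N ^~ w)}.
  by move=> h; apply: filterS h => w; exact: rc_stopped.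
have mrho n : martingale Q F time0 (stopped (rho n) M).
  rewrite /rho (_ : (fun w => omin _ _) = (fun w => omin (omin (tau n w) (level al n w)) (tau' n w))).
    rewrite stopped_omin; apply: (optional_stopping uF) => //; last exact: rcst.
    by rewrite stopped_omin; apply: (optional_stopping uF) => //; exact: rcst.
  by apply/funext => w; rewrite ominC.
have mN N : {ae Q, forall w, rc (N ^~ w)} ->
      (forall n, martingale Q F time0 (stopped (tau' n) N)) ->
      forall n, martingale Q F time0 (stopped (rho n) N).
  move=> rN mN n; rewrite /rho stopped_omin; apply: (optional_stopping uF) => //; first exact: rcst.
  exact: (stopping_omin uF (st n) (sl n)).
have bnd n : {ae Q, forall w, pint mu (fun q => `|al q w|) (horizon (rho n w)) <= n.+1%:R}.
  apply: filterS2 ial (level_bound dal n) => w gw; apply: le_trans.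
  apply: pint_mono => //; first exact: pintg_norm.
  rewrite /horizon /rho capt_omin capt_omin; apply: le_trans (capt_le _ _) _.
  rewrite -capt_omin ominC capt_omin; apply: capt_mono; exact: capt_le.
have iMal : {ae Q, forall w, pintg mu (fun q => M q w * al q w)}.
  (* Up to each [rho n] the integrability comes from the capped variation; on almost every path some
     [rho n] is infinite, and then the stopped density is the density itself. *)
  have H : {ae Q, forall w, forall n, pintg mu (fun q => stopped (rho n) M q w * (before (rho n w) q * al q w))}.
    apply: ae_foralln => n.
    exact: (ibp_integrable uF jM jal adal (srho n) (ler0n _ _) ial (bnd n) (mrho n)).
  apply: filterS2 (localizing_None lrho) H => w [n _ /(_ n (leqnn n)) rn] /(_ n).
  rewrite rn; apply: eq_integrable => // q _ /=.
  by rewrite stoppedE rn /before time_leT mul1r.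
exists rho; split; [exact: lrho|exact: mrho|exact: iMal|move=> n|exact: mN].
apply: (ibp_martingale mu0 uF jM jal adal (srho n) (ler0n _ _) ial (bnd n) (mrho n)) => //.
- exact: adapted_local lt mM.
- exact: adJ.
Qed.

Lemma drift_rc al : drift al -> {ae Q, forall w, rc (pint mu (al ^~ w))}.
Proof. by move=> [_ _ h _ _]; apply: filterS h => w gw u t _; exact: pint_cvg. Qed.

Lemma mart_mean M t : martingale Q F time0 M ->
  \int[Q]_w M t w = \int[Q]_w M time0 w.
Proof.
move=> /(martP _ uF)[_ _ h]; apply: h; first exact: time0_le.
exact: sigmaT (usual_sigma uF time0).
Qed.

(** [localization] is used with [C] as the martingale and its own density [k] as the drift, for
    which [ibp] is half of [C^2]. A nonnegative variable of mean 0 vanishes almost surely, and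
    continuity passes from fixed times to all times. *)
Theorem drift_martingale_eq0 k (tau : nat -> W -> option (time T)) : drift k ->
  localizing Q F time0 tau ->
  (forall n, martingale Q F time0 (stopped (tau n) (fun t w => pint mu (k ^~ w) t))) ->
  {ae Q, forall w, forall t, pint mu (k ^~ w) t = 0}.
Proof.
move=> dk lt mC; have [jk adk ik adA _] := dk.
pose C t w := pint mu (k ^~ w) t.
have sq : {ae Q, forall w, forall t, pint mu (fun q => C q w * k q w) t = 2^-1 * C t w ^+ 2}.
  apply: filterS ik => w gw t; rewrite (pint_square_upto mu0 t gw) -/(C _ _).
  by rewrite mulrA mulVf ?pnatr_eq0// mul1r.
have adJ : {ae Q, forall w, pintg mu (fun q => C q w * k q w)} ->
   forall t, measurable_wrt (F t) (fun w => pint mu (fun q => C q w * k q w) t).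
  move=> _ t; have sg := usual_sigma uF t.
  apply: (mwrt_ae uF (X := fun w => 2^-1 * C t w ^+ 2)).
    by apply: filterS sq => w ->.
  by apply: mwrtM => //; [exact: mwrt_cst|under eq_fun do rewrite expr2; exact: mwrtM].
have [rho [lrho mrho iCk mibp _]] := localization (jm_pint jk) (drift_rc dk) lt mC dk lt adJ.
have Crho n t : {ae Q, forall w, C (capt (rho n w) t) w = 0}.
  have e : {ae Q, forall w, stopped (rho n) (ibp mu C k) t w = 2^-1 * C (capt (rho n w) t) w ^+ 2}.
    apply: filterS sq => w h; rewrite stoppedE /ibp h /C; set x := pint _ _ _.
    by rewrite -expr2 -{1}(mul1r (x ^+ 2)) -mulrBl; congr (_ * _); lra.
  have e0 : {ae Q, forall w, stopped (rho n) (ibp mu C k) time0 w = 0}.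
    apply: filterS2 sq ik => w h gw; rewrite stoppedE /ibp h /C.
    have -> : capt (rho n w) time0 = time0.
      by apply/time_val_inj/le_anti; rewrite capt_le time0_le.
    by rewrite pint_time0// mulr0 expr0n mulr0 subr0.
  have [ad ii _] := (martP _ uF).1 (mibp n).
  have m0 := mart_mean t (mibp n).
  have := @Rint_ae _ _ _ Q _ (fun=> 0) _ measurableT (intg_measurable (ii time0)) (measurable_cst _) e0.
  rewrite -m0 (Rintegral_cst Q measurableT) mul0r => i0.
  pose Z w := 2^-1 * C (capt (rho n w) t) w ^+ 2.
  have mZ : measurable_fun setT Z.
    apply: mwrt_measurable (usual_meas uF (t := t)) _.
    exact: (mwrt_ae uF e (ad t)).
  have iZ : intg Q Z by apply: (intg_ae mZ _ (ii t)); apply: filterS e => w ->.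
  have Z0 w : 0 <= Z w by apply: mulr_ge0; [rewrite invr_ge0; exact: ler0n|exact: sqr_ge0].
  have : (\int[Q]_w `|(Z w)%:E| = 0)%E.
    have -> : (fun w => `|(Z w)%:E|)%E = EFin \o Z by apply/funext => w; apply: gee0_abs; rewrite lee_fin; exact: Z0.
    rewrite (RintK measurableT iZ) -(Rint_ae measurableT (intg_measurable (ii t)) mZ e).
    by rewrite i0.
  move/(ae_eq_integral_abs Q measurableT ((measurable_EFinP _ _).2 mZ)).1.
  apply: filterS => w /(_ I) [] /eqP; rewrite mulf_eq0 invr_eq0 pnatr_eq0/= expf_eq0/=.
  by move=> /eqP.
have Ct t : {ae Q, forall w, C t w = 0}.
  have := ae_foralln (fun n => Crho n t) => H.
  apply: filterS2 (localizing_None lrho) H => w [n _ /(_ n (leqnn n)) rn] /(_ n).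
  by rewrite rn.
apply: indistinguishable Ct; first exact: drift_rc.
by apply: aeW => w u t _ _; exact: cvg_cst.
Qed.

(** For the martingale problem, [M] and [N] are the processes of [u] and [u^2], [u0] is [u (s, x)],
    and [al], [be], [ga] are the densities given by [a u], [a (u^2)] and [Gamma a u u]. Here
    [M^2 - \int ga] is [N - 2 u0 M - 2 ibp], a combination of local martingales reduced by the same
    [rho]. *)
Theorem bracket_local_martingale M N al be ga (u0 : R) (tau tau' : nat -> W -> option (time T)) :
  jm M -> {ae Q, forall w, rc (M ^~ w)} -> {ae Q, forall w, rc (N ^~ w)} ->
  localizing Q F time0 tau -> (forall n, martingale Q F time0 (stopped (tau n) M)) ->
  localizing Q F time0 tau' -> (forall n, martingale Q F time0 (stopped (tau' n) N)) ->
  drift al -> drift be ->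
  (forall t, measurable_wrt (F t) (fun w => pint mu (ga ^~ w) t)) ->
  (forall q w, ga q w = be q w - 2 * (M q w + u0 + pint mu (al ^~ w) q) * al q w) ->
  {ae Q, forall w, forall t, N t w = (M t w + u0 + pint mu (al ^~ w) t) ^+ 2 - u0 ^+ 2 - pint mu (be ^~ w) t} ->
  {ae Q, forall w, pintg mu (ga ^~ w)} /\
  exists2 rho, localizing Q F time0 rho & forall n,
    martingale Q F time0 (stopped (rho n) M) /\
    martingale Q F time0 (stopped (rho n) (fun t w => M t w ^+ 2 - pint mu (ga ^~ w) t)).
Proof.
move=> jM rM rN lt mM lt' mN dal dbe adga gaE NE.
have [jal _ ial adA _] := dal; have [_ _ ibe adB _] := dbe.
have gaI : {ae Q, forall w, pintg mu (fun q => M q w * al q w)} ->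
  {ae Q, forall w, pintg mu (ga ^~ w) /\ forall t, pint mu (ga ^~ w) t =
    pint mu (be ^~ w) t - 2 * pint mu (fun q => M q w * al q w) t
    - 2 * u0 * pint mu (al ^~ w) t - pint mu (al ^~ w) t ^+ 2}.
  move=> iMal; apply: filterS3 iMal ial ibe => w h1 h2 h3.
  have h4 := pintg_pint mu0 h2.
  have E : ga ^~ w = (fun q => ((be q w - 2 * (M q w * al q w)) - 2 * u0 * al q w) - 2 * (pint mu (al ^~ w) q * al q w)).
    by apply/funext => q; rewrite gaE; ring.
  have i1 : pintg mu (fun q => be q w - 2 * (M q w * al q w)) by apply: pintgB => //; exact: pintgZ.
  have i2 : pintg mu (fun q => (be q w - 2 * (M q w * al q w)) - 2 * u0 * al q w).
    by apply: pintgB => //; exact: pintgZ.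
  split; first by rewrite E; apply: pintgB => //; exact: pintgZ.
  move=> t; rewrite E (pintB t i2 (pintgZ 2 h4)) (pintB t i1 (pintgZ (2 * u0) h2)) (pintB t h3 (pintgZ 2 h1)).
  by rewrite !pintZ// -pint_square_upto.
have adJ : {ae Q, forall w, pintg mu (fun q => M q w * al q w)} ->
   forall t, measurable_wrt (F t) (fun w => pint mu (fun q => M q w * al q w) t).
  move=> /gaI gI t; have sg := usual_sigma uF t.
  (* The identity in [gaI] solved for [\int M al]: all its other terms are adapted. *)
  apply: (mwrt_ae uF (X := fun w => 2^-1 * (pint mu (be ^~ w) t - pint mu (ga ^~ w) t
    - (2 * u0) * pint mu (al ^~ w) t - pint mu (al ^~ w) t * pint mu (al ^~ w) t))).
    by apply: filterS gI => w [_ ->]; rewrite expr2; field.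
  apply: mwrtM => //; first exact: mwrt_cst.
  apply: mwrtB => //; last exact: mwrtM.
  apply: mwrtB => //; first exact: mwrtB.
  by apply: mwrtM => //; exact: mwrt_cst.
have [rho [lrho mrho iMal mibp mrN]] := localization jM rM lt mM dal lt' adJ.
have gI := gaI iMal.
split; first by apply: filterS gI => w [].
exists rho; first exact: lrho.
move=> n; split; first exact: mrho.
have m1 := mart_lin 1 (- 2 * u0) (mrN N rN mN n) (mrho n).
have m2 := mart_lin 1 (- 2) m1 (mibp n).
apply: (mart_ae m2) => t; apply: filterS2 NE gI => w hN [_ hg].
by rewrite !stoppedE /ibp hN hg; ring.
Qed.

End local_martingales.

(** * Square integrability *)

Lemma fine_le_self (R : realType) (x : \bar R) : (0 <= x -> (fine x)%:E <= x)%E.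
Proof. by case: x => [r|_|] //=; rewrite leey. Qed.

Section integrals_over_initial_segments.
Context (R : realType) (T : {posnum R}).
Variable mu : {finite_measure set (borel (time T)) -> \bar R}.

(** The function [time_val] is already measurable for the sigma-algebra generated by the initial
    segments, and the open sets of [time] are its preimages of open sets of reals. The segments are
    stable under intersection, as Dynkin's argument wants. *)
Lemma measurable_time_upto : @measurable _ (borel (time T)) =
  <<s [set upto t | t in [set: time T]] >>.
Proof.
pose G : set_system (time T) := [set upto t | t in [set: time T]].
have mT : measurable_fun setT ((fun t : time T => time_val t) : g_sigma_algebraType G -> R).
  apply: (@measurability _ _ (g_sigma_algebraType G) _ setT
    ((fun t : time T => time_val t) : g_sigma_algebraType G -> R) _ (RGenOInfty.measurableE R)).
  move=> _ [_ [x ->] <-]; rewrite setTI.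
  rewrite (_ : _ @^-1` _ = ~` [set t : g_sigma_algebraType G | time_val t <= x]); last first.
    by apply/seteqP; split => t /=; rewrite in_itv/= andbT ltNge => /negP.
  apply: measurableC; have [x0|x0] := ltP x 0.
    rewrite (_ : mkset _ = set0) //; apply/seteqP; split => t //=.
    by move=> /le_lt_trans /(_ x0); rewrite ltNge time_val_ge0.
  have [xT|Tx] := leP x T%:num; last first.
    rewrite (_ : mkset _ = setT) //; apply/seteqP; split => t //= _.
    by rewrite (le_trans (time_val_leT t))// ltW.
  apply: sub_sigma_algebra; exists (time_of x) => //.
  by apply/seteqP; split => t; rewrite /upto /= time_ofK.
apply/seteqP; split.
  apply: smallest_sub; first exact: smallest_sigma_algebra.
  move=> A [B oB <-].
  have := mT measurableT _ (open_measurable oB); rewrite setTI; exact.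
apply: smallest_sub; first exact: sigma_algebra_measurable.
by move=> _ [t _ <-]; exact: measurable_upto.
Qed.

(** By Dynkin's argument on initial segments the integral of [f] vanishes over every Borel set of
    times. *)
Lemma pint_eq0_ae (f : borel (time T) -> R) : pintg mu f ->
  (forall t, pint mu f t = 0) -> {ae mu, forall q, f q = 0}.
Proof.
move=> h f0.
have iS (S : set (borel (time T))) : measurable S -> mu.-integrable S (EFin \o f).
  by move=> mS; apply: integrableS h.
have key (S : set (borel (time T))) : measurable S -> (\int[mu]_(q in S) (f q)%:E = 0)%E.
  move=> mS; move: (mS); rewrite measurable_time_upto.
  have E : @measurable _ (borel (time T)) = <<s [set upto t | t in [set: time T]] >>.
    exact: measurable_time_upto.
  apply: (dynkin_induction (P := fun S => (\int[mu]_(q in S) (f q)%:E = 0)%E) E).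
  - move=> _ _ [s _ <-] [t _ <-]; exists (tmin s t) => //.
    by apply/seteqP; split => q; rewrite /upto /= tmin_val le_min => /andP.
  - have := f0 timeT; rewrite pint_timeT => {}f0.
    by rewrite -[LHS]fineK ?(integrable_fin_num measurableT h)// -/(Rintegral _ _ _) f0.
  - move=> _ [t _ <-]; rewrite -[LHS]fineK ?(integrable_fin_num _ (iS _ _))//;
      try exact: measurable_upto.
    by have := f0 t; rewrite /pint /Rintegral => ->.
  - move=> A mA A0; have mAC := measurableC mA.
    have := f0 timeT; rewrite pint_timeT /Rintegral => fT.
    have : (\int[mu]_(q in A `|` ~` A) (f q)%:E = 0)%E.
      by rewrite setUCr -[LHS]fineK ?(integrable_fin_num measurableT h)// fT.
    rewrite integral_setU_EFin//; last 2 first.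
      by rewrite setUCr; exact: pintg_measurable h.
      by rewrite disj_set2E setICr.
    by rewrite A0 add0e.
  - move=> A mA tA A0; rewrite integral_bigcup//; last by apply: iS; exact: bigcupT_measurable.
    by apply: eseries0 => i _ _; exact: A0.
have := @integral_ae_eq _ _ _ mu setT measurableT (cst 0) (EFin \o f) h (measurable_cst _).
have H E : E `<=` setT -> measurable E -> (\int[mu]_(x in E) (EFin \o f) x = \int[mu]_(x in E) cst 0%E x)%E.
  by move=> _ mE; rewrite integral0; exact: key.
by move=> /(_ H); apply: filterS => q /(_ I) [].
Qed.

End integrals_over_initial_segments.

Section square_integrability.
Context (R : realType) (T : {posnum R}) d (W : measurableType d) (Q : probability W R).
Variable mu : {finite_measure set (borel (time T)) -> \bar R}.
Variables (F : time T -> set_system W) (uF : usual Q F).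

(* The stopped second moments are bounded by the mean total variation of the bracket. *)
Theorem square_integrable_martingale (M ga : time T -> W -> R) (rho : nat -> W -> option (time T)) :
  localizing Q F time0 rho ->
  (forall n, martingale Q F time0 (stopped (rho n) M) /\
    martingale Q F time0 (stopped (rho n) (fun t w => M t w ^+ 2 - pint mu (ga ^~ w) t))) ->
  {ae Q, forall w, M time0 w = 0} -> {ae Q, forall w, pintg mu (ga ^~ w)} -> jm ga ->
  {ae Q, forall w, pint mu (ga ^~ w) time0 = 0} ->
  (\int[Q]_w \int[mu]_q `|ga q w|%:E < +oo)%E ->
  martingale Q F time0 M /\ forall t, L2 Q (M t).
Proof.
move=> lrho mrho M0 iga jga ga0 gfin.
pose H w := \int[mu]_q `|ga q w|.
have jn : jm (fun q w => `|ga q w|) by exact: measurableT_comp.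
have mH : measurable_fun setT H by exact: measurable_Rint.
have H0 w : 0 <= H w by exact: Rintegral_ge0.
have iH : intg Q H.
  apply/integrableP; split; first exact/measurable_EFinP.
  apply: le_lt_trans gfin; apply: ge0_le_integral => //.
  - by apply: measurableT_comp => //; exact/measurable_EFinP.
  - apply: (measurable_fun_fubini_tonelli_G (m1 := mu)
      (fun z : borel (time T) * W => `|ga z.1 z.2|%:E)) => //.
    exact/measurable_EFinP.
  - move=> w _; rewrite gee0_abs ?lee_fin//=.
    by apply: fine_le_self; exact: integral_ge0.
have [srho _ _] := lrho.
have Mrho t : {ae Q, forall w, \forall n \near \oo, stopped (rho n) M t w = M t w}.
  by apply: filterS (localizing_None lrho) => w; apply: filterS => n e; rewrite stoppedE e.
have cvM t : {ae Q, forall w, stopped (rho n) M t w @[n --> \oo] --> M t w}.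
  by apply: filterS (Mrho t) => w h; apply: cvg_near_cst.
have adM := adapted_local uF lrho (fun n => (mrho n).1).
have mM t : measurable_fun setT (M t) by exact: mwrt_measurable (usual_meas uF (t := t)) (adM t).
have sqb n t : (\int[Q]_w (stopped (rho n) M t w ^+ 2)%:E <= (\int[Q]_w H w)%:E)%E.
  have [m1 m2] := mrho n.
  have [_ i1 _] := (martP _ uF).1 m1; have [_ i2 _] := (martP _ uF).1 m2.
  set Y := stopped _ _ in m2 i2.
  pose S w := stopped (rho n) M t w ^+ 2.
  have mS : measurable_fun setT S by apply: measurable_funX; exact: intg_measurable (i1 t).
  (* The stopped square is the martingale [Y], of mean 0, plus the stopped bracket [G], whose
     absolute value [H] dominates almost surely. *)
  pose G w := S w - Y t w.
  have mG : measurable_fun setT G by apply: measurable_funB => //; exact: intg_measurable (i2 t).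
  have GE w : G w = pint mu (ga ^~ w) (capt (rho n w) t).
    by rewrite /G /S /Y !stoppedE; ring.
  have GH : {ae Q, forall w, `|G w| <= H w}.
    apply: filterS iga => w h; rewrite GE; apply: le_trans (pint_norm _ h) _.
    rewrite /H -pint_timeT; apply: pint_mono => //; [exact: pintg_norm|exact: time_leT].
  have iG : intg Q G.
    apply/integrableP; split; first exact/measurable_EFinP.
    have /integrableP[_] := iH; apply: le_lt_trans.
    apply: ae_ge0_le_integral => //.
    - by apply: measurableT_comp => //; exact/measurable_EFinP.
    - by apply: measurableT_comp => //; exact/measurable_EFinP.
    - by apply: filterS GH => w h _ /=; rewrite lee_fin (ger0_norm (H0 w)).
  have SE : S = fun w => Y t w + G w by apply/funext => w; rewrite /G; ring.
  have iS : intg Q S by rewrite SE; exact: intgD.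
  rewrite (RintK measurableT iS) lee_fin SE (RintegralD measurableT (i2 t) iG).
  have Y0 : {ae Q, forall w, Y time0 w = 0}.
    apply: filterS2 M0 ga0 => w h1 h2; rewrite /Y stoppedE.
    have -> : capt (rho n w) time0 = time0.
      by apply/time_val_inj/le_anti; rewrite capt_le time0_le.
    by rewrite h1 h2 expr0n subr0.
  rewrite (mart_mean uF t m2) (Rint_ae measurableT (intg_measurable (i2 time0)) (measurable_cst (0:R)) Y0).
  rewrite Rintegral_cst// mul0r add0r.
  rewrite -lee_fin -(RintK measurableT iG) -(RintK measurableT iH).
  have /integrableP[mG' _] := iG; have /integrableP[mH' _] := iH.
  apply: (@le_trans _ _ (\int[Q]_w (`|G w|)%:E)%E).
    apply: le_integral => //; first exact: (intg_norm iG).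
    by move=> w _; rewrite lee_fin ler_norm.
  apply: ae_ge0_le_integral => //.
  - by apply/measurable_EFinP; exact: measurableT_comp.
  - by move=> w _; rewrite lee_fin.
  - by apply: filterS GH => w h _; rewrite lee_fin.
have key t : intg Q (M t) /\ (\int[Q]_w (M t w ^+ 2)%:E <= (\int[Q]_w H w)%:E)%E.
  have iX n : intg Q (stopped (rho n) M t) by have [_ i _] := (martP _ uF).1 (mrho n).1.
  have [i _] := L2_bounded_limit iX (mM t) (cvM t) (fun n => sqb n t).
  split => //; apply: (@fatou_le _ _ _ Q (fun n w => stopped (rho n) M t w ^+ 2)) => //.
  - by move=> n; apply: measurable_funX; exact: intg_measurable (iX n).
  - exact: measurable_funX.
  - by move=> n w; exact: sqr_ge0.
  - by move=> w; exact: sqr_ge0.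
  - by apply: filterS (cvM t) => w h; rewrite expr2; under eq_fun do rewrite expr2; exact: cvgM.
split; last by move=> t; have [_ h] := key t; apply: le_lt_trans h _; rewrite ltry.
apply/(martP _ uF); split; [exact: adM|by move=> t; have [] := key t|].
move=> r t rt B FB; have mB := usual_meas uF FB.
have i n q : intg Q (stopped (rho n) M q) by have [_ i _] := (martP _ uF).1 (mrho n).1.
(* [L2_bounded_limit] wants integrals over [B] that do not depend on [n]; those of the increments
   are all 0. *)
pose X n w := stopped (rho n) M t w - stopped (rho n) M r w.
have iX n : intg Q (X n) by exact: intgB.
have cX : {ae Q, forall w, X n w @[n --> \oo] --> M t w - M r w}.
  by apply: filterS2 (cvM t) (cvM r) => w; exact: cvgB.
pose K := 2 * \int[Q]_w H w + 2 * \int[Q]_w H w.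
have XK n : (\int[Q]_w (X n w ^+ 2)%:E <= K%:E)%E.
  have m2 q : measurable_fun setT (fun w => (stopped (rho n) M q w ^+ 2)%:E).
    by apply/measurable_EFinP; apply: measurable_funX; exact: intg_measurable (i n q).
  have p q w : (0 <= (stopped (rho n) M q w ^+ 2)%:E)%E by rewrite lee_fin sqr_ge0.
  apply: (@le_trans _ _ (\int[Q]_w (2%:E * (stopped (rho n) M t w ^+ 2)%:E +
     2%:E * (stopped (rho n) M r w ^+ 2)%:E))%E).
    apply: ge0_le_integral => //.
    - by move=> w _; rewrite lee_fin sqr_ge0.
    - by apply/measurable_EFinP; apply: measurable_funX; exact: intg_measurable (iX n).
    - by apply: emeasurable_funD; exact: measurable_funeM.
    - move=> w _; rewrite -!EFinM -EFinD lee_fin /X.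
      move: (stopped _ _ _ _) (stopped _ _ _ _) => x y.
      by have := sqr_ge0 (x + y); nra.
  rewrite ge0_integralD//; last 4 first.
    by move=> w _; apply: mule_ge0.
    exact: measurable_funeM.
    by move=> w _; apply: mule_ge0.
    exact: measurable_funeM.
  have -> : K%:E = (2%:E * (\int[Q]_w H w)%:E + 2%:E * (\int[Q]_w H w)%:E)%E by [].
  rewrite !ge0_integralZl//.
  by apply: leeD; apply: lee_wpmul2l => //; exact: sqb.
have mX0 : measurable_fun setT (fun w => M t w - M r w) by exact: measurable_funB.
have [_ L] := L2_bounded_limit iX mX0 cX XK.
have := L B 0 mB.
rewrite (RintegralB mB (intgS mB (key t).1) (intgS mB (key r).1)) => /(_ _)/eqP.
rewrite subr_eq0 => h; apply/eqP; apply: h => n.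
rewrite (RintegralB mB (intgS mB (i n t)) (intgS mB (i n r))).
have [_ _ e] := (martP _ uF).1 (mrho n).1.
by rewrite (e r t)// subrr.
Qed.

End square_integrability.

(** * Completion of the probability space *)

Section completion.
Context d (W : measurableType d) (R : realType) (Q : probability W R).

Local Notation Qo := (mu_ext Q).

(** The same points with the Caratheodory-measurable sets of the outer measure of [Q]. Keeping the
    carrier lets one process be read on both probability spaces. *)
Definition completed : Type := caratheodory_type Qo.
HB.instance Definition _ := Measurable.on completed.

Definition completion : set completed -> \bar R := @completed_measure_extension _ W R Q.
HB.instance Definition _ := Measure.on completion.

Lemma completion_measurable (A : set W) : measurable A -> measurable (A : set completed).
Proof. by move=> mA; exact: (@caratheodory_measurable_mu_ext _ R W Q A mA). Qed.

Lemma completionE (A : set W) : measurable A -> completion A = Q A.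
Proof. by move=> mA; exact: measurable_mu_extE. Qed.

Let completion_setT : completion setT = 1%:E.
Proof. by rewrite completionE//; exact: probability_setT. Qed.

HB.instance Definition _ := @Measure_isProbability.Build _ completed R completion completion_setT.

(** A measurable hull: the intersection of covers whose measures exceed the outer measure by at most
    [1/(n+1)]. *)
Lemma outer_cover (A : set W) : exists B : set W, [/\ measurable B, A `<=` B & Q B = Qo A].
Proof.
have fA : Qo A \is a fin_num.
  rewrite ge0_fin_numE; last exact: outer_measure_ge0.
  have : (Qo A <= Qo setT)%E by apply: le_outer_measure.
  have QT : Qo setT = 1%E by rewrite (measurable_mu_extE Q measurableT); exact: probability_setT.
  by move=> /le_lt_trans; apply; rewrite QT ltry.
have H n : exists B : set W, [/\ measurable B, A `<=` B & (Q B <= Qo A + (n.+1%:R^-1)%:E)%E].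
  have e0 : (0 : R) < n.+1%:R^-1 by rewrite invr_gt0.
  have [_ [F [mF AF] <-] h] := lb_ereal_inf_adherent e0 fA.
  exists (\bigcup_k F k); split => //; first exact: bigcupT_measurable.
  apply: le_trans (ltW h).
  by apply: measure_sigma_subadditive => //; exact: bigcupT_measurable.
have [B hB] := choice H.
exists (\bigcap_n B n); split.
- by apply: bigcapT_measurable => n; have [] := hB n.
- by move=> x Ax n _; have [_ h _] := hB n; exact: h.
- have mI : measurable (\bigcap_n B n) by apply: bigcapT_measurable => n; have [] := hB n.
  apply/eqP; rewrite eq_le; apply/andP; split; last first.
    rewrite -(measurable_mu_extE Q mI); apply: le_outer_measure.
    by move=> x Ax n _; have [_ h _] := hB n; exact: h.
  apply/lee_addgt0Pr => e e0.
  have /cvgrPdist_lt /(_ _ e0)[n _ /(_ n (leqnn n))] := @invnS_cvg0 R.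
  rewrite sub0r normrN ger0_norm ?invr_ge0// => ne.
  have [mB _ h] := hB n.
  apply: (@le_trans _ _ (Q (B n))).
    by apply: le_measure; rewrite ?inE// => x; apply.
  by apply: le_trans h _; rewrite leeD2l// lee_fin ltW.
Qed.

Lemma completion_negligible (N : set W) : completion.-negligible N <-> Q.-negligible N.
Proof.
split=> [[A [mA A0 NA]]|[A [mA A0 NA]]]; last first.
  by exists A; split => //; [exact: completion_measurable|rewrite completionE].
have [B [mB AB QB]] := outer_cover A.
by exists B; split; [exact: mB|rewrite QB; exact: A0|exact: subset_trans AB].
Qed.

Lemma completion_ae (P : W -> Prop) : {ae completion, forall w, P w} <-> {ae Q, forall w, P w}.
Proof. exact: completion_negligible. Qed.

(** The hulls [B] of [A] and [C] of its complement cover the space and have total mass 1. Their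
    intersection is therefore null, and it contains the difference between [B] and [A]. *)
Lemma completion_version (A : set W) : measurable (A : set completed) ->
  exists B : set W, measurable B /\ {ae Q, forall w, A w <-> B w}.
Proof.
move=> mA; have [B [mB AB QB]] := outer_cover A.
have [C [mC AC QC]] := outer_cover (~` A).
have mBC : measurable (B `&` C) by exact: measurableI.
exists B; split => //; exists (B `&` C); split => //.
  have cA : completion A = Q B by rewrite QB.
  have cA' : completion (~` A) = Q C by rewrite QC.
  have BCT : B `|` C = setT.
    by apply/seteqP; split => // x _; have [/AB|/AC] := pselect (A x); [left|right].
  have s1 : (completion A + completion (~` A) = 1)%E.
    rewrite -measureU//; first by rewrite setUCr; exact: probability_setT.
      exact: measurableC.
    by rewrite setICr.
  have s2 : (Q (B `|` C) = Q B + Q C - Q (B `&` C))%E.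
    apply: measureUfinr => //; rewrite -ge0_fin_numE//; exact: fin_num_measure.
  move: s2; rewrite BCT probability_setT -cA -cA' s1.
  have := fin_num_measure Q _ mBC; case: (Q (B `&` C)) => [x| |] //= _ [].
  by move=> h; congr EFin; lra.
move=> w /= h; have [Aw|Aw] := pselect (A w).
  by exfalso; apply: h; split => // _; exact: AB.
split; last exact: AC.
by apply: contrapT => Bw; apply: h; split.
Qed.

(** Measurable versions are chosen for the countably many sets [X < q] with [q] rational. Off one
    null set [N] they determine the sets [X < x], and on [N] the new variable is set to 0. *)
Lemma completed_fun_version (X : W -> R) : measurable_fun setT (X : completed -> R) ->
  exists Y : W -> R, measurable_fun setT Y /\ {ae Q, forall w, X w = Y w}.
Proof.
move=> mX.
have mXq (q : R) : measurable ([set w | X w < q] : set completed).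
  rewrite (_ : mkset _ = setT `&` X @^-1` `]-oo, q[).
    by apply: mX => //; exact: measurable_itv.
  by rewrite setTI; apply/seteqP; split => w /=; rewrite in_itv.
have [B hB] := choice (fun q : rat => completion_version (mXq (ratr q))).
have aeB : {ae Q, forall w, forall q : rat, X w < ratr q <-> B q w}.
  have cnt : countable [set: rat] by exact: countableP.
  have H : {ae Q, forall w, forall n, forall q : rat, unpickle n = Some q -> (X w < ratr q <-> B q w)}.
    apply: ae_foralln => n; case E : (unpickle n) => [q|]; last by apply: aeW.
    by apply: filterS (hB q).2 => w hw _ [<-].
  by apply: filterS H => w hw q; apply: (hw (pickle q)); rewrite pickleK.
have [N [mN N0 sN]] := aeB.
have good w : ~ N w -> forall q : rat, X w < ratr q <-> B q w.
  by move=> Nw; apply: contrapT => h; apply: Nw; exact: sN.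
exists (fun w => if w \in N then 0 else X w); split; last first.
  exists N; split => // w /= h; apply: contrapT => Nw; apply: h.
  by rewrite memNset.
apply: (@measurability _ _ _ _ setT _ _ (RGenInftyO.measurableE R)).
move=> _ [_ [x ->] <-]; rewrite setTI.
rewrite (_ : _ @^-1` _ = (N `&` [set w | 0 < x]) `|` (\bigcup_(q : rat) if ratr q <= x then B q `\` N else set0)).
  apply: measurableU.
    by have [x0|x0] := ltP 0 x; [rewrite (_ : mkset _ = setT) ?setIT//|rewrite (_ : mkset _ = set0) ?setI0//];
      apply/seteqP; split => w //=; rewrite ?x0// ltNge x0.
  apply: bigcupT_measurable_rat => q; case: ifP => _ //.
  by apply: measurableD => //; exact: (hB q).1.
apply/seteqP; split => w /=; rewrite in_itv/=.
  case: (boolP (w \in N)) => [|]; first by rewrite inE => Nw x0; left.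
  rewrite notin_setE => Nw Xx; right.
  have [q /andP[Xq qx]] := rat_in_itvoo Xx.
  by exists q => //; rewrite (ltW qx); split => //; apply/(good w Nw).
move=> [[Nw x0]|[q _]]; first by rewrite mem_set.
case: ifP => // qx [Bq Nw]; rewrite memNset//.
by apply: lt_le_trans qx; apply/(good w Nw).
Qed.

End completion.
Arguments completion {d W R} Q A.

(** * Integrals and conditional expectations under the completed measure *)

Section integral_completion.
Context d (W : measurableType d) (R : realType) (Q : probability W R).
Import HBNNSimple.

(* No measurability is assumed: the library integral of a non-measurable function
   is a supremum over the simple functions below it. *)
Lemma integral_ae_eq_any (f g : W -> \bar R) : {ae Q, forall w, f w = g w} ->
  (\int[Q]_w f w = \int[Q]_w g w)%E.
Proof.
move=> [N [mN N0 sN]].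
have fgN w : ~ N w -> f w = g w by move=> Nw; apply: contrapT => h; apply: Nw; exact: sN.
have key (u v : W -> \bar R) : (forall w, ~ N w -> u w = v w) -> (forall w, 0 <= v w)%E ->
  (ereal_sup [set sintegral Q h | h in [set h : {nnsfun W >-> R} | forall x, (h x)%:E <= u x]] <=
   ereal_sup [set sintegral Q h | h in [set h : {nnsfun W >-> R} | forall x, (h x)%:E <= v x]])%E.
  move=> uv v0; apply: ge_ereal_sup => _ [h hu <-].
  have mNC := measurableC mN.
  pose h' : {nnsfun W >-> R} := mul_nnsfun h (indic_nnsfun R mNC).
  have -> : sintegral Q h = sintegral Q h'.
    rewrite -!integralT_nnsfun; apply: ae_eq_integral => //; try exact/measurable_EFinP.
    have : {ae Q, forall w, h w = h' w}.
      exists N; split => // w /= hw; apply: contrapT => Nw; apply: hw.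
      by rewrite /h' /= mindicE mem_set// mulr1.
    by move=> H; apply: filterS H => w hw _; congr EFin; exact: hw.
  apply: ereal_sup_ubound; exists h' => // w /=.
  have [Nw|Nw] := pselect (N w).
    by rewrite mindicE memNset ?mulr0//; apply; exact: Nw.
  by rewrite mindicE mem_set// mulr1 -uv.
rewrite /integral !patch_setT; congr (_ - _)%E; apply/le_anti/andP; split; apply: key => w.
- by move=> Nw; rewrite !funeposE fgN.
- exact: funepos_ge0.
- by move=> Nw; rewrite !funeposE fgN.
- exact: funepos_ge0.
- by move=> Nw; rewrite !funenegE fgN.
- exact: funeneg_ge0.
- by move=> Nw; rewrite !funenegE fgN.
- exact: funeneg_ge0.
Qed.

Lemma ge0_integral_completion (Z : W -> \bar R) : measurable_fun setT Z -> (forall w, 0 <= Z w)%E ->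
  (\int[completion Q]_w Z w = \int[Q]_w Z w)%E.
Proof.
move=> mZ Z0; have mid : measurable_fun setT (fun w : completed Q => (w : W)).
  by move=> _ B mB; rewrite setTI; exact: completion_measurable.
rewrite [RHS](eq_measure_integral (pushforward (completion Q) (fun w : completed Q => (w : W)))); last first.
  by move=> A mA _; rewrite /pushforward; exact/esym/completionE.
by rewrite ge0_integral_pushforward.
Qed.

(** [X] is measurable for the completed sigma-algebra only; both integrals equal those of a
    measurable version, the one on the right by [integral_ae_eq_any]. *)
Lemma integral_completion (X : W -> R) : measurable_fun setT (X : completed Q -> R) ->
  (\int[completion Q]_w (X w)%:E = \int[Q]_w (X w)%:E)%E.
Proof.
move=> mX; have [Y [mY XY]] := completed_fun_version mX.
have mid : measurable_fun setT (fun w : completed Q => (w : W)).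
  by move=> _ B mB; rewrite setTI; exact: completion_measurable.
have mYc : measurable_fun setT (Y : completed Q -> R) by exact: (measurableT_comp mY mid).
rewrite (@integral_ae_eq_any (fun w => (X w)%:E) (fun w => (Y w)%:E)); last by apply: filterS XY => w ->.
transitivity (\int[completion Q]_w (Y w)%:E)%E.
  apply: ae_eq_integral; [exact: measurableT|exact/measurable_EFinP|exact/measurable_EFinP|].
  by apply/completion_ae; apply: filterS XY => w ->.
rewrite integralE [RHS]integralE; congr (_ - _)%E; apply: ge0_integral_completion => //.
- by apply: measurable_funepos; exact/measurable_EFinP.
- by apply: measurable_funeneg; exact/measurable_EFinP.
Qed.

Lemma integral_completion_in (X : W -> R) (B : set W) : measurable_fun setT (X : completed Q -> R) ->
  measurable (B : set (completed Q)) ->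
  (\int[completion Q]_(w in B) (X w)%:E = \int[Q]_(w in B) (X w)%:E)%E.
Proof.
move=> mX mB; rewrite integral_mkcond [RHS]integral_mkcond !restrict_EFin.
apply: integral_completion; apply/(measurable_restrictT _ mB).
exact: measurable_funTS.
Qed.

Lemma is_condexp_completion (G : set_system W) (X Y : W -> R) :
  (forall A, G A -> measurable (A : set (completed Q))) ->
  measurable_fun setT (X : completed Q -> R) -> measurable_fun setT (Y : completed Q -> R) ->
  is_condexp (completion Q) (G : set_system (completed Q)) X Y <-> is_condexp Q G X Y.
Proof.
move=> GG mX mY; rewrite /is_condexp /L1.
have mn (Z : W -> R) : measurable_fun setT (Z : completed Q -> R) -> measurable_fun setT ((fun w => `|Z w|) : completed Q -> R).
  by move=> mZ; exact: measurableT_comp.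
rewrite (integral_completion (mn _ mX)) (integral_completion (mn _ mY)).
have E B : G B -> (\int[completion Q]_(w in B) (X w)%:E = \int[Q]_(w in B) (X w)%:E)%E /\
    (\int[completion Q]_(w in B) (Y w)%:E = \int[Q]_(w in B) (Y w)%:E)%E.
  by move=> /GG mB; split; apply: integral_completion_in.
split=> -[h1 h2 h3 h4]; split; [exact: h1|exact: h2|exact: h3| |exact: h1|exact: h2|exact: h3|].
  by move=> B GB; have [<- <-] := E B GB; exact: h4.
by move=> B GB; have [-> ->] := E B GB; exact: h4.
Qed.

End integral_completion.

(** * The canonical space *)

Lemma measurable_fun_lim_borel d (U : measurableType d) (R : realType) (E : completePseudoMetricType R)
    (f : nat -> U -> borel E) (g : U -> borel E) :
  (forall n, measurable_fun setT (f n)) -> (forall x, f n x @[n --> \oo] --> (g x : E)) ->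
  measurable_fun setT g.
Proof.
move=> mf fg; apply: (@measurability _ _ _ (borel E) setT g open erefl).
move=> _ [B oB <-]; rewrite setTI.
(* The limit is in the open set [B] exactly when, for some [m], the terms are eventually interior to
   the set of points whose ball of radius [1/(m+1)] lies in [B]. *)
pose S m : set E := interior [set x | ball x m.+1%:R^-1 `<=` B].
have -> : g @^-1` B = \bigcup_m \bigcup_N \bigcap_(n in [set n | (N <= n)%N]) (f n @^-1` S m).
  apply/seteqP; split => x /=.
    move=> Bgx; have /nbhs_ballP[e e0 eB] : nbhs (g x : E) B by apply: open_nbhs_nbhs; split.
    have /cvgrPdist_lt /(_ (e / 2))[|m _ /(_ m (leqnn m))] := @invnS_cvg0 R; first by rewrite divr_gt0.
    rewrite sub0r normrN ger0_norm ?invr_ge0// => me.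
    have gS : nbhs (g x : E) (S m).
      apply: nbhs_interior; apply/nbhs_ballP; exists (e / 2); first by rewrite /= divr_gt0.
      move=> y gy z yz; apply: eB.
      by rewrite [e]splitr; apply: ball_triangle gy _; apply: le_ball yz; exact: ltW.
    have [N _ hN] := fg x _ gS.
    by exists m => //; exists N => // n /= /hN.
  move=> [m _ [N _ hN]].
  have /cvg_ballP /(_ m.+1%:R^-1)[|N' _ hN'] := fg x; first by rewrite invr_gt0.
  have /interior_subset /= := hN (maxn N N') (leq_maxl _ _).
  by apply; apply: ball_sym; apply: hN'; rewrite /= leq_maxr.
apply: bigcupT_measurable => m; apply: bigcupT_measurable => N.
apply: bigcap_measurable => [|n _]; first by exists N => /=.
rewrite -[X in measurable X]setTI; apply: mf => //.
by apply: sub_sigma_algebra; exact: open_interior.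
Qed.

Section canonical_space.
Context {R : realType} (T : {posnum R}) (E : completePseudoMetricType R).
Implicit Types (D : set (time T)) (s t q : time T).

Lemma measurable_coordinate D t : D t ->
  measurable_fun setT (fun w : g_sigma_algebraType (@cylinder R T E D) => w t : borel E).
Proof.
move=> Dt _ B mB; rewrite setTI; apply: sub_sigma_algebra.
by exists t => //; exists B.
Qed.

(** Progressive measurability. Rounding the time up and capping it at [t] gives approximations that
    are constant in time on each cell and read coordinates up to [t] only; right-continuity gives
    the limit. *)
Lemma measurable_path_upto t :
  measurable_fun setT (fun z : borel (time T) *
      g_sigma_algebraType (@cylinder R T E [set r | time_val r <= time_val t]) =>
    z.2 (tmin z.1 t) : borel E).
Proof.
apply: (@measurable_fun_lim_borel _ _ _ _
  (fun n (z : borel (time T) * g_sigma_algebraType (@cylinder R T E [set r | time_val r <= time_val t])) =>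
    z.2 (tmin (dsc n z.1) t) : borel E)); last first.
  move=> [q w] /=; apply: (cadlag_rc (@path_cadlag _ _ _ w)).
    move=> n; rewrite !tmin_val; have := dsc_ge n q.
    by rewrite !minEle; do 2 case: ifPn; rewrite -?ltNge => *; lra.
  by apply: tmin_cvg; exact: dsc_cvg.
move=> n _ B mB; rewrite setTI.
pose C k : set (borel (time T)) := [set q | cell n q = k].
have mC k : measurable (C k).
  have mle j : measurable [set q : borel (time T) | (cell n q <= j)%N].
    rewrite (_ : mkset _ = [set q : borel (time T) | time_val q <= time_val (grid n j : time T)]); first exact: measurable_time_le.
    by apply/seteqP; split => q /=; rewrite cell_leE.
  case: k => [|k].
    by rewrite (_ : C 0%N = [set q : borel (time T) | (cell n q <= 0)%N])//; apply/seteqP; split => q /=; rewrite leqn0 => /eqP.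
  rewrite (_ : C k.+1 = [set q : borel (time T) | (cell n q <= k.+1)%N] `\` [set q : borel (time T) | (cell n q <= k)%N]); first exact: measurableD.
  apply/seteqP; split => q; rewrite /C /=; first by move=> ->; split => //; rewrite ltnn.
  by move=> [h1 h2]; apply/eqP; rewrite eqn_leq h1 ltnNge; apply/negP.
rewrite (_ : _ @^-1` B = \bigcup_k (C k `*` [set w : g_sigma_algebraType (@cylinder R T E [set r | time_val r <= time_val t]) | B (w (tmin (grid n k) t))])).
  apply: bigcupT_measurable => k; apply: measurableX => //.
  have := @measurable_coordinate [set r | time_val r <= time_val t] (tmin (grid n k) t).
  by rewrite /= tmin_val ge_min lexx orbT => /(_ isT measurableT B mB); rewrite setTI.
apply/seteqP; split => [[q w]|[q w]] /=; first by move=> h; exists (cell n q).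
by move=> [k _ [/= <-]].
Qed.

Lemma cylinderS D D' : D `<=` D' -> @cylinder R T E D `<=` cylinder D'.
Proof. by move=> DD A [t /DD Dt h]; exists t. Qed.

Lemma canonical_filtration_cylinder t (A : set (Omega T E)) :
  <<s @cylinder R T E [set r | time_val r <= time_val t] >> A -> canonical_filtration t A.
Proof.
move=> hA; rewrite /canonical_filtration /=; case: ifPn => [_ s ts|_].
  by apply: sub_sigma_algebra2 hA; apply: cylinderS => r /= rt; exact: le_trans rt (ltW ts).
by apply: sub_sigma_algebra2 hA; exact: cylinderS.
Qed.

Lemma canonical_filtration_measurable t (A : set (Omega T E)) :
  canonical_filtration t A -> measurable A.
Proof.
rewrite /canonical_filtration /=; case: ifPn => // tT /(_ timeT tT).
by apply: sub_sigma_algebra2; exact: cylinderS.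
Qed.

Lemma canonical_filtration_sigma t : sigma_algebra setT (@canonical_filtration R T E t).
Proof.
have [tT|tT] := boolP (time_val t < T%:num); last first.
  rewrite (_ : canonical_filtration t = measurable :> set_system (Omega T E)).
    exact: (@sigma_algebra_measurable _ (Omega T E)).
  by apply/funext => A; rewrite /canonical_filtration /= (negbTE tT).
rewrite /canonical_filtration tT.
split=> /=.
- by move=> s _; exact: sigma_algebra0.
- by move=> A hA s ts; apply: sigma_algebraCD; exact: hA.
- by move=> A hA s ts; apply: sigma_algebra_bigcup => n; exact: hA.
Qed.

Lemma canonical_filtration_mono s t : time_val s <= time_val t ->
  @canonical_filtration R T E s `<=` canonical_filtration t.
Proof.
move=> st A hA; rewrite /canonical_filtration /=; case: ifPn => tT.
  move: hA; rewrite /canonical_filtration /= (le_lt_trans st tT) => hA r tr.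
  by apply: hA; exact: le_lt_trans st tr.
exact: canonical_filtration_measurable hA.
Qed.

End canonical_space.

(** * The measure of the clock *)

Section clock_measure.
Context {R : realType} {T : {posnum R}} (V : cumulative R R).

Local Notation dV := (lebesgue_stieltjes_measure V).

Lemma lebesgue_stieltjes_itv (x y : R) : x <= y -> dV `]x, y] = (V y - V x)%:E.
Proof.
move=> xy.
rewrite /lebesgue_stieltjes_measure /measure_extension measurable_mu_extE/=; last exact: is_ocitv.
have [->|nxy] := eqVneq x y; first by rewrite set_itvoc0 wlength0 subrr.
by rewrite wlength_itv_bnd// bnd_simp lt_neqAle nxy.
Qed.

Let whole : set R := `]0, T%:num].
Let mwhole : measurable whole. Proof. exact: measurable_itv. Qed.

Let mto : measurable_fun setT (time_of : measurableTypeR R -> borel (time T)).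
Proof. exact: measurable_time_of. Qed.

(** [dV] restricted to []0, T]] and carried to [time]. The restriction makes the measure finite, and
    it prevents the reals outside [[0, T]], which [time_of] sends to [time0], from creating mass
    there. *)
Definition clock_measure : set (borel (time T)) -> \bar R :=
  pushforward (mrestr dV mwhole) (time_of : R -> borel (time T)).

Let base := [the {measure set (borel (time T)) -> \bar R} of
  measure_function_pushforward__canonical__measure_function_Measure (mrestr dV mwhole) mto].

Let clock0 : clock_measure set0 = 0. Proof. exact: (measure0 base). Qed.
Let clock_ge0 A : (0 <= clock_measure A)%E. Proof. exact: (measure_ge0 base). Qed.
Let clock_sigma : semi_sigma_additive clock_measure.
Proof. exact: (@measure_semi_sigma_additive _ _ _ base). Qed.

HB.instance Definition _ := isMeasure.Build _ _ _ clock_measure clock0 clock_ge0 clock_sigma.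

Let clock_fin : fin_num_fun clock_measure.
Proof.
apply: lty_fin_num_fun.
have E : clock_measure setT = dV whole.
  by rewrite /clock_measure /pushforward /mrestr (_ : _ `&` _ = whole)//; apply/seteqP; split => r // [].
change (clock_measure setT < +oo)%E.
by rewrite E /whole lebesgue_stieltjes_itv ?ltry.
Qed.

HB.instance Definition _ := Measure_isFinite.Build _ _ _ clock_measure clock_fin.

Definition during (s t : time T) : set (borel (time T)) := [set q | time_val s < time_val q <= time_val t].

Lemma measurable_during s t : measurable (during s t).
Proof.
rewrite (_ : during s t = upto t `\` upto s); first by apply: measurableD; exact: measurable_upto.
apply/seteqP; split => q; rewrite /during /upto /=.
  by move=> /andP[sq qt]; split => //; apply/negP; rewrite -ltNge.
by move=> [qt /negP]; rewrite -ltNge => ->.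
Qed.

Lemma during_preimage s t : (time_of : R -> borel (time T)) @^-1` during s t = [set` `]time_val s, time_val t]].
Proof.
apply/seteqP; split => r; rewrite /during /= in_itv /=; last first.
  move=> /andP[sr rt]; rewrite time_ofK ?sr//; last exact: le_trans rt (time_val_leT t).
  by rewrite (le_trans (time_val_ge0 s))// ltW.
have [rI|rI] := boolP (r \in `[0, T%:num]%classic).
  by move: (rI); rewrite inE /= in_itv /= => /andP[r0 rT]; rewrite time_ofK.
(* A real outside [[0, T]] is sent to [time0], which is never later than [s]. *)
rewrite /time_of /insubd insubN//= => /andP[st0].
by have := time0_le s; rewrite leNgt => /negP.
Qed.

Lemma eintegral_clock_ge0 (k : borel (time T) -> \bar R) s t : measurable_fun setT k -> (forall q, 0 <= k q)%E ->
  (\int[dV]_(r in `]time_val s, time_val t]) k (time_of r) = \int[clock_measure]_(q in during s t) k q)%E.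
Proof.
move=> mk k0.
rewrite [RHS](ge0_integral_pushforward mto (mrestr dV mwhole)) //=; last 2 first.
  exact: measurable_during.
  exact: measurable_funTS.
rewrite during_preimage; apply: eq_measure_integral => A mA As.
rewrite /= /mrestr setIidl//; apply: subset_trans As _ => r; rewrite /whole /= !in_itv /= => /andP[sr rt].
by rewrite (le_lt_trans (time_val_ge0 s) sr) (le_trans rt (time_val_leT t)).
Qed.

Lemma eintegral_clock (k : borel (time T) -> \bar R) s t : measurable_fun setT k ->
  (\int[dV]_(r in `]time_val s, time_val t]) k (time_of r) = \int[clock_measure]_(q in during s t) k q)%E.
Proof.
move=> mk; rewrite integralE [RHS]integralE.
rewrite (_ : (fun r => k (time_of r))^\+%E = fun r => (k^\+ (time_of r))%E); last by apply/funext => r; rewrite !funeposE.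
rewrite (_ : (fun r => k (time_of r))^\-%E = fun r => (k^\- (time_of r))%E); last by apply/funext => r; rewrite !funenegE.
congr (_ - _)%E; apply: eintegral_clock_ge0.
- exact: measurable_funepos.
- exact: funepos_ge0.
- exact: measurable_funeneg.
- exact: funeneg_ge0.
Qed.

(** The lower limit [s] moves into the density, as the indicator of []s, T]], so that all integrals
    start at time 0. *)
Lemma integral_clock (k : borel (time T) -> R) s t : measurable_fun setT k ->
  \int[dV]_(r in `]time_val s, time_val t]) k (time_of r) =
  pint clock_measure (fun q => \1_(during s timeT) q * k q) t.
Proof.
move=> mk; rewrite /pint /Rintegral; congr fine.
rewrite (@eintegral_clock (fun q => (k q)%:E)); last exact/measurable_EFinP.
have -> : during s t = upto t `&` during s timeT.
  apply/seteqP; split => q; rewrite /during /upto /=.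
    by move=> /andP[-> qt]; rewrite qt (time_leT q).
  by move=> [-> /andP[-> _]].
rewrite integral_mkcondr; apply: eq_integral => q _.
by rewrite patchE indicE; case: (q \in _); rewrite ?mul1r ?mul0r.
Qed.

Lemma clock_measure1 (t : borel (time T)) : {within `[0, T%:num], continuous V} -> clock_measure [set t] = 0.
Proof.
move=> cV; apply/eqP; rewrite eq_le measure_ge0 andbT.
have [t0|t0] := eqVneq (time_val t) 0.
  rewrite /clock_measure /pushforward /mrestr (_ : _ `&` _ = set0) ?measure0//.
  apply/seteqP; split => r //; rewrite /whole /= in_itv /= => -[rt /andP[r0 rT]].
  by have := @time_ofK R T r (ltW r0) rT; rewrite rt t0 => e; move: r0; rewrite -e ltxx.
have {}t0 : 0 < time_val t by rewrite lt_neqAle eq_sym t0 time_val_ge0.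
(* These points approach [t] strictly from below and stay in [[0, T]], where [V] is known to be
   continuous; the point [t] lies in each interval []u n, t]]. The case [t = 0] was settled by the
   restriction to []0, T]]. *)
pose u n : R := time_val t * (1 - n.+1%:R^-1).
have u01 n : 0 <= u n < time_val t.
  rewrite mulr_ge0//=; last 2 first.
    exact: ltW.
    by rewrite subr_ge0 invf_le1// ler1n.
  by rewrite -[ltRHS]mulr1 ltr_pM2l// ltrBlDr ltrDl invr_gt0.
have ut : u n @[n --> \oo] --> time_val t.
  rewrite -[X in _ --> X]mulr1; apply: cvgM; first exact: cvg_cst.
  rewrite -[X in _ --> X]subr0; apply: cvgB; [exact: cvg_cst|exact: invnS_cvg0].
have Vu : V (u n) @[n --> \oo] --> V (time_val t).
  have /subspace_continuousP /(_ (time_val t)) := cV; rewrite /= in_itv /= time_val_ge0 time_val_leT => /(_ isT) h.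
  apply: (@cvg_comp _ _ _ u V) h => A; rewrite /within /= => hA.
  have H1 : \forall n \near \oo, (`[0, T%:num]%classic (u n) -> A (u n)) by exact: ut _ hA.
  change (\forall n \near \oo, A (u n)); apply: filterS H1 => n; apply.
  have /andP[u0 ut'] := u01 n.
  by rewrite /= in_itv /= u0 (le_trans (ltW ut') (time_val_leT t)).
have H : (V (time_val t) - V (u n))%:E @[n --> \oo] --> 0%E.
  apply/fine_cvgP; split; first by apply: nearW.
  rewrite -[X in _ --> X](subrr (V (time_val t))); apply: cvgB => //; exact: cvg_cst.
apply: (cvge_ge _ H); apply: nearW => n; rewrite -lebesgue_stieltjes_itv; last by have /andP[_ /ltW] := u01 n.
apply: le_measure; rewrite ?inE.
- apply: measurableI => //.
  by rewrite -[X in measurable X]setTI; apply: measurable_time_of => //; exact: measurable_time1.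
- exact: measurable_itv.
- move=> r /=; rewrite /whole /= !in_itv /= => -[rt /andP[r0 rT]].
  have -> : r = time_val t by rewrite -rt time_ofK// ltW.
  by have /andP[_ ->] := u01 n; rewrite lexx.
Qed.

End clock_measure.

(** * Augmented filtrations *)

Section augmentation.
Context (R : realType) (T : {posnum R}) d (W : measurableType d) (Q : probability W R).

Definition augmented (G : time T -> set_system W) (t : time T) : set_system (completed Q) :=
  augment Q (G t).

Lemma negligible_augment (G : set_system W) A : Q.-negligible A -> augment Q G A.
Proof. by move=> A0; apply: sub_sigma_algebra; right. Qed.

Lemma sub_augment (G : set_system W) A : G A -> augment Q G A.
Proof. by move=> GA; apply: sub_sigma_algebra; left. Qed.

Lemma negligible_completed A : Q.-negligible A -> measurable (A : set (completed Q)).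
Proof.
move=> /(completion_negligible Q A) nA.
exact: (measure_is_complete_caratheodory (mu := mu_ext Q) nA).
Qed.

Lemma augment_measurable (G : set_system W) (A : set W) : G `<=` measurable ->
  augment Q G A -> measurable (A : set (completed Q)).
Proof.
move=> GG; apply: smallest_sub; first exact: (@sigma_algebra_measurable _ (completed Q)).
move=> B [/GG mB|/negligible_completed//]; exact: completion_measurable.
Qed.

(** The sets that agree with a set of [G] up to a null set form a sigma-algebra containing the
    generators. *)
Lemma augment_version (G : set_system W) (A : set W) : sigma_algebra setT G ->
  augment Q G A -> exists2 B, G B & {ae Q, forall w, A w <-> B w}.
Proof.
move=> sG; pose H : set_system W := [set A | exists2 B, G B & {ae Q, forall w, A w <-> B w}].
apply: (@smallest_sub _ _ _ H).
  split=> /=.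
  - by exists set0; [exact: sigma0 sG|exact: aeW].
  - move=> C [B GB CB]; exists (~` B); first exact: sigmaC sG _ GB.
    by apply: filterS CB => w [h1 h2]; split => [[_ h] /h2|/= h] //; split => // /h1.
  - move=> C hC.
    have hC' n : exists B, G B /\ {ae Q, forall w, C n w <-> B w} by have [B] := hC n; exists B.
    have [B hB] := choice hC'.
    exists (\bigcup_n B n); first by apply: sigma_bigcup sG _ _ => n; have [] := hB n.
    have := ae_foralln (fun n => (hB n).2); apply: filterS => w h.
    by split=> -[n _ /h Hn]; exists n.
move=> B [GB|nB]; first by exists B => //; exact: aeW.
exists set0; first exact: sigma0 sG.
have : {ae Q, forall w, ~ B w}.
  by apply: negligibleS nB => w /= /contrapT.
by apply: filterS => w h; split.
Qed.

Lemma usual_augmented (G : time T -> set_system W) : (forall t, G t `<=` measurable) ->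
  (forall r t, time_val r <= time_val t -> G r `<=` G t) ->
  usual (completion Q) (augmented G).
Proof.
move=> GG Gm; split.
- by move=> t; exact: smallest_sigma_algebra.
- by move=> r t rt; apply: sub_sigma_algebra2 => A [/(Gm _ _ rt)|]; [left|right].
- by move=> t A; exact: augment_measurable.
- by move=> t A /completion_negligible; exact: negligible_augment.
Qed.

Lemma is_condexp_augment (G : set_system W) (X Y : W -> R) : sigma_algebra setT G ->
  is_condexp Q G X Y -> is_condexp Q (augment Q G) X Y.
Proof.
move=> sG [h1 h2 mY h]; split => //; first by move=> B mB; apply: sub_augment; exact: mY.
move=> A /(augment_version sG)[B GB AB].
have E (Z : W -> R) : (\int[Q]_(w in A) (Z w)%:E = \int[Q]_(w in B) (Z w)%:E)%E.
  rewrite integral_mkcond [RHS]integral_mkcond; apply: integral_ae_eq_any.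
  apply: filterS AB => w [h3 h4]; rewrite !patchE.
  have [Aw|Aw] := pselect (A w); first by rewrite !mem_set//; exact: h3.
  by rewrite !memNset// => /h4.
by rewrite !E; exact: h.
Qed.

Lemma martingale_completion (F : time T -> set_system W) M : usual (completion Q) (F : time T -> set_system (completed Q)) ->
  martingale (completion Q) (F : time T -> set_system (completed Q)) time0 M <-> martingale Q F time0 M.
Proof.
move=> uF.
have key t r : measurable_wrt (F t) (M t) -> measurable_wrt (F r) (M r) ->
    is_condexp (completion Q) (F r : set_system (completed Q)) (M t) (M r) <-> is_condexp Q (F r) (M t) (M r).
  move=> mt mr; apply: is_condexp_completion.
  - by move=> A; exact: usual_meas uF _ _.
  - exact: mwrt_measurable (usual_meas uF (t := t)) mt.
  - exact: mwrt_measurable (usual_meas uF (t := r)) mr.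
split=> h r t r0 rt.
  have [_ _ mt _] := h t t (time0_le t) (lexx _).
  by have hr := h r t r0 rt; have [_ _ mr _] := hr; apply/key.
have [_ _ mt _] := h t t (time0_le t) (lexx _).
by have hr := h r t r0 rt; have [_ _ mr _] := hr; apply/key.
Qed.

Section extension.
Variables (G : time T -> set_system W) (GG : forall t, G t `<=` measurable)
  (Gm : forall r t, time_val r <= time_val t -> G r `<=` G t)
  (sG : forall t, sigma_algebra setT (G t)).
Variables (s : time T) (M : time T -> W -> R).

Definition after t w : R := if time_val s <= time_val t then M t w else 0.

Lemma cadlag_after w : cadlag_from s (M ^~ w) -> M s w = 0 -> cadlag_from time0 (after ^~ w).
Proof.
move=> cM M0 t _; rewrite /after; have [st|ts] := leP (time_val s) (time_val t).
  have [h1 [l h2]] := cM t st; split.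
    apply: cvg_trans h1; apply: near_eq_cvg; apply: (@filterE _ (nbhs t)) => r /= tr.
    by rewrite (le_trans st (ltW tr)).
  move: st; rewrite le_eqVlt => /predU1P[st|st].
    exists 0; apply: cvg_near_cst; apply: (@filterE _ (nbhs t)) => r /= /andP[_ rt].
    by rewrite leNgt st rt.
  exists l; move=> A Al.
  have hA : \forall r \near t, time_val s <= time_val r < time_val t -> A (M r w) by exact: h2 _ Al.
  have sr : \forall r \near t, time_val s < time_val r.
    apply/time_nbhsP; exists (time_val t - time_val s); first by rewrite subr_gt0.
    by move=> r; rewrite ltr_norml => /andP[]; lra.
  change (\forall r \near t, time_val (time0 : time T) <= time_val r < time_val t ->
    A (if time_val s <= time_val r then M r w else 0)).
  apply: filterS2 hA sr => r h rs /andP[_ rt]; rewrite (ltW rs); apply: h.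
  by rewrite (ltW rs) rt.
have near_lt : \forall r \near t, time_val r < time_val s.
  apply/time_nbhsP; exists (time_val s - time_val t); first by rewrite subr_gt0.
  by move=> r; rewrite ltr_norml => /andP[]; lra.
split; [|exists 0]; apply: cvg_near_cst; rewrite /within /=;
  by apply: filterS near_lt => r rs _; rewrite leNgt rs.
Qed.

(** The localizing times are at least [s], so that before [s] their events are empty and they are
    stopping times from time 0 on. The almost sure value 0 at [s] gives the martingale property
    across [s]. *)
Theorem local_martingale_after : {ae Q, forall w, M s w = 0} -> cadlag_local_martingale Q G s M ->
  {ae completion Q, forall w, cadlag_from time0 (after ^~ w)} /\
  exists2 tau, localizing (completion Q) (augmented G) time0 tau &
    forall n, martingale (completion Q) (augmented G) time0 (stopped (tau n) after).
Proof.
move=> M0 [cM [tau [st1 st2 st3] mM]]; split.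
  by apply/completion_ae; apply: filterS2 cM M0 => w; exact: cadlag_after.
have uF := usual_augmented GG Gm.
exists tau.
  split.
  - move=> n; have [t1 t2] := st1 n; split; first by move=> w r _; exact: time0_le.
    move=> t _; have [ts|ts] := leP (time_val s) (time_val t); first by apply: sub_augment; exact: t2.
    rewrite (_ : mkset _ = set0); first exact: (sigma0 (usual_sigma uF t)).
    apply/seteqP; split => w //= [r /t1 sr rt].
    by move: ts; rewrite ltNge (le_trans sr rt).
  - exact/completion_ae.
  - exact/completion_ae.
move=> n; have [t1 t2] := st1 n; set Y := stopped (tau n) after.
have YE t w : Y t w = if time_val s <= time_val t then stopped (tau n) M t w else 0.
  rewrite /Y !stoppedE /after; have [ts|ts] := leP (time_val s) (time_val t).
    rewrite (_ : time_val s <= _)//; rewrite /capt; case E : (tau n w) => [r|] //.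
    by rewrite tmin_val le_min ts (t1 _ _ E).
  by rewrite leNgt (le_lt_trans (capt_le _ _) ts).
have cond r t : time_val s <= time_val r -> time_val r <= time_val t ->
    is_condexp (completion Q) (augmented G r) (Y t) (Y r).
  move=> sr rt; have ts := le_trans sr rt.
  have -> : Y t = stopped (tau n) M t by apply/funext => w; rewrite YE ts.
  have -> : Y r = stopped (tau n) M r by apply/funext => w; rewrite YE sr.
  have hr := mM n r t sr rt; have [_ _ mr _] := hr.
  have [_ _ mt _] := mM n t t ts (lexx _).
  have mc q : measurable_wrt (G q) (stopped (tau n) M q) -> measurable_fun setT (stopped (tau n) M q : completed Q -> R).
    move=> h _ B mB; rewrite setTI; apply: completion_measurable; apply: (GG (t := q)); exact: h.
  apply/is_condexp_completion; [by move=> A; exact: augment_measurable (GG (t := r))|exact: mc|exact: mc|].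
  exact: is_condexp_augment.
have adY t : measurable_wrt (augmented G t) (Y t).
  have [ts|ts] := leP (time_val s) (time_val t); first by have [] := cond t t ts (lexx _).
  have -> : Y t = fun=> 0 by apply/funext => w; rewrite YE leNgt ts.
  exact: mwrt_cst (usual_sigma uF t) _.
have mY t : measurable_fun setT (Y t : completed Q -> R) by exact: mwrt_measurable (usual_meas uF (t := t)) (adY t).
have iY t : intg (completion Q) (Y t).
  have [ts|ts] := leP (time_val s) (time_val t).
    by have [_ h _ _] := cond t t ts (lexx _); apply/(L1_intg _ (mY t)).
  have -> : Y t = fun=> 0 by apply/funext => w; rewrite YE leNgt ts.
  exact: intg_cst.
have Ys : {ae completion Q, forall w, Y s w = 0}.
  apply/completion_ae; apply: filterS M0 => w h.
  rewrite YE lexx stoppedE /capt; case E : (tau n w) => [r|] //.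
  by rewrite tminC tmin_idl// (t1 _ _ E).
apply/(martP _ uF); split => //.
have H r t (B : set (completed Q)) : time_val s <= time_val r -> time_val r <= time_val t -> augmented G r B ->
    \int[completion Q]_(w in B) Y t w = \int[completion Q]_(w in B) Y r w.
  by move=> sr rt FB; have [_ _ _ h] := cond r t sr rt; rewrite /Rintegral h.
move=> r t rt B FB; have mB := usual_meas uF FB.
have [sr|rs] := leP (time_val s) (time_val r); first exact: H.
have Yr q : time_val q < time_val s -> \int[completion Q]_(w in B) Y q w = 0.
  move=> qs; have -> : Y q = fun=> 0 by apply/funext => w; rewrite YE leNgt qs.
  by rewrite Rintegral_cst// mul0r.
rewrite (Yr r rs); have [ts|ts] := leP (time_val s) (time_val t); last exact: Yr.
rewrite (H s t)//; last exact: (usual_mono uF (ltW rs)).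
by rewrite (Rint_ae mB (mY s) (measurable_cst (0:R)) Ys) Rintegral_cst// mul0r.
Qed.

End extension.
End augmentation.
Arguments augmented {R T d W} Q G t.

(** * Functionals of the path *)

Section measurable_pairs.
Context d1 d2 d3 d4 (U : measurableType d1) (W : measurableType d2) (X : measurableType d3)
  (Z : measurableType d4).

Lemma measurable_comp_graph (h : U * X -> Z) (p : U * W -> X) : measurable_fun setT h ->
  measurable_fun setT p -> measurable_fun setT (fun z => h (z.1, p z)).
Proof.
by move=> mh mp; apply: (measurableT_comp mh); exact: measurable_fun_pair measurable_fst mp.
Qed.

Lemma measurable_comp_section (h : U * X -> Z) (p : W -> X) (t : U) : measurable_fun setT h ->
  measurable_fun setT p -> measurable_fun setT (fun w => h (t, p w)).
Proof.
by move=> mh mp; apply: (measurableT_comp mh); by apply: measurable_fun_pair.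
Qed.

Lemma measurable_comp_diagonal (h : U * X -> Z) (p : U -> X) : measurable_fun setT h ->
  measurable_fun setT p -> measurable_fun setT (fun q => h (q, p q)).
Proof.
by move=> mh mp; apply: (measurableT_comp mh); by apply: measurable_fun_pair.
Qed.

End measurable_pairs.

Lemma measurable_comp_snd d1 d2 d3 d4 (U : measurableType d1) (W : measurableType d2)
    (W' : measurableType d3) (Z : measurableType d4) (h : U * W' -> Z) (i : W -> W') :
  measurable_fun setT h -> measurable_fun setT i -> measurable_fun setT (fun z : U * W => h (z.1, i z.2)).
Proof. by move=> mh mi; apply: measurable_comp_graph mh _; exact: (measurableT_comp mi measurable_snd). Qed.

Section path_functionals.
Context {R : realType} {T : {posnum R}} {E : completePseudoMetricType R} (V : cumulative R R).

Local Notation mu := (@clock_measure R T V).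
Local Notation spacetime := (borel (time T) * borel E)%type.
Local Notation O := (Omega T E).
Local Notation cf := (@canonical_filtration R T E).
Implicit Types (h : spacetime -> R) (s t q : time T).

(** The density of the integrals started at [s]: [h] read along the path, and 0 up to time [s]. *)
Definition along s h q (w : O) : R := \1_(during s timeT) q * h (q, w q).

Lemma measurable_path : measurable_fun setT (fun z : borel (time T) * O => z.2 z.1 : borel E).
Proof.
pose C := g_sigma_algebraType (@cylinder R T E [set r | time_val r <= time_val (timeT : time T)]).
have mid : measurable_fun setT (fun w : O => w : C).
  by move=> _ B mB; rewrite setTI; apply: sub_sigma_algebra2 mB; exact: cylinderS.
have := measurable_comp_snd (@measurable_path_upto R T E timeT) mid.
by congr measurable_fun; apply/funext => z /=; rewrite tmin_idl//; exact: time_leT.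
Qed.

Lemma along0 s h q w : time_val q <= time_val s -> along s h q w = 0.
Proof.
move=> qs; rewrite /along indicE memNset ?mul0r// /during /= => /andP[sq _].
by move: sq; rewrite ltNge qs.
Qed.

Lemma along1 s h q w : time_val s < time_val q -> along s h q w = h (q, w q).
Proof. by move=> sq; rewrite /along indicE mem_set ?mul1r// /during /= sq time_leT. Qed.

Lemma along_norm s h q w : `|along s h q w| = along s (fun z => `|h z|) q w.
Proof.
by have [qs|sq] := leP (time_val q) (time_val s); [rewrite !along0// normr0|rewrite !along1].
Qed.

Lemma measurable_during_indic s : measurable_fun setT (\1_(during s timeT) : borel (time T) -> R).
Proof. by apply: measurable_indic; exact: measurable_during. Qed.

Lemma jm_along s h : measurable_fun setT h -> jm (along s h).
Proof.
move=> mh; apply: jmM; first by apply: jm1; exact: measurable_during_indic.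
exact: (measurable_comp_graph mh measurable_path).
Qed.

Lemma measurable_wrt_path h t : measurable_fun setT h -> measurable_wrt (cf t) (fun w => h (t, w t)).
Proof.
move=> mh B mB; apply: canonical_filtration_cylinder.
pose C := g_sigma_algebraType (@cylinder R T E [set r | time_val r <= time_val t]).
have : measurable_fun setT (fun w : C => h (t, w t)).
  apply: (@measurable_comp_section _ _ _ _ (borel (time T)) C (borel E) R h (fun w => w t) t mh).
  exact: (@measurable_coordinate R T E [set r | time_val r <= time_val t] t (lexx _)).
by move=> /(_ measurableT B mB); rewrite setTI.
Qed.

Lemma measurable_wrt_along s h q : measurable_fun setT h -> measurable_wrt (cf q) (along s h q).
Proof.
move=> mh; have sg : sigma_algebra setT (cf q : set_system O) by exact: canonical_filtration_sigma.
apply: (@mwrtM _ O R _ sg (fun=> \1_(during s timeT) q)); first exact: (mwrt_cst sg).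
exact: measurable_wrt_path.
Qed.

Lemma measurable_wrt_pint s h t : measurable_fun setT h ->
  measurable_wrt (cf t) (fun w => pint mu (along s h ^~ w) t).
Proof.
move=> mh B mB; apply: canonical_filtration_cylinder.
pose C := g_sigma_algebraType (@cylinder R T E [set r | time_val r <= time_val t]).
(* Reading the path at [tmin q t] changes nothing for [q <= t] and makes the integrand a function of
   the coordinates up to [t]. *)
have : measurable_fun setT (fun w : C => \int[mu]_q (\1_(upto t) q * (\1_(during s timeT) q * h (q, w (tmin q t))))).
  apply: measurable_Rint.
  apply: jmM; first by apply: jm1; exact: measurable_upto_indic.
  apply: jmM; first by apply: jm1; exact: measurable_during_indic.
  exact: (measurable_comp_graph mh (@measurable_path_upto R T E t)).
move=> /(_ measurableT B mB); rewrite setTI.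
congr (<<s _ >> _); apply/funext => w; rewrite /preimage /=; congr (B _).
rewrite pintE; apply: eq_Rintegral => q _; rewrite /along indicE.
have [/set_mem qt|] := boolP (q \in upto t); last by rewrite !mul0r.
by rewrite tmin_idl.
Qed.

Lemma measurable_section h w : measurable_fun setT h ->
  measurable_fun setT (fun q : borel (time T) => h (q, (w : O) q)).
Proof.
move=> mh; apply: (measurable_comp_diagonal mh).
exact: (measurable_fun_pair1 w measurable_path).
Qed.

Lemma integral_alongE s h t w : measurable_fun setT h ->
  integral_along V h s t w = pint mu (along s h ^~ w) t.
Proof.
by move=> mh; rewrite /integral_along (@integral_clock _ _ V (fun q => h (q, w q)))//; exact: measurable_section.
Qed.

Lemma eintegral_alongE s h w : measurable_fun setT h ->
  (eintegral_along V (fun z => (h z)%:E) s timeT w = \int[mu]_q (along s h q w)%:E)%E.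
Proof.
move=> mh; rewrite /eintegral_along (@eintegral_clock _ _ V (fun q => (h (q, w q))%:E)); last first.
  by apply/measurable_EFinP; exact: measurable_section.
rewrite integral_mkcond; apply: eq_integral => q _.
by rewrite patchE /along indicE; case: (q \in _); rewrite ?mul1r ?mul0r.
Qed.

Lemma as_integrable_alongE (Q : probability O R) s h : measurable_fun setT h ->
  as_integrable_along V Q h s <-> {ae Q, forall w, pintg mu (along s h ^~ w)}.
Proof.
move=> mh.
have mn : measurable_fun setT (fun z => `|h z|) by exact: measurableT_comp.
have key w : (eintegral_along V (fun z => `|h z|%:E) s timeT w < +oo)%E <-> pintg mu (along s h ^~ w).
  rewrite (eintegral_alongE _ _ mn); split=> [H|/integrableP[_]].
    apply/integrableP; split.
      by apply/measurable_EFinP; exact: (jm_w _ (jm_along s mh)).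
    by apply: le_lt_trans H; under eq_integral do rewrite /= along_norm.
  by apply: le_lt_trans; under [leRHS]eq_integral do rewrite /= along_norm.
by split; apply: filterS => w /key.
Qed.

Lemma measurable_completed_pair (Q : probability O R) (f : time T -> O -> R) : jm f -> jm (f : time T -> completed Q -> R).
Proof.
move=> jf; have mid : measurable_fun setT (fun w : completed Q => w : O).
  by move=> _ B mB; rewrite setTI; exact: completion_measurable.
exact: (measurable_comp_snd jf mid).
Qed.

Lemma drift_along (Q : probability O R) s h : measurable_fun setT h -> as_integrable_along V Q h s ->
  drift (completion Q) mu (augmented Q cf) (along s h).
Proof.
move=> mh /(as_integrable_alongE Q s mh) ih.
have mn : measurable_fun setT (fun z => `|h z|) by exact: measurableT_comp.
split.
- by apply: measurable_completed_pair; exact: jm_along.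
- by move=> q B mB; apply: sub_augment; exact: measurable_wrt_along.
- exact/completion_ae.
- by move=> t B mB; apply: sub_augment; exact: measurable_wrt_pint.
- move=> t; rewrite (_ : (fun w => _) = fun w => pint mu (along s (fun z => `|h z|) ^~ w) t).
    by move=> B mB; apply: sub_augment; exact: measurable_wrt_pint.
  apply/funext => w; congr (pint _ _ t); apply/funext => q; exact: along_norm.
Qed.

End path_functionals.

(** * Starting a process at a given time *)

Section restart.
Context (R : realType) (T : {posnum R}) d (W : measurableType d) (Q : probability W R).
Variables (F : time T -> set_system W) (uF : usual Q F).

Definition tmax (r t : time T) : time T := if time_val r <= time_val t then t else r.

Lemma tmax_val r t : time_val (tmax r t) = Num.max (time_val r) (time_val t).
Proof. by rewrite /tmax; case: leP. Qed.

Definition delay (s : time T) (o : option (time T)) := if o is Some r then Some (tmax r s) else None.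

(** A time before [s] freezes both increments at 0, and a later one is not changed by [delay]. *)
Lemma delay_restart N s (o : option (time T)) (w : W) t :
  N (tmax (capt (delay s o) t) s) w - N s w =
  N (capt o (tmax t s)) w - N (capt o s) w :> R.
Proof.
case: o => [r|] //=; have [sr|rs] := leP (time_val s) (time_val r).
  have -> : tmax (tmin (tmax r s) t) s = tmin r (tmax t s).
    by apply: time_val_inj; rewrite !(tmax_val, tmin_val) (max_l sr) max_minl (max_l sr).
  by have -> : tmin r s = s by rewrite tminC tmin_idl.
have -> : tmax (tmin (tmax r s) t) s = s.
  apply: time_val_inj; rewrite !(tmax_val, tmin_val) (max_r (ltW rs)) max_minl maxxx min_l//.
  by rewrite le_max lexx orbT.
rewrite (tmin_idl (ltW rs)) tmin_idl ?subrr// tmax_val le_max (ltW rs) orbT //.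
Qed.

(* Nothing is known of [N] before [s], so that it can only be used through its increments from [s] on. *)
Lemma local_martingale_restart N C s (tau : nat -> W -> option (time T)) :
  localizing Q F time0 tau -> (forall n, martingale Q F time0 (stopped (tau n) N)) ->
  {ae Q, forall w, forall t, C t w = N (tmax t s) w - N s w} ->
  exists2 rho, localizing Q F time0 rho & forall n, martingale Q F time0 (stopped (rho n) C).
Proof.
move=> [st1 st2 st3] mN CN; exists (fun n w => delay s (tau n w)).
  split.
  - move=> n; split; first by move=> w r _; exact: time0_le.
    move=> t _; have [ts|ts] := leP (time_val s) (time_val t).
      have [_ /(_ t (time0_le t))] := st1 n; congr (F t _); apply/seteqP; split => w /=.
        move=> [r -> rt]; exists (tmax r s) => //; rewrite tmax_val ge_max rt; exact: ts.
      case E : (tau n w) => [r|] /=; last by case.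
      by move=> [_ [<-]]; rewrite tmax_val ge_max => /andP[rt _]; exists r.
    rewrite (_ : mkset _ = set0); first exact: (sigma0 (usual_sigma uF t)).
    apply/seteqP; split => w //=; case: (tau n w) => [r|] /= [q] // [<-].
    by rewrite tmax_val ge_max => /andP[_]; rewrite leNgt ts.
  - apply: filterS st2 => w h n; have := h n; case: (tau n w) => [r|]; case: (tau n.+1 w) => [r'|] //=.
    by rewrite !tmax_val => rr'; rewrite ge_max !le_max rr' lexx orbT.
  - by apply: filterS st3 => w [n h]; exists n; rewrite h.
move=> n; have [adN iN eN] := (martP _ uF).1 (mN n); set X := stopped (tau n) N in adN iN eN.
pose Y t w := X (tmax t s) w - X s w.
have Fs (t : time T) : time_val s <= time_val t -> F s `<=` F t by move=> st; exact: (usual_mono uF st).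
have mX t : measurable_fun setT (X t) by exact: intg_measurable (iN t).
have tmaxl t : time_val s <= time_val t -> tmax t s = t.
  by move=> st; apply/time_val_inj; rewrite tmax_val; apply/max_idPl.
have tmaxr t : time_val t < time_val s -> tmax t s = s.
  by move=> ts; apply/time_val_inj; rewrite tmax_val; apply/max_idPr/ltW.
have mY : martingale Q F time0 Y.
  apply/(martP _ uF); split.
  - move=> t; have sg := usual_sigma uF t; rewrite /Y; have [st|ts] := leP (time_val s) (time_val t).
      by rewrite tmaxl//; apply: mwrtB => //; exact: mwrtS (Fs _ st) (adN s).
    by rewrite tmaxr//; under eq_fun do rewrite subrr; exact: mwrt_cst.
  - by move=> t; exact: intgB.
  - move=> r t rt B FB; have mB := usual_meas uF FB.
    have i q := intgS mB (iN q).
    have E q : \int[Q]_(w in B) Y q w = \int[Q]_(w in B) X (tmax q s) w - \int[Q]_(w in B) X s w.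
      exact: (RintegralB mB (i _) (i _)).
    rewrite !E; congr (_ - _); have [sr|rs] := leP (time_val s) (time_val r).
      by rewrite !tmaxl ?(le_trans sr rt)//; exact: eN.
    rewrite (tmaxr r)//; apply: eN; first by rewrite tmax_val le_max lexx orbT.
    exact: (usual_mono uF (ltW rs)).
apply: (mart_ae uF mY) => t; apply: filterS CN => w h.
by rewrite /Y /X !stoppedE h delay_restart.
Qed.

End restart.

(** * The initial segment of the canonical path *)

Section starting_point.
Context {R : realType} {T : {posnum R}} {E : completePseudoMetricType R}.
Local Notation O := (Omega T E).

(** Right-continuity reduces the condition at all times up to [s] to countably many grid times
    capped at [s]. As [E] is Hausdorff, singletons are closed and limits unique. *)
Lemma start_measurable (s : time T) (x : E) : hausdorff_space E ->
  measurable [set w : O | forall t, time_val t <= time_val s -> w t = x].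
Proof.
move=> hE.
have mpt t : measurable [set w : O | w t = x].
  apply: sub_sigma_algebra; exists t => //; exists [set x] => //.
  rewrite -[X in measurable X]setCK; apply: measurableC; apply: sub_sigma_algebra.
  by rewrite openC; exact: accessible_closed_set1 (hausdorff_accessible hE) x.
rewrite (_ : mkset _ = \bigcap_n \bigcap_k [set w : O | w (tmin (grid n k) s) = x]).
  by apply: bigcapT_measurable => n; apply: bigcapT_measurable => k; exact: mpt.
apply/seteqP; split => w /=.
  by move=> h n _ k _ /=; apply: h; rewrite tmin_val ge_min lexx orbT.
move=> h t ts.
have H : w (tmin (dsc n t) s) @[n --> \oo] --> w t.
  apply: (cadlag_rc (@path_cadlag _ _ _ w)).
    by move=> n; rewrite tmin_val le_min dsc_ge ts.
  by have := @tmin_cvg R T (fun n => dsc n t) t s (@dsc_cvg _ _ t); rewrite (tmin_idl ts).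
have Hx : (fun n => w (tmin (dsc n t) s)) = fun=> x by apply/funext => n; exact: h.
by apply: (cvg_unique hE H); rewrite Hx; exact: cvg_cst.
Qed.

Lemma start_ae (Q : probability O R) (s : time T) (x : E) : hausdorff_space E ->
  Q [set w | forall t, time_val t <= time_val s -> w t = x] = 1%E ->
  {ae Q, forall w : O, w s = x}.
Proof.
move=> hE Q1; have mS := start_measurable s x hE.
have : {ae Q, forall w : O, forall t, time_val t <= time_val s -> w t = x}.
  exists (~` [set w : O | forall t, time_val t <= time_val s -> w t = x]); split => //; first exact: measurableC.
  by rewrite (probability_setC _ mS) Q1 subee.
by apply: filterS => w; apply.
Qed.

End starting_point.

(** * Predictability of the bracket *)

Section predictable.
Context (R : realType) (T : {posnum R}) d (W : measurableType d).
Implicit Types (A : time T -> W -> R).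

(** The last grid point strictly before [t], or [time0] at [t = 0], where the predecessor of the
    index 0 is again 0. Strictness makes [A (lgrid n t)] a left-continuous step process. *)
Definition lgrid n (t : time T) : time T := grid n (cell n t).-1.

Lemma grid0 n : grid n 0 = time0 :> time T.
Proof. by apply: time_val_inj; rewrite grid_val mul0r min_r//; exact: ltW. Qed.

Lemma cell_eq0 n (t : time T) : cell n t = 0%N -> t = time0.
Proof.
move=> c0; have := cell_leE n t 0; rewrite c0 leqnn grid0 => /esym tt0.
by apply/time_val_inj/le_anti; rewrite tt0 time0_le.
Qed.

Lemma lgrid_le n (t : time T) : time_val (lgrid n t) <= time_val t.
Proof.
rewrite /lgrid; case E : (cell n t) => [|k] /=; first by rewrite grid0; exact: time0_le.
by apply: ltW; rewrite ltNge -cell_leE E ltnn.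
Qed.

Lemma lgrid_ge n (t : time T) : time_val t <= time_val (lgrid n t) + n.+1%:R^-1.
Proof.
apply: le_trans (dsc_ge n t) _; rewrite /lgrid /dsc !grid_val.
case: (cell n t) => [|k] /=; first by rewrite lerDl invr_ge0.
rewrite addr_minl le_min ge_min lerDl invr_ge0 ler0n /=.
by rewrite ge_min -[k.+1%:R]natr1 mulrDl mul1r lexx orbT.
Qed.

Lemma lgrid_cvg (t : time T) : time_val (lgrid n t) @[n --> \oo] --> time_val t.
Proof.
apply: (@squeeze_cvgr _ _ _ _ (fun n => time_val t - n.+1%:R^-1) (fun=> time_val t)).
- by apply: nearW => n; rewrite lgrid_le lerBlDr lgrid_ge.
- rewrite -[X in _ --> X]subr0; apply: cvgB; [exact: cvg_cst|exact: invnS_cvg0].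
- exact: cvg_cst.
Qed.

(** A continuous adapted process is the limit of its values at [lgrid n t], constant in time on each
    []grid n k, grid n k.+1]] and known at [grid n k]: such step processes are predictable. *)
Lemma predictable_continuous (F : time T -> set_system W) A :
  (forall t, measurable_wrt (F t) (A t)) ->
  (forall w (u : nat -> time T) t, time_val (u n) @[n --> \oo] --> time_val t ->
     A (u n) w @[n --> \oo] --> A t w) ->
  measurable_wrt (predictable_sets F) (fun z => A z.1 z.2).
Proof.
move=> mA cA; have sg : sigma_algebra setT (predictable_sets F : set_system (borel (time T) * W)).
  exact: smallest_sigma_algebra.
apply: (@mwrt_cvg _ (borel (time T) * W)%type R _ sg (fun n z => A (lgrid n z.1) z.2)); last first.
  by move=> [t w] /=; apply: cA; exact: lgrid_cvg.
move=> n B mB.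
pose S k : set (borel (time T) * W) :=
  [set u : time T | time_val (grid n k : time T) < time_val u <= time_val (grid n k.+1 : time T)] `*` (A (grid n k) @^-1` B).
rewrite (_ : _ @^-1` B = ([set time0] `*` (A time0 @^-1` B)) `|` \bigcup_k S k).
  apply: (@sigmaU _ (borel (time T) * W)%type _ sg).
    by apply: sub_sigma_algebra; left; exists (A time0 @^-1` B) => //; exact: mA.
  apply: (@sigma_bigcup _ (borel (time T) * W)%type _ sg) => k.
  apply: sub_sigma_algebra; right; exists (grid n k), (grid n k.+1), (A (grid n k) @^-1` B) => //.
  exact: mA.
apply/seteqP; split => -[t w] /=.
  rewrite /lgrid; case Et : (cell n t) => [|k] /= Bw.
    by left; split => /=; [exact: cell_eq0 Et|rewrite -(grid0 n)].
  by right; exists k => //; split => //=; rewrite ltNge -!cell_leE Et ltnn leqnn.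
move=> [[/= -> Bw]|[k _ [/=]]].
  rewrite /lgrid (_ : cell n time0 = 0%N) ?grid0//.
  by apply/eqP; rewrite -leqn0 cell_leE time0_le.
rewrite ltNge -!cell_leE => /andP[k1 k2]; rewrite /lgrid.
by have -> : cell n t = k.+1; first by apply/eqP; rewrite eqn_leq k2 ltnNge.
Qed.

End predictable.

(** * Finite variation of indefinite integrals *)

Section bounded_variation.
Context (R : realType) (T : {posnum R}).
Variable mu : {finite_measure set (borel (time T)) -> \bar R}.

Lemma bounded_variation_pint (f : borel (time T) -> R) : pintg mu f ->
  bounded_variation 0 T%:num (fun r => pint mu f (time_of r)).
Proof.
move=> h.
have mono g : pintg mu g -> (forall q, 0 <= g q) -> bounded_variation 0 T%:num (fun r => pint mu g (time_of r)).
  move=> ig g0; apply: nondecreasing_bounded_variation => x y.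
  rewrite !in_itv /= => /andP[x0 xT] /andP[y0 yT] xy.
  by apply: pint_mono => //; rewrite !time_ofK.
have part (c : R) : `|c| = 1 -> pintg mu (fun q => Num.max (c * f q) 0).
  move=> c1; apply: (@pintg_le _ _ _ _ f) => //.
    apply: measurable_maxr; last exact: measurable_cst.
    by apply: measurable_funM; [exact: measurable_cst|exact: pintg_measurable h].
  move=> q; rewrite ger0_norm ?le_max ?lexx ?orbT// ge_max normr_ge0 andbT.
  by apply: le_trans (ler_norm _) _; rewrite normrM c1 mul1r.
have ip := part 1 (normr1 _); have im := part (-1) (normrN1 _).
have -> : (fun r => pint mu f (time_of r)) =
   (fun r => pint mu (fun q => Num.max (1 * f q) 0) (time_of r)) \+
   (\- (fun r => pint mu (fun q => Num.max (-1 * f q) 0) (time_of r))).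
  apply/funext => r /=; rewrite -(pintB _ ip im); congr (pint mu _ _); apply/funext => q.
  by rewrite mul1r mulN1r; case: (leP (f q) 0); case: (leP (- f q) 0); lra.
apply: bounded_variationD => //.
  by apply: mono ip _ => q; rewrite le_max lexx orbT.
by apply: bounded_variationN; apply: mono im _ => q; rewrite le_max lexx orbT.
Qed.

End bounded_variation.

(** * The bracket as an indefinite integral *)

Section bracket_process.
Context (R : realType) (T : {posnum R}) d (W : measurableType d) (Q : probability W R).
Variable mu : {finite_measure set (borel (time T)) -> \bar R}.
Hypothesis mu0 : forall t : borel (time T), mu [set t] = 0.
Variables (F : time T -> set_system W) (uF : usual Q F).

(* The paths with a non-integrable density are removed, for the bracket must be predictable
   and not only equal to a predictable process almost surely. *)
Definition bracket_process (ga : time T -> W -> R) t w : R :=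
  \1_[set w | pintg mu (ga ^~ w)] w * pint mu (ga ^~ w) t.

Lemma bracket_processE ga : {ae Q, forall w, pintg mu (ga ^~ w)} ->
  {ae Q, forall w, forall t, bracket_process ga t w = pint mu (ga ^~ w) t}.
Proof. by apply: filterS => w h t; rewrite /bracket_process indicE mem_set// mul1r. Qed.

Lemma angle_bracket_process M1 M2 (M ga : time T -> W -> R) (rho : nat -> W -> option (time T)) :
  {ae Q, forall w, pintg mu (ga ^~ w)} ->
  (forall t, measurable_wrt (F t) (fun w => pint mu (ga ^~ w) t)) ->
  localizing Q F time0 rho ->
  (forall n, martingale Q F time0 (stopped (rho n) (fun t w => M t w ^+ 2 - pint mu (ga ^~ w) t))) ->
  {ae Q, forall w, cadlag_from time0 (M ^~ w)} ->
  {ae Q, forall w, forall t, M1 t w = M t w} -> {ae Q, forall w, forall t, M2 t w = M t w} ->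
  angle_bracket Q F M1 M2 (bracket_process ga).
Proof.
move=> iga adga lrho mrho cM e1 e2.
have AE := bracket_processE iga.
have E : {ae Q, forall w, (fun t => M1 t w * M2 t w - bracket_process ga t w) =
    (fun t => M t w ^+ 2 - pint mu (ga ^~ w) t)}.
  by apply: filterS3 AE e1 e2 => w h h1 h2; apply/funext => t; rewrite h h1 h2 expr2.
split.
- apply: predictable_continuous.
    move=> t; apply: (mwrt_ae uF _ (adga t)).
    by apply: filterS AE => w ->.
  move=> w u t ut; rewrite /bracket_process indicE.
  have [h|h] := pselect (pintg mu (ga ^~ w)).
    by rewrite mem_set//; under eq_fun do rewrite mul1r; rewrite mul1r; exact: pint_cvg.
  by rewrite memNset//; under eq_fun do rewrite mul0r; rewrite mul0r; exact: cvg_cst.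
- by apply: filterS2 AE iga => w -> h; exact: pint_time0.
- apply: filterS2 AE iga => w e h.
  have -> : bracket_process ga ^~ w = pint mu (ga ^~ w) by apply/funext => t; exact: e.
  exact: pint_cadlag.
- apply: filterS2 AE iga => w e h.
  have -> : (fun r => bracket_process ga (time_of r) w) = fun r => pint mu (ga ^~ w) (time_of r).
    by apply/funext => t; exact: e.
  exact: bounded_variation_pint.
- split.
    apply: filterS3 E cM iga => w -> c h t t0.
    have [h1 [l h2]] := c t t0; have [g1 [m g2]] := pint_cadlag mu0 h t0.
    split; last exists (l * l - m).
      by apply: cvgB g1; rewrite expr2; exact: cvgM.
    by apply: cvgB g2; exact: cvgM.
  exists rho; first exact: lrho.
  move=> n; apply: (mart_ae uF (mrho n)) => t.
  by apply: filterS E => w h; rewrite !stoppedE; exact/esym/(congr1 (fun f => f _) h).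
Qed.

End bracket_process.

(** * Martingales of the martingale problem *)

(* Class inference does not find the filter of a concrete measure such as [completion Q], so the
   measure has to be a variable here. *)
Section almost_everywhere.
Context d (W : measurableType d) (R : realType) (m : {measure set W -> \bar R}).
Implicit Types (P : W -> Prop).

Lemma ae_mono P P' : (forall w, P w -> P' w) ->
  {ae m, forall w, P w} -> {ae m, forall w, P' w}.
Proof. by move=> PP'; exact: filterS. Qed.

Lemma ae_mono2 P1 P2 P' : (forall w, P1 w -> P2 w -> P' w) ->
  {ae m, forall w, P1 w} -> {ae m, forall w, P2 w} -> {ae m, forall w, P' w}.
Proof. by move=> PP'; exact: filterS2. Qed.

Lemma ae_and P1 P2 :
  {ae m, forall w, P1 w} -> {ae m, forall w, P2 w} -> {ae m, forall w, P1 w /\ P2 w}.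
Proof. exact: ae_mono2. Qed.

End almost_everywhere.

(** * Passage between a probability measure and its completion *)

Section transfer.
Context (R : realType) (T : {posnum R}) d (W : measurableType d) (Q : probability W R).
Variable F : time T -> set_system W.
Let Fc : time T -> set_system (completed Q) := F.
Hypothesis uF : usual (completion Q) Fc.

Lemma localizing_completion (tau : nat -> W -> option (time T)) :
  localizing (completion Q) Fc time0 tau <-> localizing Q F time0 tau.
Proof. by split=> -[h1 h2 h3]; split => //; exact/completion_ae. Qed.

Lemma cadlag_local_martingale_completion M :
  cadlag_local_martingale (completion Q) Fc time0 M <-> cadlag_local_martingale Q F time0 M.
Proof.
split=> -[h1 [tau lt mt]]; split; try exact/completion_ae.
  by exists tau; [exact/localizing_completion|move=> n; apply/(martingale_completion _ uF); exact: mt].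
by exists tau; [exact/localizing_completion|move=> n; apply/(martingale_completion _ uF); exact: mt].
Qed.

Lemma angle_bracket_completion M N A :
  angle_bracket (completion Q) Fc M N A <-> angle_bracket Q F M N A.
Proof.
split=> -[h1 h2 h3 h4 h5]; split; [exact: h1|exact/completion_ae|exact/completion_ae|exact/completion_ae| | | | | |].
- exact/cadlag_local_martingale_completion.
- exact: h1.
- exact/completion_ae.
- exact/completion_ae.
- exact/completion_ae.
- exact/cadlag_local_martingale_completion.
Qed.

Lemma H20_completion M : H20 (completion Q) Fc M <-> H20 Q F M.
Proof.
have key : martingale (completion Q) Fc time0 M -> forall t, L2 (completion Q) (M t) <-> L2 Q (M t).
  move=> mM t; have mMt : measurable_wrt (F t) (M t) by have [] := mM t t (time0_le t) (lexx _).
  rewrite /L2 (@integral_completion _ W R Q (fun w => M t w ^+ 2)); first by [].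
  by apply: measurable_funX; exact: mwrt_measurable (usual_meas uF (t := t)) mMt.
split=> -[h1 h2 h3 h4].
  by split; [exact/(martingale_completion _ uF)|exact/completion_ae|exact/completion_ae|move=> t; apply/key].
have h1' : martingale (completion Q) Fc time0 M by exact/(martingale_completion _ uF).
by split; [exact: h1'|exact/completion_ae|exact/completion_ae|move=> t; apply/key].
Qed.

End transfer.

(** * The martingale problem from a fixed starting point *)

Section solution.
Context {R : realType} {T : {posnum R}} {E : completePseudoMetricType R} (hE : hausdorff_space E).
Variables (V : cumulative R R) (cV : clock (T := T) V).
Local Notation spacetime := (borel (time T) * borel E)%type.
Variables (D : set (spacetime -> R)) (a : (spacetime -> R) -> spacetime -> R).
Hypotheses (DA : function_algebra D) (La : linear_operator D a).
Local Notation O := (Omega T E).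
Local Notation cf := (@canonical_filtration R T E).
Local Notation mu := (@clock_measure R T V).
Variables (s : time T) (x : E) (Q : probability O R).
Hypothesis sol : solves_from V D a s x Q.

Local Notation Qc := (completion Q).
Local Notation F := (augmented Q cf).
Implicit Types (phi psi h u : spacetime -> R).

Lemma clock_atomless (t : borel (time T)) : mu [set t] = 0.
Proof. by apply: clock_measure1; case: cV. Qed.

Lemma usual_completed : usual Qc F.
Proof.
apply: usual_augmented; first by move=> t A; exact: canonical_filtration_measurable.
by move=> r t; exact: canonical_filtration_mono.
Qed.

(** The process of Dynkin's formula, extended by 0 before [s] as in the definition of the extended
    generator. *)
Definition dynkin phi psi (t : time T) (w : O) : R :=
  if time_val s <= time_val t then phi (t, w t) - phi (s, x) - integral_along V psi s t w else 0.

Lemma pint_along0 h t (w : O) : time_val t <= time_val s -> pint mu (along s h ^~ w) t = 0.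
Proof.
move=> ts; rewrite /pint (@eq_Rintegral _ _ _ _ _ (fun=> 0)) ?Rintegral_cst ?mul0r//; first exact: measurable_upto.
by move=> q /set_mem qt; rewrite along0//; exact: le_trans qt ts.
Qed.

Lemma dynkinE phi psi t (w : O) : measurable_fun setT psi -> dynkin phi psi t w =
  if time_val s <= time_val t then phi (t, w t) - phi (s, x) - pint mu (along s psi ^~ w) t else 0.
Proof. by move=> mpsi; rewrite /dynkin integral_alongE. Qed.

Lemma dynkin_start phi psi : measurable_fun setT psi -> {ae Q, forall w, dynkin phi psi s w = 0}.
Proof.
move=> mpsi; case: sol => /(start_ae hE) H _; apply: filterS H => w ws.
by rewrite dynkinE// lexx ws pint_along0// subrr subr0.
Qed.

Lemma dynkin_local phi : D phi -> {ae Qc, forall w, cadlag_from time0 (dynkin phi (a phi) ^~ w)} /\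
  exists2 tau, localizing Qc F time0 tau &
    forall n, martingale Qc F time0 (stopped (tau n) (dynkin phi (a phi))).
Proof.
move=> Dphi; have [ma _ _] := La; have [_ /(_ _ Dphi)[_ lm]] := sol.
apply: (local_martingale_after _ _ _ _ lm).
- by move=> t A; exact: canonical_filtration_measurable.
- by move=> r t; exact: canonical_filtration_mono.
- by move=> t; exact: canonical_filtration_sigma.
- by apply: filterS (dynkin_start phi (ma _ Dphi)) => w; rewrite /dynkin lexx.
Qed.

Lemma jm_dynkin phi psi : measurable_fun setT phi -> measurable_fun setT psi ->
  jm (dynkin phi psi : time T -> completed Q -> R).
Proof.
move=> mphi mpsi; apply: measurable_completed_pair.
pose g (t : borel (time T)) : R := \1_[set t : borel (time T) | time_val s <= time_val t] t.
have -> : dynkin phi psi = fun t w => g t * (phi (t, w t) - phi (s, x) - pint mu (along s psi ^~ w) t).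
  apply/funext => t; apply/funext => w; rewrite dynkinE// /g indicE; case: ifPn => st.
    by rewrite mem_set ?mul1r.
  by rewrite memNset ?mul0r//; exact/negP.
apply: jmM; first by apply: jm1; apply: measurable_indic; exact: measurable_time_ge.
apply: jmB; last by apply: jm_pint; exact: jm_along.
apply: jmB; last exact: measurable_cst.
exact: (measurable_comp_graph mphi (@measurable_path R T E)).
Qed.

Lemma adapted_along h t : measurable_fun setT h -> measurable_wrt (F t) (fun w => pint mu (along s h ^~ w) t).
Proof. by move=> mh B mB; apply: sub_augment; exact: measurable_wrt_pint. Qed.

(** From [s] on, the path satisfies [u = dynkin u (a u) + u (s, x) + \int a u], so that
    [Gamma a u u], the density [a (u^2) - 2 u a u], has the form of [ga] in
    [bracket_local_martingale]. The almost sure integrability of [Gamma a u u] along the path comes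
    out as well. *)
Theorem dynkin_bracket u : D u ->
  measurable_fun setT (Gamma a u u) /\ as_integrable_along V Q (Gamma a u u) s /\
  exists2 rho, localizing Qc F time0 rho & forall n,
    martingale Qc F time0 (stopped (rho n) (dynkin u (a u))) /\
    martingale Qc F time0 (stopped (rho n)
      (fun t w => dynkin u (a u) t w ^+ 2 - pint mu (along s (Gamma a u u) ^~ w) t)).
Proof.
move=> Du; have [mD _ _ _ DM] := DA; have [ma _ _] := La; have [_ sol'] := sol.
have Duu := DM _ _ Du Du; have [i1 _] := sol' _ Du; have [i2 _] := sol' _ Duu.
have mu1 := ma _ Du; have mu2 := ma _ Duu; have mu0 := mD _ Du.
have mG : measurable_fun setT (Gamma a u u).
  by apply: measurable_funB; [apply: measurable_funB => //|]; exact: measurable_funM.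
split => //.
have [c1 [tau lt mt]] := dynkin_local Du.
have [c2 [tau' lt' mt']] := dynkin_local Duu.
have rc1 : {ae Qc, forall w, rc (dynkin u (a u) ^~ w)}.
  by apply: ae_mono c1 => w; exact: cadlag_rc.
have rc2 : {ae Qc, forall w, rc (dynkin (fun z => u z * u z) (a (fun z => u z * u z)) ^~ w)}.
  by apply: ae_mono c2 => w; exact: cadlag_rc.
have gaE (q : borel (time T)) (w : O) : along s (Gamma a u u) q w = along s (a (fun z => u z * u z)) q w -
    2 * (dynkin u (a u) q w + u (s, x) + pint mu (along s (a u) ^~ w) q) * along s (a u) q w.
  have [qs|sq] := leP (time_val q) (time_val s); first by rewrite !along0// mulr0 subr0.
  by rewrite !along1// dynkinE// (ltW sq) /Gamma; ring.
have NE : {ae Qc, forall w, forall t, dynkin (fun z => u z * u z) (a (fun z => u z * u z)) t w =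
    (dynkin u (a u) t w + u (s, x) + pint mu (along s (a u) ^~ w) t) ^+ 2 - u (s, x) ^+ 2 -
    pint mu (along s (a (fun z => u z * u z)) ^~ w) t}.
  apply/completion_ae; apply: aeW => w t; rewrite !dynkinE//; have [st|ts] := leP (time_val s) (time_val t); first by ring.
  by rewrite !pint_along0 ?(ltW ts)//; ring.
have [iG bG] := bracket_local_martingale clock_atomless usual_completed (jm_dynkin mu0 mu1) rc1 rc2 lt mt lt' mt'
  (drift_along mu1 i1) (drift_along mu2 i2) (fun t => @adapted_along _ t mG) gaE NE.
split; last exact: bG.
by apply/as_integrable_alongE => //; exact/completion_ae.
Qed.

(** The two processes differ by [\int (psi0 - psi1) dV], a local martingale with a density, hence
    zero. As both are cadlag, equality at each time becomes equality at all times. *)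
Lemma dynkin_unique u psi0 psi1 (tau : nat -> O -> option (time T)) (M1 : time T -> O -> R) :
  measurable_fun setT psi0 -> measurable_fun setT psi1 ->
  as_integrable_along V Q psi0 s -> as_integrable_along V Q psi1 s ->
  {ae Qc, forall w, cadlag_from time0 (dynkin u psi0 ^~ w)} ->
  localizing Qc F time0 tau -> (forall n, martingale Qc F time0 (stopped (tau n) (dynkin u psi0))) ->
  martingale Qc F time0 M1 -> {ae Qc, forall w, cadlag_from time0 (M1 ^~ w)} ->
  (forall t, {ae Qc, forall w, M1 t w = dynkin u psi1 t w}) ->
  {ae Qc, forall w, forall t, pint mu (along s (fun z => psi0 z - psi1 z) ^~ w) t = 0} /\
  {ae Qc, forall w, forall t, M1 t w = dynkin u psi0 t w}.
Proof.
move=> m0 m1 i0 i1 c0 lt mt mM1 c1 e1; have uF := usual_completed.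
pose k := fun z => psi0 z - psi1 z.
have mk : measurable_fun setT k by exact: measurable_funB.
have I0 := (as_integrable_alongE V Q s m0).1 i0; have I1 := (as_integrable_alongE V Q s m1).1 i1.
have kE q w : along s k q w = along s psi0 q w - along s psi1 q w by rewrite /along -mulrBr.
have kw w : along s k ^~ w = (fun q => along s psi0 q w - along s psi1 q w) by apply/funext => q.
have ik : as_integrable_along V Q k s.
  by apply/as_integrable_alongE => //; apply: filterS2 I0 I1 => w h1 h2; rewrite kw; exact: pintgB.
have dk := drift_along mk ik.
have I : {ae Qc, forall w, pintg mu (along s psi0 ^~ w) /\ pintg mu (along s psi1 ^~ w)}.
  by apply/completion_ae; apply: filterS2 I0 I1 => w.
have e : {ae Qc, forall w, forall t, M1 t w = dynkin u psi0 t w + pint mu (along s k ^~ w) t}.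
  apply: indistinguishable; first by apply: ae_mono c1 => w; exact: cadlag_rc.
    apply: ae_mono2 c0 (drift_rc clock_atomless dk) => w h1 h2 v t vt vc.
    by apply: cvgD; [exact: (cadlag_rc h1)|exact: h2].
  move=> t; apply: ae_mono2 (e1 t) I => w -> [h1 h2].
  rewrite !dynkinE// kw pintB//; have [st|ts] := leP (time_val s) (time_val t); first by ring.
  by rewrite !pint_along0 ?(ltW ts)//; ring.
have rM1 : {ae Qc, forall w, rc (M1 ^~ w)} by apply: ae_mono c1 => w; exact: cadlag_rc.
have z : {ae Qc, forall w, forall t, pint mu (along s k ^~ w) t = 0}.
  apply: (drift_martingale_eq0 clock_atomless uF dk lt) => n.
  have [stn _ _] := lt.
  have h := mart_lin uF 1 (-1) (optional_stopping uF mM1 rM1 (stn n)) (mt n).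
  apply: (mart_ae uF h) => t; apply: ae_mono e => w h'; rewrite !stoppedE h'; ring.
split; first exact: z.
by apply: ae_mono2 e z => w h1 h2 t; rewrite h1 h2 addr0.
Qed.

End solution.

(** * Extended generator and carre du champ from a fixed starting point *)

Section extended_operators.
Context {R : realType} {T : {posnum R}} {E : completePseudoMetricType R} (hE : hausdorff_space E).
Variables (V : cumulative R R) (cV : clock (T := T) V).
Local Notation spacetime := (borel (time T) * borel E)%type.
Variables (D : set (spacetime -> R)) (a : (spacetime -> R) -> spacetime -> R).
Hypotheses (DA : function_algebra D) (La : linear_operator D a).
Local Notation O := (Omega T E).
Local Notation cf := (@canonical_filtration R T E).
Local Notation mu := (@clock_measure R T V).
Variables (s : time T) (x : E) (Q : probability O R).
Hypothesis sol : solves_from V D a s x Q.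
Local Notation Qc := (completion Q).
Local Notation F := (augmented Q cf).
Implicit Types (phi psi h u : spacetime -> R).

Let uF : usual Qc F. Proof. exact: usual_completed. Qed.
Let mu0 : forall t : borel (time T), mu [set t] = 0. Proof. exact: clock_atomless. Qed.

Lemma pintg_along h : measurable_fun setT h -> as_integrable_along V Q h s ->
  {ae Qc, forall w, pintg mu (along s h ^~ w)}.
Proof. by move=> mh ih; apply/completion_ae; exact/as_integrable_alongE. Qed.

Lemma H20_dynkin u : D u ->
  (\int[Q]_w eintegral_along V (fun z => (`|Gamma a u u z| `^ 1)%:E) s timeT w < +oo)%E ->
  H20 Qc F (dynkin V s x u (a u)).
Proof.
move=> Du; have [mG [iG [rho lrho mrho]]] := dynkin_bracket hE cV DA La sol Du.
have [c0 _] := dynkin_local hE La sol Du.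
have mau : measurable_fun setT (a u) by case: La => h _ _; exact: h.
have mn : measurable_fun setT (fun z => `|Gamma a u u z|) by exact: measurableT_comp.
have jn : jm (fun q w => `|along s (Gamma a u u) q w| : R).
  by have := jm_along s mG => h; exact: (measurableT_comp (@normr_measurable R setT) h).
have -> : (\int[Q]_w eintegral_along V (fun z => (`|Gamma a u u z| `^ 1)%:E) s timeT w)%E =
  (\int[Qc]_w \int[mu]_q `|along s (Gamma a u u) q w|%:E)%E.
  rewrite (@ge0_integral_completion _ O R Q (fun w => \int[mu]_q `|along s (Gamma a u u) q w|%:E)%E); last 2 first.
    apply: (measurable_fun_fubini_tonelli_G (m1 := mu)
      (fun z : borel (time T) * O => `|along s (Gamma a u u) z.1 z.2|%:E)) => //.
    exact/measurable_EFinP.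
    by move=> w; apply: integral_ge0.
  apply: eq_integral => w _.
  rewrite (_ : (fun z => (`|Gamma a u u z| `^ 1)%:E) = fun z => `|Gamma a u u z|%:E); last first.
    by apply/funext => z; rewrite powRr1.
  rewrite (eintegral_alongE _ _ _ mn); apply: eq_integral => q _.
  by rewrite along_norm.
have M0 : {ae Qc, forall w, dynkin V s x u (a u) time0 w = 0}.
  apply/completion_ae; have [s0|s0] := leP (time_val s) (time_val (time0 : time T)); last first.
    by apply: aeW => w; rewrite /dynkin leNgt s0.
  have -> : time0 = s by apply/time_val_inj/le_anti; rewrite s0 time0_le.
  exact: (dynkin_start hE sol u mau).
move=> fin.
have P0 : {ae Qc, forall w, pint mu (along s (Gamma a u u) ^~ w) time0 = 0}.
  by apply/completion_ae; apply: aeW => w; apply: pint_along0; exact: time0_le.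
have [h1 h2] := square_integrable_martingale uF lrho mrho M0 (pintg_along mG iG)
  (measurable_completed_pair (jm_along s mG)) P0 fin.
by split.
Qed.

(** [ext_Gamma] quantifies over all densities and all versions of the martingales. Each version is
    indistinguishable from [dynkin u (a u)], whose bracket is known. *)
Lemma ext_bracket u psi1 psi2 (M1 M2 : time T -> O -> R) : D u ->
  measurable_fun setT psi1 -> as_integrable_along V Q psi1 s ->
  measurable_fun setT psi2 -> as_integrable_along V Q psi2 s ->
  H20 Qc F M1 -> (forall t, {ae Qc, forall w, M1 t w = dynkin V s x u psi1 t w}) ->
  H20 Qc F M2 -> (forall t, {ae Qc, forall w, M2 t w = dynkin V s x u psi2 t w}) ->
  exists2 A, angle_bracket Qc F M1 M2 A &
    {ae Qc, forall w, forall t, time_val s <= time_val t -> A t w = integral_along V (Gamma a u u) s t w}.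
Proof.
move=> Du m1 i1 m2 i2 [mM1 c1 _ _] e1 [mM2 c2 _ _] e2.
have [mG [iG [rho lrho mrho]]] := dynkin_bracket hE cV DA La sol Du.
have [c0 _] := dynkin_local hE La sol Du.
have mau : measurable_fun setT (a u) by case: La => h _ _; exact: h.
have iau : as_integrable_along V Q (a u) s by case: sol => _ /(_ _ Du)[].
have mr n := (mrho n).1.
have [_ E1] := dynkin_unique cV mau m1 iau i1 c0 lrho mr mM1 c1 e1.
have [_ E2] := dynkin_unique cV mau m2 iau i2 c0 lrho mr mM2 c2 e2.
have ig := pintg_along mG iG.
exists (bracket_process mu (along s (Gamma a u u) : time T -> completed Q -> R)).
  exact: (angle_bracket_process mu0 uF ig (fun t => @adapted_along _ _ _ V s Q _ t mG) lrho (fun n => (mrho n).2) c0 E1 E2).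
apply: ae_mono (bracket_processE ig) => w h t _.
by rewrite h integral_alongE.
Qed.

(** The square of one process is compensated twice, by [A] and by [\int Gamma a u u]. The difference
    of the compensators is a local martingale with density [Gamma a u u - h] from [s] on, hence
    zero, and so is its density. *)
Lemma ext_operators_eq u psi h (M1 A : time T -> O -> R) : D u ->
  measurable_fun setT psi -> as_integrable_along V Q psi s ->
  measurable_fun setT h -> as_integrable_along V Q h s ->
  H20 Qc F M1 -> (forall t, {ae Qc, forall w, M1 t w = dynkin V s x u psi t w}) ->
  angle_bracket Qc F M1 M1 A ->
  {ae Qc, forall w, forall t, time_val s <= time_val t -> A t w = integral_along V h s t w} ->
  {ae Qc, forall w, {ae mu, forall q, along s (fun z => a u z - psi z) q w = 0 /\
    along s (fun z => Gamma a u u z - h z) q w = 0}}.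
Proof.
move=> Du m1 i1 mh ih [mM1 c1 _ _] e1 [_ _ _ _ [cN [tau ltau mN]]] AE.
have [mG [iG [rho lrho mrho]]] := dynkin_bracket hE cV DA La sol Du.
have [c0 _] := dynkin_local hE La sol Du.
have mau : measurable_fun setT (a u) by case: La => H _ _; exact: H.
have iau : as_integrable_along V Q (a u) s by case: sol => _ /(_ _ Du)[].
have mr n := (mrho n).1.
have [z1 E1] := dynkin_unique cV mau m1 iau i1 c0 lrho mr mM1 c1 e1.
have ig := pintg_along mG iG; have ih' := pintg_along mh ih.
have igh := ae_and ig ih'.
pose k z := Gamma a u u z - h z.
have mk : measurable_fun setT k by exact: measurable_funB.
have kw w : along s k ^~ w = (fun q => along s (Gamma a u u) q w - along s h q w).
  by apply/funext => q; rewrite /along -mulrBr.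
have ik : as_integrable_along V Q k s.
  by apply/as_integrable_alongE => //; apply/completion_ae; apply: ae_mono igh => w [h1 h2]; rewrite kw; exact: pintgB.
have dk := drift_along mk ik.
pose N1 t w := M1 t w * M1 t w - A t w.
pose N2 t w := dynkin V s x u (a u) t w ^+ 2 - pint mu (along s (Gamma a u u) ^~ w) t.
have rN1 : {ae Qc, forall w, rc (N1 ^~ w)} by apply: ae_mono cN => w; exact: cadlag_rc.
have rN2 : {ae Qc, forall w, rc (N2 ^~ w)}.
  apply: ae_mono2 c0 ig => w /cadlag_rc h1 h2 v t vt vc.
  apply: cvgB; last exact: pint_cvg.
  by rewrite expr2; under eq_fun do rewrite expr2; apply: cvgM; exact: h1.
have [s1 _ _] := ltau; have [s2 _ _] := lrho.
have l12 := localizing_omin uF ltau lrho.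
have mN12 n : martingale Qc F time0 (stopped (fun w => omin (tau n w) (rho n w)) (fun t w => N1 t w - N2 t w)).
  have r1 : {ae Qc, forall w, rc (stopped (tau n) N1 ^~ w)} by apply: ae_mono rN1 => w; exact: rc_stopped.
  have r2 : {ae Qc, forall w, rc (stopped (rho n) N2 ^~ w)} by apply: ae_mono rN2 => w; exact: rc_stopped.
  have h1 := optional_stopping uF (mN n) r1 (s2 n).
  have h2 := optional_stopping uF (mrho n).2 r2 (s1 n).
  apply: (mart_ae uF (mart_lin uF 1 (-1) h1 h2)) => t; apply/completion_ae; apply: aeW => w.
  rewrite !stoppedE capt_omin -(capt_omin (rho n w)) ominC capt_omin.
  by rewrite mul1r mulN1r.
(* [A] is identified with the integral of [h] from [s] on only, so that the difference of
   compensators is expressed by increments from [s], with all times raised to [s]. *)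
have CE : {ae Qc, forall w, forall t, pint mu (along s k ^~ w) t =
    (N1 (tmax t s) w - N2 (tmax t s) w) - (N1 s w - N2 s w)}.
  apply: ae_mono2 (ae_and AE E1) igh => w [h1 h2] [h3 h4] t.
  have N12 r : time_val s <= time_val r -> N1 r w - N2 r w = pint mu (along s k ^~ w) r.
    by move=> sr; rewrite /N1 /N2 h1// h2 integral_alongE// kw pintB//; ring.
  rewrite !N12// ?tmax_val ?le_max ?lexx ?orbT//.
  rewrite (pint_along0 V k (t := s))// subr0; have [st|ts] := leP (time_val s) (time_val t).
    by congr (pint _ _ _); apply/time_val_inj; rewrite tmax_val max_l.
  have -> : tmax t s = s by apply/time_val_inj; rewrite tmax_val max_r// ltW.
  by rewrite !pint_along0// ltW.
have [rho' lrho' mrho'] := local_martingale_restart uF l12 mN12 CE.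
have z2 := drift_martingale_eq0 mu0 uF dk lrho' mrho'.
have m01 : measurable_fun setT (fun z => a u z - psi z) by exact: measurable_funB.
have i01 : as_integrable_along V Q (fun z => a u z - psi z) s.
  have ipsi := (as_integrable_alongE V Q s m1).1 i1; have iau' := (as_integrable_alongE V Q s mau).1 iau.
  apply/as_integrable_alongE => //; apply: filterS2 iau' ipsi => w h1 h2.
  rewrite (_ : along s _ ^~ w = (fun q => along s (a u) q w - along s psi q w)); first exact: pintgB.
  by apply/funext => q; rewrite /along -mulrBr.
have j1 := pintg_along m01 i01; have j2 := pintg_along mk ik.
apply: ae_mono2 (ae_and z1 z2) (ae_and j1 j2) => w [h1 h2] [h3 h4].
exact: filterS2 (pint_eq0_ae h3 h1) (pint_eq0_ae h4 h2) => q.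
Qed.

End extended_operators.

(** * Sets of zero potential *)

Section zero_potential_sets.
Context {R : realType} {T : {posnum R}} {E : completePseudoMetricType R} (V : cumulative R R).
Local Notation spacetime := (borel (time T) * borel E)%type.
Local Notation O := (Omega T E).
Local Notation mu := (@clock_measure R T V).

(** The double integral of a nonnegative function vanishes exactly when the function vanishes at
    almost every time on almost every path. In this form several exceptional sets can be combined
    path by path. *)
Lemma zero_potential_ae (Q : probability O R) (s : time T) (A : set spacetime) : measurable A ->
  (\int[Q]_w eintegral_along V (fun z => (\1_A z)%:E) s timeT w = 0)%E <->
  {ae Q, forall w, {ae mu, forall q, time_val s < time_val q -> ~ A (q, (w : O) q)}}.
Proof.
move=> mA; have m1 : measurable_fun setT (\1_A : spacetime -> R) by exact: measurable_indic.
have jA := jm_along s m1.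
have A0 q w : 0 <= along s (\1_A : spacetime -> R) q w.
  by apply: mulr_ge0; rewrite indicE; exact: ler0n.
have AE q (w : O) : along s (\1_A : spacetime -> R) q w = 0 <-> (time_val s < time_val q -> ~ A (q, w q)).
  have [qs|sq] := leP (time_val q) (time_val s); first by rewrite along0.
  rewrite along1// indicE; split=> [h _ Aq|h]; last by rewrite memNset//; exact: h.
  by move: h; rewrite mem_set// => /eqP; rewrite oner_eq0.
have mI : measurable_fun setT (fun w : O => \int[mu]_q (along s (\1_A : spacetime -> R) q w)%:E)%E.
  apply: (measurable_fun_fubini_tonelli_G (m1 := mu)
    (fun z : borel (time T) * O => (along s (\1_A : spacetime -> R) z.1 z.2)%:E)) => //.
    exact/measurable_EFinP.
  by move=> z; rewrite lee_fin.
have mw (w : O) : measurable_fun setT (fun q : borel (time T) => (along s (\1_A : spacetime -> R) q w)%:E).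
  by apply/measurable_EFinP; exact: (jm_w w jA).
have inner (w : O) : (\int[mu]_q (along s (\1_A : spacetime -> R) q w)%:E = 0)%E <->
    {ae mu, forall q, time_val s < time_val q -> ~ A (q, w q)}.
  rewrite (eq_integral (fun q : borel (time T) => `|(along s (\1_A : spacetime -> R) q w)%:E|)%E); last first.
    by move=> q _; rewrite gee0_abs ?lee_fin.
  rewrite (ae_eq_integral_abs mu measurableT (mw w)).
  split; apply: ae_mono => q; first by move=> /(_ I) [] /AE.
  by move=> /AE h _; rewrite h.
under eq_integral do rewrite (eintegral_alongE V s _ m1).
rewrite (eq_integral (fun w : O => `|\int[mu]_q (along s (\1_A : spacetime -> R) q w)%:E|)%E); last first.
  by move=> w _; rewrite gee0_abs//; apply: integral_ge0 => q _; rewrite lee_fin.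
rewrite (ae_eq_integral_abs Q measurableT mI).
split; apply: ae_mono => w; first by move=> /(_ I) /inner.
by move=> /inner h _; rewrite h.
Qed.

Lemma measurable_neq (h k : spacetime -> R) : measurable_fun setT h -> measurable_fun setT k ->
  measurable [set z | h z <> k z].
Proof.
move=> mh mk; rewrite (_ : mkset _ = setT `&` (fun z => h z - k z) @^-1` (~` [set 0])).
  by apply: (measurable_funB mh mk) => //; exact: measurableC.
rewrite setTI; apply/seteqP; split => z /= hk e; apply: hk; first exact/subr0_eq.
by rewrite e subrr.
Qed.

End zero_potential_sets.

(** * Classical and martingale solutions *)

Section solutions.
Context {R : realType} {T : {posnum R}} {E : completePseudoMetricType R} (hE : hausdorff_space E).
Variables (V : cumulative R R) (cV : clock (T := T) V).
Local Notation spacetime := (borel (time T) * borel E)%type.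
Variables (D : set (spacetime -> R)) (a : (spacetime -> R) -> spacetime -> R).
Hypotheses (DA : function_algebra D) (La : linear_operator D a).
Variable P : time T -> E -> probability (Omega T E) R.
Hypothesis sol : solves_martingale_problem V D a P.
Variables (f : spacetime * R * R -> R) (g : E -> R) (mf : measurable_fun setT f).
Implicit Types (u : spacetime -> R).

Let uF s x : usual (completion (P s x)) (augmented (P s x) (@canonical_filtration R T E)).
Proof. exact: usual_completed. Qed.

Let mDa u : D u -> [/\ measurable_fun setT u, measurable_fun setT (a u) & measurable_fun setT (Gamma a u u)].
Proof.
move=> Du; have [mD _ _ _ DM] := DA; have [ma _ _] := La; have Duu := DM _ _ Du Du.
split; [exact: mD|exact: ma|].
apply: measurable_funB; [apply: measurable_funB => //; first exact: ma|];
  by apply: measurable_funM; [exact: mD|exact: ma].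
Qed.

Let ext_ae s x phi psi M : ext_martingale V P s x phi psi M ->
  H20 (completion (P s x)) (augmented (P s x) (@canonical_filtration R T E)) M /\
  forall t, {ae completion (P s x), forall w, M t w = dynkin V s x phi psi t w}.
Proof.
by move=> [h1 h2]; split; [exact/(H20_completion (uF s x))|move=> t; apply/completion_ae; exact: h2].
Qed.

Lemma classical_martingale_solution u : classical_solution D a f g u -> LpX V P 1 (Gamma a u u) ->
  martingale_solution V P f g u.
Proof.
move=> [Du pde ug] [_ GL]; have [mu0 mau mG] := mDa Du.
have ia s x : as_integrable_along V (P s x) (a u) s by have [_ /(_ _ Du)[]] := sol s x.
have ea : ext_a V P u (a u).
  split => // s x; exists (dynkin V s x u (a u)); split; last by move=> t; exact: aeW.
  by apply/(H20_completion (uF s x)); exact: (H20_dynkin hE cV DA La (sol s x) Du (GL s x)).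
have du : ext_domain V P u by exists (a u).
(* With these representatives of the two classes the equation holds at every point, and the
   exceptional set is empty. *)
split => //; exists (a u), (Gamma a u u); split => //.
  split => //.
    by split => // s x; have [_ [iG _]] := dynkin_bracket hE cV DA La (sol s x) Du.
  move=> psi1 psi2 [_ [m1 i1] _] [_ [m2 i2] _] s x M1 M2 /ext_ae[h1 e1] /ext_ae[h2 e2].
  have [A hA AE] := ext_bracket hE cV DA La (sol s x) Du m1 (i1 s x) m2 (i2 s x) h1 e1 h2 e2.
  by exists A; [exact/(angle_bracket_completion (uF s x))|exact/completion_ae].
rewrite /eq_zp (_ : mkset _ = set0).
  split => // s x; apply/zero_potential_ae => //.
  by apply: aeW => w; apply: aeW => q _.
apply/seteqP; split => z //= h; apply: h; apply/eqP.
by rewrite -subr_eq0 opprK pde.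
Qed.

Lemma martingale_classical_solution u : martingale_solution V P f g u -> D u ->
  zero_potential V P [set z | a u z + f (z, u z, Num.sqrt (Gamma a u u z)) <> 0] /\
  forall x, u (timeT, x) = g x.
Proof.
move=> [_ [psi [h [ea eG [_ zp]]]] ug] Du; split; last exact: ug.
have [mu0 mau mG] := mDa Du.
have [_ [mpsi ipsi] hM] := ea; have [_ _ [mh ih] hG] := eG.
have msq : measurable_fun setT (fun z => f (z, u z, Num.sqrt (Gamma a u u z))).
  apply: (measurableT_comp mf); apply: measurable_fun_pair; first exact: measurable_fun_pair.
  by apply: (measurableT_comp _ mG); apply: continuous_measurable_fun; exact: sqrt_continuous.
have msh : measurable_fun setT (fun z => - f (z, u z, Num.sqrt (h z))).
  apply: measurableT_comp => //.
  apply: (measurableT_comp mf); apply: measurable_fun_pair; first exact: measurable_fun_pair.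
  by apply: (measurableT_comp _ mh); apply: continuous_measurable_fun; exact: sqrt_continuous.
have mZ : measurable [set z | a u z + f (z, u z, Num.sqrt (Gamma a u u z)) <> 0].
  by apply: measurable_neq; [exact: measurable_funD|exact: measurable_cst].
split; first exact: mZ.
move=> s x; apply/(zero_potential_ae V (P s x) s mZ).
have [M1 M1E] := hM s x; have [h1 e1] := ext_ae M1E.
have [A hA AE] := hG _ _ ea ea s x _ _ M1E M1E.
have bA := (angle_bracket_completion (uF s x) M1 M1 A).2 hA.
have AE' := (completion_ae (P s x) _).2 AE.
have H := ext_operators_eq hE cV DA La (sol s x) Du mpsi (ipsi s x) mh (ih s x) h1 e1 bA AE'.
have H' := (zero_potential_ae V (P s x) s (measurable_neq mpsi msh)).1 (zp s x).
apply: ae_mono2 H' ((completion_ae (P s x) _).1 H) => w.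
apply: ae_mono2 => q H1 [H2 H3] sq.
(* At such a point [psi] is [- f (., u, sqrt h)], [a u] is [psi] and [Gamma a u u] is [h]; the
   equation follows by substitution. *)
have := H1 sq; rewrite /= => /contrapT e.
move: H2 H3; rewrite !along1// => /eqP; rewrite subr_eq0 => /eqP E2 /eqP; rewrite subr_eq0 => /eqP E3.
by rewrite E2 E3 e addNr; apply.
Qed.

End solutions.

Theorem proposition5p20 (R : realType) (T : {posnum R})
  (E : completePseudoMetricType R) (E_polish : polish E)
  (V : cumulative R R) (V_clock : clock (T := T) V)
  (D : set (borel (time T) * borel E -> R))
  (a : (borel (time T) * borel E -> R) -> borel (time T) * borel E -> R)
  (D_algebra : function_algebra D) (a_linear : linear_operator D a)
  (p : time T -> E -> time T -> probability (borel E) R)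
  (p_transition : transition_function p)
  (P : time T -> E -> probability (Omega T E) R)
  (P_markov : canonical_markov_class p P)
  (P_solves : solves_martingale_problem V D a P)
  (P_well_posed : well_posed V D a P)
  (g : E -> R) (g_borel : measurable_fun setT (g : borel E -> R))
  (f : borel (time T) * borel E * R * R -> R) (f_borel : measurable_fun setT f)
  (g_L2 : forall s x, L2 (P s x) (fun w => g (w timeT)))
  (f0_L2 : LpX V P 2 (fun z => f (z, 0, 0)))
  (f_lipschitz : exists KY KZ : R, [/\ 0 < KY, 0 < KZ &
     forall t x y y' z z', `|f (t, x, y, z) - f (t, x, y', z')|
       <= KY * `|y - y'| + KZ * `|z - z'|]) :
  (forall u : borel (time T) * borel E -> R,
     classical_solution D a f g u -> LpX V P 1 (Gamma a u u) ->
     martingale_solution V P f g u) /\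
  (forall u : borel (time T) * borel E -> R,
     martingale_solution V P f g u -> D u ->
     zero_potential V P
       [set z | a u z + f (z, u z, Num.sqrt (Gamma a u u z)) <> 0] /\
     forall x, u (timeT, x) = g x).
Proof.
have hE := E_polish.1; split=> u.
  exact: (classical_martingale_solution hE V_clock D_algebra a_linear P_solves).
exact: (martingale_classical_solution hE V_clock D_algebra a_linear P_solves f_borel).
Qed.
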